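(* The map $(c,\mathbf t)\mapsto$ (distribution of $c+\mathcal S_{\mathbf t}$) is a bijection from $\mathbb R\times\widetilde\ell_2$ onto the set of generalized uniform sum distributions. In particular, if $\mathbf t,\mathbf u\in\widetilde\ell_2$ with $\mathbf t\ne\mathbf u$, then $\mathcal S_{\mathbf t}$ and $\mathcal S_{\mathbf u}$ have different distributions. Furthermore, for nonzero $\mathbf t,\mathbf u\in\widetilde\ell_2$, $\mathcal S_{\mathbf t}^*$ and $\mathcal S_{\mathbf u}^*$ have the same distribution if and only if $\mathbf t$ and $\mathbf u$ differ by a scalar multiple.
   Context: A generalized uniform sum distribution is the distribution of a random variable with finite mean and variance given as a countable sum of independent continuous uniform random variables. $\widetilde\ell_2=\{\mathbf t=(t_1,t_2,\dots):t_1\ge t_2\ge\dots\ge0,\ \sum_kt_k^2<\infty\}$. For $\mathbf t\in\widetilde\ell_2$, $\mathcal S_{\mathbf t}=\sum_{k\ge1}\mathcal U[-t_k/2,t_k/2]$ with independent summands (this converges almost surely). $\mathcal X^*=(\mathcal X-\mu)/\sigma$ denotes standardization. *)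

(* Defs.v *)
From HB Require Import structures.
From mathcomp Require Import all_boot all_order all_algebra finmap.
From mathcomp Require Import all_classical all_reals all_analysis.

Set Implicit Arguments.
Unset Strict Implicit.
Unset Printing Implicit Defensive.

Import Order.TTheory GRing.Theory Num.Theory.
Import numFieldNormedType.Exports.

Local Open Scope classical_set_scope.
Local Open Scope ring_scope.

Definition borel_set (R : realType) : Type := {A : set R | measurable A}.

(* A library measure is a total function on [set T] whose values outside the
   sigma-algebra are unconstrained, so distributions are compared as functions
   on Borel sets only. *)
Definition law (R : realType) (d : measure_display) (T : measurableType d)
    (P : probability T R) (X : T -> R) : borel_set R -> \bar R :=
  fun A => pushforward P X (sval A).

Definition mutually_independent (R : realType) (d : measure_display)
    (T : measurableType d) (P : probability T R) (X : nat -> {RV P >-> R}) :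
    Prop :=
  forall (J : {fset nat}) (A : nat -> set R), (forall k, measurable (A k)) ->
    P (\big[setI/setT]_(k <- J) (X k @^-1` A k)) =
    (\prod_(k <- J) P (X k @^-1` A k))%E.

(* U[a, a] is the point mass at a; this case is needed because entries of t
   may vanish. *)
Definition uniform_on (R : realType) (d : measure_display)
    (T : measurableType d) (P : probability T R) (a b : R)
    (X : {RV P >-> R}) : Prop :=
  [/\ a <= b,
      forall (ab : a < b) (A : set R), measurable A ->
        distribution P X A = uniform_prob ab A &
      a = b -> forall A : set R, measurable A ->
        distribution P X A = \d_a A].

(* S is (a version of) the almost sure sum of independent U[a_k, b_k].
   Finite sums are the case a_k = b_k = 0 for all large k. *)
Definition is_uniform_sum (R : realType) (d : measure_display)
    (T : measurableType d) (P : probability T R) (a b : nat -> R)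
    (S : {RV P >-> R}) : Prop :=
  exists X : nat -> {RV P >-> R},
    [/\ mutually_independent X,
        forall k, uniform_on (a k) (b k) (X k) &
        {ae P, forall w, (fun n => \sum_(0 <= k < n) X k w) @ \oo --> S w}].

Definition generalized_uniform_sum_laws (R : realType) :
    set (borel_set R -> \bar R) :=
  [set m | exists (d : measure_display) (T : measurableType d)
             (P : probability T R) (a b : nat -> R) (S : {RV P >-> R}),
     [/\ is_uniform_sum a b S,
         P.-integrable [set: T] (EFin \o S),
         ('V_P[S] < +oo)%E &
         m = law P S]].

(* t_1, t_2, ... is indexed from 0. *)
Definition l2_tilde (R : realType) : set (nat -> R) :=
  [set t : nat -> R | [/\ forall k, t k.+1 <= t k,
               forall k, 0 <= t k &
               cvgn (series (fun k => t k ^+ 2))]].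

Definition is_calS (R : realType) (d : measure_display) (T : measurableType d)
    (P : probability T R) (t : nat -> R) (S : {RV P >-> R}) : Prop :=
  is_uniform_sum (fun k => - (t k / 2)) (fun k => t k / 2) S.

(* The laws of c + S_t over all its realizations on all probability spaces. *)
Definition shifted_calS_laws (R : realType) (c : R) (t : nat -> R) :
    set (borel_set R -> \bar R) :=
  [set m | exists (d : measure_display) (T : measurableType d)
             (P : probability T R) (S : {RV P >-> R}),
     is_calS t S /\ m = law P (fun w => c + S w)].

(* The distribution of c + S_t, by definite description. The junk value 0,
   taken when S_t has no realization or the law depends on the realization, is
   not a probability law, hence never in [generalized_uniform_sum_laws]. *)
Definition shifted_calS_law (R : realType) (c : R) (t : nat -> R) :
    borel_set R -> \bar R :=
  xget (fun=> 0%E) [set m | shifted_calS_laws c t = [set m]].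

Definition standardize (R : realType) (d : measure_display)
    (T : measurableType d) (P : probability T R) (X : T -> R) : T -> R :=
  fun w => (X w - fine 'E_P[X]) / Num.sqrt (fine 'V_P[X]).

(* Main.v *)
(** The mean of cos (s S + z) for a sum S of independent U[a_k, b_k] is
    cos (s M + z) times the product of sinc (s (b_k - a_k) / 2), M being the sum
    of the midpoints; everything is read off this formula.

    Injectivity.  Near s = 0 the product is positive, so the phase determines
    the shift c, and then the whole product is determined by the law.  If t and
    u first differ at n, with t_n > u_n, the common factors k < n cancel just to
    the right of s = 2 pi / t_n; there the product of t tends to 0, while the
    product of u stays away from 0 since its remaining factors have their
    first zeros further to the right.

    Surjectivity.  If S has mean m and variance V, then
    1 - s^2 V / 2 <= E cos (s (S - m)) <= prod_(k < n) |sinc (s (b_k - a_k) / 2)|,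
    which for small s bounds the partial sums of (b_k - a_k)^2.  The centered
    summands then converge almost surely by Kolmogorov's inequality, hence so
    does the series of midpoints, and a greedy argument rearranges the lengths
    decreasingly; in L^2 the rearranged series has the same sum.

    Existence.  The even and the odd binary digits of a uniform variable on
    [0, 1] are independent and uniform; iterating this splitting yields an
    i.i.d. sequence of uniform variables. *)
Require Import Defs.
From HB Require Import structures.
From mathcomp Require Import all_boot all_order all_algebra finmap.
From mathcomp Require Import all_classical all_reals all_analysis.
From mathcomp Require Import ring lra measurable_realfun.

Set Implicit Arguments.
Unset Strict Implicit.
Unset Printing Implicit Defensive.

Import Order.TTheory GRing.Theory Num.Theory.
Import numFieldNormedType.Exports.

Local Open Scope classical_set_scope.
Local Open Scope ring_scope.

(** * Measures determined by Lipschitz functions *)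

(** Cosines with a free phase z replace complex exponentials: varying z recovers the sine part, and
    in inductions over the summands z absorbs the midpoint of the variable just integrated out.

    Test functions are Lipschitz with values in [0, 1]. This class determines finite measures and is
    stable under x / 2 and (x + 1) / 2, which halve the Lipschitz constant; independence of the even
    and odd digits thus becomes a contraction estimate instead of a count of digit blocks.

    The given series converges in a prescribed order, and neither its midpoints nor its summands
    need be absolutely summable, so the lengths cannot simply be sorted. Centering splits off the
    deterministic series of midpoints, which keeps its order, and leaves a square summable
    orthogonal part, which tolerates reordering. The reordering need not be a permutation: if
    infinitely many lengths are positive, the zero lengths are never reached, so only the positive
    ones are required to occur. *)

Definition unit_lipschitz (R : realType) (L : R) (f : R -> R) : Prop :=
  [/\ 0 <= L, forall x, 0 <= f x <= 1 &
      forall x y, `|f x - f y| <= L * `|x - y|].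

Lemma unit_lipschitz_continuous (R : realType) (L : R) (f : R -> R) :
  unit_lipschitz L f -> continuous f.
Proof.
move=> [L0 _ Lf] x; apply/cvgrPdist_lt => e e0.
have L1 : 0 < L + 1 by rewrite ltr_pwDr.
have e1 : 0 < e / (L + 1) by exact: divr_gt0.
near=> y; rewrite (le_lt_trans (Lf _ _))//.
apply: (@le_lt_trans _ _ ((L + 1) * `|x - y|)).
  by rewrite ler_wpM2r// lerDl.
rewrite mulrC -ltr_pdivlMr//.
Unshelve. all: by end_near. Qed.

(** Zero at x itself, so that the increasing limit in n is the indicator of the open ray, whose
    measure is then reached by monotone convergence. *)
Definition ramp (R : realType) (x : R) (n : nat) (y : R) : R :=
  Num.min 1 (Num.max 0 (n%:R * (y - x))).

Lemma unit_lipschitz_ramp (R : realType) (x : R) n :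
  unit_lipschitz n%:R (ramp x n).
Proof.
split=> // y.
  by rewrite /ramp le_min ler01 le_max lexx/= ge_min lexx.
move=> z; rewrite -[in leRHS](ger0_norm (ler0n R n)) -normrM.
have -> : n%:R * (y - z) = n%:R * (y - x) - n%:R * (z - x) by ring.
rewrite /ramp; set a := n%:R * _; set b := n%:R * _.
have h : `|a - b| >= a - b /\ `|a - b| >= b - a.
  by split; [exact: ler_norm|rewrite distrC ler_norm].
case: h; set c := `|a - b|; clearbody c => h1 h2; rewrite ler_norml.
rewrite /Num.min /Num.max.
by repeat case: ifPn; rewrite -?leNgt => *; apply/andP; split; lra.
Qed.

Lemma ramp_nondecreasing (R : realType) (x y : R) (m n : nat) :
  (m <= n)%N -> ramp x m y <= ramp x n y.
Proof.
move=> mn; rewrite /ramp le_min2//; have [yx|yx] := lerP (y - x) 0.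
  by rewrite (max_idPl _) ?le_max ?lexx// mulr_ge0_le0.
by rewrite le_max2// ler_wpM2r ?ler_nat// ltW.
Qed.

Lemma ramp_cvg (R : realType) (x y : R) :
  ramp x n y @[n --> \oo] --> (\1_(`]x, +oo[%classic) y : R).
Proof.
apply: cvg_near_cst; rewrite indicE.
case: (boolP (y \in _)); rewrite /= ?notin_setE ?inE/= in_itv/= andbT.
  move=> xy; near=> n; rewrite /ramp.
  have ? : 1 <= n%:R * (y - x).
    rewrite -ler_pdivrMr ?subr_gt0//.
    near: n; exact: nbhs_infty_ger.
  by rewrite (max_idPr _) ?(min_idPl _)// (le_trans ler01).
move=> /negP; rewrite -leNgt => yx.
apply: nearW => n; rewrite /ramp (max_idPl _) ?(min_idPr _)//.
by rewrite mulr_ge0_le0// subr_le0.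
Unshelve. all: by end_near. Qed.

(** Open rays form a pi-system generating the Borel sets. The whole line is not one of them, so
    finiteness is used on the exhausting rays []-k, +oo[]. *)
Lemma measure_unique_rays (R : realType) (m1 m2 : {measure set R -> \bar R}) :
  (m1 setT < +oo)%E ->
  (forall x : R, m1 `]x, +oo[%classic = m2 `]x, +oo[%classic) ->
  forall A, measurable A -> m1 A = m2 A.
Proof.
move=> m1oo m12 A mA.
apply: (measure_unique (@RGenOInfty.G R) (fun k => `]- k%:R, +oo[%classic)) => //.
- exact: RGenOInfty.measurableE.
- move=> _ _ [x ->] [y ->]; exists (Num.max x y).
  apply/seteqP; split=> z /=; rewrite !in_itv/= !andbT gt_max.
    by move=> [-> ->].
  by move=> /andP.
- by move=> k; exists (- k%:R).
- apply/seteqP; split=> // z _.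
  exists (Num.bound `|z|) => //=; rewrite in_itv/= andbT ltrNl.
  by rewrite (le_lt_trans (ler_norm _))// normrN archi_boundP.
- by move=> _ [x ->]; exact: m12.
- by move=> k; apply: le_lt_trans m1oo; apply: le_measure; rewrite ?inE.
Qed.

Lemma measure_unique_lipschitz (R : realType)
    (m1 m2 : {measure set R -> \bar R}) :
  (m1 setT < +oo)%E ->
  (forall L f, unit_lipschitz L f ->
    (\int[m1]_x (f x)%:E = \int[m2]_x (f x)%:E)%E) ->
  forall A, measurable A -> m1 A = m2 A.
Proof.
move=> m1oo m12; apply: measure_unique_rays => // x.
have key (m : {measure set R -> \bar R}) :
    (\int[m]_y (ramp x n y)%:E)%E @[n --> \oo] --> m `]x, +oo[%classic.
  rewrite -[X in m X]setIT -integral_indic//.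
  rewrite (eq_integral (fun y => limn (fun n => (ramp x n y)%:E))).
    apply: cvg_monotone_convergence => //.
  + move=> n; apply/measurable_EFinP; apply: continuous_measurable_fun.
    exact: unit_lipschitz_continuous (unit_lipschitz_ramp x n).
  + move=> n y _; rewrite lee_fin.
    by have [_ /(_ y) /andP[]] := unit_lipschitz_ramp x n.
  + by move=> y _ a b ab; rewrite lee_fin ramp_nondecreasing.
  + move=> y _; apply/esym/cvg_lim => //.
    by apply: cvg_EFin; [exact: nearW|exact: ramp_cvg].
have := key m1.
rewrite (eq_cvg _ _ (fun n => m12 _ _ (unit_lipschitz_ramp x n))).
by move=> /cvg_unique; apply => //; exact: key.
Qed.

(* [uniform_prob] lives on [measurableTypeR R], whose measurable sets are those
   of [R] but whose display differs; this transports it to [R]. *)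
Definition uniform_law (R : realType) (a b : R) (ab : a < b) :
    probability R R :=
  distribution (uniform_prob ab)
    (@mfun_Sub _ _ (measurableTypeR R) R idfun
      (mem_set (@measurable_id _ (measurableTypeR R) setT))).

Lemma uniform_lawE (R : realType) (a b : R) (ab : a < b) (A : set R) :
  uniform_law ab A = uniform_prob ab A.
Proof. by []. Qed.

Lemma ge0_integral_uniform_law (R : realType) (a b : R) (ab : a < b)
    (f : R -> \bar R) :
  measurable_fun setT f -> (forall x, 0 <= f x)%E ->
  (\int[uniform_law ab]_x f x =
   (b - a)^-1%:E * \int[lebesgue_measure]_(x in `[a, b]) f x)%E.
Proof.
move=> mf f0; rewrite /uniform_law ge0_integral_distribution//=.
exact: integral_uniform.
Qed.

Lemma lebesgue_integral_affine (R : realType) (a b c d : R) (f : R -> R) :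
  a < b -> 0 < c -> continuous f ->
  (\int[lebesgue_measure]_(x in `[(c * a + d)%R, (c * b + d)%R]) (f x)%:E =
   c%:E * \int[lebesgue_measure]_(x in `[a, b]) (f (c * x + d)%R)%:E)%E.
Proof.
move=> ab c0 cf.
have dF x : is_derive (x : R) 1 (fun x : R => c * x + d) c.
  have -> : (fun x => c * x + d) = c *: (id : R -> R) + cst d by [].
  by apply: is_derive_eq; rewrite addr0 /GRing.scale/= mulr1.
have cF : continuous (fun x : R => c * x + d).
  by move=> x; apply: cvgD; [apply: cvgM; [exact: cvg_cst|exact: cvg_id]|exact: cvg_cst].
have F'E : derive1 (fun x : R => c * x + d) = cst c.
  by apply/funext => x; rewrite derive1E derive_val.
rewrite (@integration_by_substitution_increasing R (fun x : R => c * x + d) f) //.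
- rewrite F'E -integralZl//.
  + by apply: eq_integral => x _; rewrite -EFinM /= mulrC.
  + apply: continuous_compact_integrable; first exact: segment_compact.
    apply: continuous_subspaceT => x.
    by apply: continuous_comp; [exact: cF|exact: cf].
- exact: ltW.
- by move=> x y _ _ xy; rewrite ltrD2r ltr_pM2l.
- by rewrite F'E => x _; exact: cvg_cst.
- by rewrite F'E; exact: is_cvg_cst.
- by rewrite F'E; exact: is_cvg_cst.
- split => //.
  + by apply: cvg_at_right_filter; exact: cF.
  + by apply: cvg_at_left_filter; exact: cF.
- exact: continuous_subspaceT.
Qed.

(** Substitution is done for continuous integrands, hence the detour through Lipschitz functions
    instead of a direct argument on sets. *)
Lemma uniform_law_affine (R : realType) (a b c d : R) (ab : a < b)
    (ab' : c * a + d < c * b + d) (c0 : 0 < c) (A : set R) : measurable A ->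
  uniform_law ab [set x | A (c * x + d)] = uniform_law ab' A.
Proof.
move=> mA.
have mF : measurable_fun setT (fun x : R => c * x + d).
  apply: measurable_funD => //; exact: measurable_funM.
pose F : {mfun R >-> R} := mfun_Sub (mem_set mF).
apply: (@measure_unique_lipschitz R (distribution (uniform_law ab) F)) => //.
  by rewrite (le_lt_trans (probability_le1 _ _)) ?ltry.
move=> L f Lf; have cf := unit_lipschitz_continuous Lf.
have mf : measurable_fun setT (EFin \o f).
  by apply/measurable_EFinP; exact: continuous_measurable_fun.
have f0 x : (0 <= (f x)%:E)%E by case: Lf => _ /(_ x)/andP[].
rewrite ge0_integral_distribution// !ge0_integral_uniform_law//; last 2 first.
- by apply: measurableT_comp.
- by move=> x; exact: f0.
rewrite lebesgue_integral_affine//= muleA -EFinM; congr (_%:E * _)%E.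
by field; lra.
Qed.

(** * Bounded random variables and uniform laws *)

Definition bounded_mfun (d : measure_display) (T : measurableType d)
    (R : realType) (f : T -> R) : Prop :=
  measurable_fun setT f /\ exists M, forall x, `|f x| <= M.

Lemma bounded_mfun_integrable (d : measure_display) (T : measurableType d)
    (R : realType) (P : probability T R) (f : T -> R) :
  bounded_mfun f -> P.-integrable setT (EFin \o f).
Proof.
move=> [mf [M fM]]; apply: measurable_bounded_integrable => //.
  by rewrite (le_lt_trans (probability_le1 P measurableT))// ltry.
exists M; split; first by rewrite num_real.
by move=> y /ltW My x _ /=; exact: le_trans (fM x) My.
Qed.

Lemma bounded_mfun_cst (d : measure_display) (T : measurableType d)
    (R : realType) (c : R) : bounded_mfun ((fun=> c) : T -> R).
Proof. by split=> //; exists `|c|. Qed.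

Lemma bounded_mfunD (d : measure_display) (T : measurableType d)
    (R : realType) (f g : T -> R) :
  bounded_mfun f -> bounded_mfun g -> bounded_mfun (fun x => f x + g x).
Proof.
move=> [mf [M fM]] [mg [N gN]]; split; first exact: measurable_funD.
exists (M + N) => x; rewrite (le_trans (ler_normD _ _))//; exact: lerD.
Qed.

Lemma bounded_mfunM (d : measure_display) (T : measurableType d)
    (R : realType) (f g : T -> R) :
  bounded_mfun f -> bounded_mfun g -> bounded_mfun (fun x => f x * g x).
Proof.
move=> [mf [M fM]] [mg [N gN]]; split; first exact: measurable_funM.
exists (M * N) => x; rewrite normrM; exact: ler_pM.
Qed.

Lemma bounded_mfun_comp (d : measure_display) (T : measurableType d)
    (d' : measure_display) (T' : measurableType d')
    (R : realType) (f : T' -> R) (g : T -> T') :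
  bounded_mfun f -> measurable_fun setT g -> bounded_mfun (fun x => f (g x)).
Proof.
move=> [mf [M fM]] mg; split; first exact: measurableT_comp.
by exists M.
Qed.

Lemma unit_lipschitz_bounded_mfun (R : realType) (L : R) (f : R -> R) :
  unit_lipschitz L f -> bounded_mfun f.
Proof.
move=> Lf; split.
  exact: continuous_measurable_fun (unit_lipschitz_continuous Lf).
by exists 1 => x; case: Lf => _ /(_ x)/andP[? ?] _; rewrite ger0_norm.
Qed.

Lemma Rintegral_prob_cst (d : measure_display) (T : measurableType d)
    (R : realType) (P : probability T R) (c : R) :
  \int[P]_(x in setT) c = c.
Proof.
rewrite /Rintegral integral_cst//=; transitivity (fine (c%:E * 1)%E).
  by congr (fine (_ * _)%E); exact: probability_setT.
by rewrite mule1.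
Qed.

Lemma Rintegral_EFin (d : measure_display) (T : measurableType d)
    (R : realType) (P : probability T R) (f : T -> R) : bounded_mfun f ->
  (\int[P]_x f x)%:E = (\int[P]_x (f x)%:E)%E.
Proof.
by move=> bf; rewrite fineK// integrable_fin_num// bounded_mfun_integrable.
Qed.

Lemma normr_Rintegral_sub (d : measure_display) (T : measurableType d)
    (R : realType) (P : probability T R) (f : T -> R) (c e : R) :
  0 <= e -> bounded_mfun f -> {ae P, forall x, `|f x - c| <= e} ->
  `|\int[P]_x f x - c| <= e.
Proof.
move=> e0 bf fe.
have bc : bounded_mfun (fun x => f x - c).
  by apply: bounded_mfunD => //; exact: bounded_mfun_cst.
have -> : \int[P]_x f x - c = \int[P]_x (f x - c).
  rewrite RintegralB ?Rintegral_prob_cst//; apply: bounded_mfun_integrable => //.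
  exact: bounded_mfun_cst.
apply: (le_trans (le_normr_Rintegral _ _)) => //.
  exact: bounded_mfun_integrable.
rewrite -[leRHS](Rintegral_prob_cst P e).
have bn : bounded_mfun (fun x => `|f x - c|).
  case: bc => mc [M fM]; split; first exact: measurableT_comp.
  by exists M => x; rewrite normr_id.
rewrite -lee_fin !Rintegral_EFin//; last exact: bounded_mfun_cst.
apply: ae_ge0_le_integral => //.
- by apply/measurable_EFinP; case: bn.
- by apply: filterS fe => x fe _; rewrite lee_fin.
Qed.

Lemma bounded_convergence (d : measure_display) (T : measurableType d)
    (R : realType) (P : probability T R) (f_ : nat -> T -> R) (f : T -> R)
    (M : R) :
  (forall n, measurable_fun setT (f_ n)) -> measurable_fun setT f ->
  (forall n x, `|f_ n x| <= M) -> {ae P, forall x, f_ n x @[n --> \oo] --> f x} ->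
  \int[P]_x f_ n x @[n --> \oo] --> \int[P]_x f x.
Proof.
move=> mf_ mf fM f_f.
have [//||||||fi _ h] := @dominated_convergence _ _ _ P setT _
    (fun n x => (f_ n x)%:E) (EFin \o f) (fun=> M%:E).
- by move=> n; exact/measurable_EFinP.
- exact/measurable_EFinP.
- by apply: filterS f_f => x fx _; apply: cvg_EFin; [exact: nearW|].
- by apply: bounded_mfun_integrable; exact: bounded_mfun_cst.
- by apply: aeW => x n _; rewrite lee_fin.
apply: fine_cvg; rewrite fineK; last exact: integrable_fin_num.
exact: h.
Qed.

(** The endpoint 1 has to be discarded: [half_map false 1] is 1/2, whose first bit is 1, so the
    digit identities below fail there. *)
Lemma uniform_law01_ae (R : realType) :
  {ae uniform_law (@ltr01 R), forall x : R, 0 <= x < 1}.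
Proof.
exists (~` `[0, 1[%classic); split.
- exact: measurableC.
- rewrite uniform_lawE /uniform_prob.
  rewrite integral_uniform_pdf.
  have -> : ~` `[0, 1[%classic `&` `[0, 1] = [set 1 : R].
    apply/seteqP; split=> x /=; rewrite !in_itv/=.
      move=> [/negP + /andP[x0 x1]]; rewrite x0/= -leNgt => ?.
      by apply/eqP; rewrite eq_le x1.
    by move=> ->; rewrite ltxx ler01 lexx andbF; split.
  by rewrite integral_set1.
- by move=> x /= /negP h; rewrite in_itv/=; exact/negP.
Qed.

(** The two inverse branches of the doubling map: the binary digit i is put in front of the
    expansion of x. *)
Definition half_map (R : realType) (i : bool) (x : R) : R :=
  2^-1 * x + i%:R / 2.

Lemma measurable_half_map (R : realType) i :
  measurable_fun setT (@half_map R i).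
Proof. by apply: measurable_funD => //; exact: measurable_funM. Qed.

(** Self-similarity of the uniform law. The right side is integration against a sum of two scaled
    image measures; on Lipschitz functions it agrees with the left side by cutting [0, 1] at 1/2 and
    substituting on each half. *)
Lemma uniform_law01_half (R : realType) (f : R -> \bar R) :
  measurable_fun setT f -> (forall x, 0 <= f x)%E ->
  (\int[uniform_law (@ltr01 R)]_x f x =
   2^-1%:E * \int[uniform_law (@ltr01 R)]_x f (half_map false x) +
   2^-1%:E * \int[uniform_law (@ltr01 R)]_x f (half_map true x))%E.
Proof.
move=> mf f0; set P := uniform_law _.
pose F i : {mfun R >-> R} := mfun_Sub (mem_set (@measurable_half_map R i)).
have h0 : 0 <= (2^-1 : R) by rewrite invr_ge0.
pose m i := mscale (NngNum h0) (distribution P (F i)).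
pose m2 := measure_add (m false) (m true).
have E (g : R -> \bar R) : measurable_fun setT g -> (forall x, 0 <= g x)%E ->
    (\int[m2]_x g x = 2^-1%:E * \int[P]_x g (half_map false x) +
      2^-1%:E * \int[P]_x g (half_map true x))%E.
  move=> mg g0; rewrite ge0_integral_measure_add//.
  rewrite /m !ge0_integral_mscale//.
  by congr (_ * _ + _ * _)%E; exact: ge0_integral_distribution.
rewrite -E//; apply: eq_measure_integral => A mA _.
apply: measure_unique_lipschitz => //.
  by rewrite (le_lt_trans (probability_le1 P measurableT))// ltry.
move=> L g Lg; have cg := unit_lipschitz_continuous Lg.
have mg : measurable_fun setT (EFin \o g).
  by apply/measurable_EFinP; exact: continuous_measurable_fun.
have g0 x : (0 <= (g x)%:E)%E by case: Lg => _ /(_ x)/andP[].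
rewrite E// !ge0_integral_uniform_law//.
rewrite subr0 invr1 !mul1e /half_map.
rewrite -!(@lebesgue_integral_affine R 0 1 2^-1)// ?invr_gt0//.
rewrite !mulr0 !mulr1 !add0r mul0r addr0 mul1r.
have -> : 2^-1 + 2^-1 = 1 :> R by field.
rewrite (@itv_bndbnd_setU _ _ _ (BLeft (2^-1 : R))) ?bnd_simp ?invr_ge0//; last first.
  by rewrite invf_le1// ler1n.
rewrite ge0_integral_setU//=.
- by rewrite integral_itv_bndo_bndc//; exact: measurable_funTS.
- exact: measurable_funTS.
- apply/disj_setPS => y [/=]; rewrite 2!in_itv/= => /andP[_ yx] /andP[].
  by rewrite leNgt yx.
- by apply: (measurableT_comp mg); exact: measurable_half_map.
- by apply: (measurableT_comp mg); exact: measurable_half_map.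
Qed.

Lemma uniform_on_affine (R : realType) (d : measure_display)
    (T : measurableType d) (P : probability T R) (a b c e : R)
    (X Y : {RV P >-> R}) :
  0 <= c -> (forall w, Y w = c * X w + e) ->
  uniform_on a b X -> uniform_on (c * a + e) (c * b + e) Y.
Proof.
move=> c0 YX [ab Xab Xa].
have YE A : Y @^-1` A = X @^-1` [set x | A (c * x + e)].
  by apply/seteqP; split => w /=; rewrite YX.
have mF : measurable_fun setT (fun x : R => c * x + e).
  by apply: measurable_funD => //; exact: measurable_funM.
have mA' A : measurable A -> measurable [set x : R | A (c * x + e)].
  by move=> mA; rewrite -[X in measurable X]setTI; exact: mF.
split.
- by rewrite lerD2r ler_wpM2l.
- move=> ab' A mA; rewrite /distribution /pushforward YE.
  have cp : 0 < c by rewrite lt_neqAle c0 andbT; apply: contraTneq ab' => <-; rewrite !mul0r ltxx.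
  have ab1 : a < b by move: ab'; rewrite ltrD2r ltr_pM2l.
  have := Xab ab1 _ (mA' _ mA); rewrite /distribution /pushforward => ->.
  by rewrite -uniform_lawE (uniform_law_affine _ ab').
- move=> abE A mA; rewrite /distribution /pushforward YE.
  have [ab1|] := eqVneq a b.
    have := Xa ab1 _ (mA' _ mA); rewrite /distribution /pushforward => ->.
    by rewrite !diracE; congr (_%:R%:E); apply/idP/idP; rewrite !inE.
  (* The image interval is degenerate although [a, b] is not, so the map is constant and its image
     law is the point mass at e. *)
  move=> nab; have cE : c = 0.
    apply/eqP; move/eqP: abE; rewrite -subr_eq0.
    rewrite (_ : _ - _ = c * (a - b)); last by ring.
    by rewrite mulf_eq0 subr_eq0 (negbTE nab) orbF.
  rewrite cE mul0r add0r diracE.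
  have [/set_mem Ae|Ae] := boolP (e \in A).
    rewrite -(@probability_setT _ _ _ P); congr (P _).
    by apply/seteqP; split => // w _ /=; rewrite mul0r add0r.
  rewrite (_ : X @^-1` _ = set0) ?measure0//.
  by apply/seteqP; split => // w /=; rewrite mul0r add0r => /mem_set; rewrite (negbTE Ae).
Qed.

(** * A sequence of independent uniform variables *)

Definition first_bit (R : realType) (x : R) : R := if 2^-1 <= x then 1 else 0.

(** On [0, 1[ this is the binary shift, so the digit of index j, counted from 0, is [first_bit] of
    the j-th iterate. *)
Definition doubling (R : realType) (x : R) : R := 2 * x - first_bit x.

Lemma measurable_first_bit (R : realType) :
  measurable_fun setT (@first_bit R).
Proof. by apply: measurable_fun_if => //=; exact: measurable_fun_ler. Qed.

Lemma measurable_doubling (R : realType) : measurable_fun setT (@doubling R).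
Proof.
by apply: measurable_funB; [exact: measurable_funM|exact: measurable_first_bit].
Qed.

Lemma measurable_iter_doubling (R : realType) n :
  measurable_fun setT (iter n (@doubling R)).
Proof.
elim: n => [|n IH]; first exact: measurable_id.
exact: (measurableT_comp (@measurable_doubling R) IH).
Qed.

Definition even_bits_partial (R : realType) (n : nat) (x : R) : R :=
  \sum_(0 <= k < n) 2^-1 ^+ k.+1 * first_bit (iter k.*2 (@doubling R) x).

(** [first_bit] is 0 or 1 at every real number, so the series converges everywhere and no
    restriction to [0, 1] is needed for the bounds and for measurability. *)
Definition even_bits (R : realType) (x : R) : R :=
  limn (fun n => even_bits_partial n x).

Definition odd_bits (R : realType) (x : R) : R := even_bits (doubling x).

Lemma first_bit01 (R : realType) (x : R) : 0 <= first_bit x <= 1.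
Proof. by rewrite /first_bit; case: ifP; rewrite ?ler01 lexx. Qed.

Lemma even_bits_partial01 (R : realType) n (x : R) :
  0 <= even_bits_partial n x <= 1.
Proof.
apply/andP; split.
  apply: sumr_ge0 => k _; rewrite mulr_ge0// ?exprn_ge0 ?invr_ge0//.
  by case/andP: (first_bit01 (iter k.*2 (@doubling R) x)).
apply: (@le_trans _ _ (1 - 2^-1 ^+ n)); last by rewrite gerBl exprn_ge0// invr_ge0.
elim: n => [|n IH]; first by rewrite /even_bits_partial big_geq// expr0 subrr.
rewrite /even_bits_partial big_nat_recr//=.
apply: (le_trans (lerD IH (_ : _ <= 2^-1 ^+ n.+1))); last by rewrite exprS; lra.
rewrite -[leRHS]mulr1 ler_wpM2l ?exprn_ge0 ?invr_ge0//.
by case/andP: (first_bit01 (iter n.*2 (@doubling R) x)).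
Qed.

Lemma even_bits_cvg (R : realType) (x : R) :
  (fun n => even_bits_partial n x) @ \oo --> even_bits x.
Proof.
apply: nondecreasing_is_cvgn.
  apply/nondecreasing_seqP => n.
  rewrite /even_bits_partial big_nat_recr//= lerDl.
  rewrite mulr_ge0// ?exprn_ge0 ?invr_ge0//.
  by case/andP: (first_bit01 (iter n.*2 (@doubling R) x)).
by exists 1 => _ [n _ <-]; case/andP: (even_bits_partial01 n x).
Qed.

Lemma even_bits01 (R : realType) (x : R) : 0 <= even_bits x <= 1.
Proof.
have c : cvgn (fun n => even_bits_partial n x).
  by apply/cvg_ex; eexists; exact: even_bits_cvg.
by apply/andP; split; [apply: limr_ge => //|apply: limr_le => //];
  apply: nearW => n; case/andP: (even_bits_partial01 n x).
Qed.

Lemma measurable_even_bits (R : realType) : measurable_fun setT (@even_bits R).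
Proof.
apply: (@measurable_fun_cvg _ _ _ _ (fun n x => even_bits_partial n x)).
  move=> n; apply: measurable_sum => k; apply: measurable_funM => //.
  apply: measurableT_comp; first exact: measurable_first_bit.
  exact: measurable_iter_doubling.
by move=> x _; exact: even_bits_cvg.
Qed.

Lemma measurable_odd_bits (R : realType) : measurable_fun setT (@odd_bits R).
Proof.
by apply: measurableT_comp; [exact: measurable_even_bits|exact: measurable_doubling].
Qed.

Lemma even_bits_rec (R : realType) (x : R) :
  even_bits x = (first_bit x + odd_bits (doubling x)) / 2.
Proof.
apply/esym; have h : (fun n => even_bits_partial n.+1 x) @ \oo --> even_bits x.
  by rewrite (@cvg_shiftS _ (fun n => even_bits_partial n x)); exact: even_bits_cvg.
apply: cvg_unique h => //.
rewrite (_ : (fun n => _) = (fun n => (first_bit x + even_bits_partial n (doubling (doubling x))) / 2)).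
  apply: cvgM; last exact: cvg_cst.
  by apply: cvgD; [exact: cvg_cst|exact: even_bits_cvg].
apply/funext => n; rewrite /even_bits_partial big_nat_recl//= expr1.
rewrite mulrDl mulrC; congr (_ + _); rewrite mulr_suml.
apply: eq_bigr => k _; rewrite (exprS _ k.+1) -!iterSr.
by rewrite -mulrA mulrC.
Qed.

Lemma first_bit_half (R : realType) i (x : R) : 0 <= x < 1 ->
  first_bit (half_map i x) = i%:R.
Proof.
move=> /andP[x0 x1]; rewrite /first_bit /half_map.
by case: i => /=; case: ifPn => //; rewrite -?ltNge => ?; exfalso; lra.
Qed.

Lemma doubling_half (R : realType) i (x : R) : 0 <= x < 1 ->
  doubling (half_map i x) = x.
Proof.
by move=> x01; rewrite /doubling first_bit_half// /half_map; field.
Qed.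

(** A digit put in front moves every other digit by one place: the even digits become i followed by
    the old odd digits, while the odd digits become the old even ones. *)
Lemma even_bits_half (R : realType) i (x : R) : 0 <= x < 1 ->
  even_bits (half_map i x) = half_map i (odd_bits x).
Proof.
move=> x01; rewrite even_bits_rec first_bit_half// doubling_half//.
by rewrite /half_map; field.
Qed.

Lemma odd_bits_half (R : realType) i (x : R) : 0 <= x < 1 ->
  odd_bits (half_map i x) = even_bits x.
Proof. by move=> x01; rewrite /odd_bits doubling_half. Qed.

Lemma unit_lipschitz_half (R : realType) (L : R) (f : R -> R) i :
  unit_lipschitz L f -> unit_lipschitz (L / 2) (fun x => f (half_map i x)).
Proof.
move=> [L0 f01 Lf]; split=> // [|x y]; first by rewrite divr_ge0.
rewrite (le_trans (Lf _ _))// -mulrA ler_wpM2l//.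
have -> : half_map i x - half_map i y = 2^-1 * (x - y) by rewrite /half_map; ring.
by rewrite normrM ger0_norm ?invr_ge0.
Qed.

Lemma Rintegral01_half (R : realType) (f : R -> R) :
  bounded_mfun f -> (forall x, 0 <= f x) ->
  \int[uniform_law (@ltr01 R)]_x f x =
   2^-1 * \int[uniform_law (@ltr01 R)]_x f (half_map false x) +
   2^-1 * \int[uniform_law (@ltr01 R)]_x f (half_map true x).
Proof.
move=> bf f0; apply: EFin_inj; rewrite EFinD !EFinM.
have bh i : bounded_mfun (fun x => f (half_map i x)).
  by apply: bounded_mfun_comp => //; exact: measurable_half_map.
rewrite !Rintegral_EFin//; apply: uniform_law01_half => //.
by apply/measurable_EFinP; case: bf.
Qed.

Lemma Rintegral01_eq (R : realType) (f g : R -> R) :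
  bounded_mfun f -> bounded_mfun g -> (forall x, 0 <= x < 1 -> f x = g x) ->
  \int[uniform_law (@ltr01 R)]_x f x = \int[uniform_law (@ltr01 R)]_x g x.
Proof.
move=> [mf _] [mg _] fg; congr fine; apply: ae_eq_integral => //.
- exact/measurable_EFinP.
- exact/measurable_EFinP.
- by apply: filterS (@uniform_law01_ae R) => x x01 _ /=; rewrite fg.
Qed.

(** One step of the contraction: the two factors change places and only f is composed with a
    halving. Two steps therefore contract both f and h. *)
Lemma bits_mean_half (R : realType) (f h : R -> R) :
  bounded_mfun f -> bounded_mfun h ->
  (forall x, 0 <= f x) -> (forall x, 0 <= h x) ->
  \int[uniform_law (@ltr01 R)]_x (f (even_bits x) * h (odd_bits x)) =
  2^-1 * \int[uniform_law (@ltr01 R)]_x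
    (h (even_bits x) * f (half_map false (odd_bits x))) +
  2^-1 * \int[uniform_law (@ltr01 R)]_x
    (h (even_bits x) * f (half_map true (odd_bits x))).
Proof.
move=> bf bh f0 h0.
have mE := @measurable_even_bits R; have mO := @measurable_odd_bits R.
have mH i := @measurable_half_map R i.
have bfh : bounded_mfun (fun x => f (even_bits x) * h (odd_bits x)).
  by apply: bounded_mfunM; exact: bounded_mfun_comp.
rewrite Rintegral01_half//; last by move=> x; exact: mulr_ge0.
congr (_ * _ + _ * _); apply: Rintegral01_eq.
- exact: (bounded_mfun_comp bfh).
- apply: bounded_mfunM; first exact: bounded_mfun_comp.
  apply: (bounded_mfun_comp bf); exact: (measurableT_comp (mH _)).
- by move=> x x01; rewrite even_bits_half// odd_bits_half// mulrC.
- exact: (bounded_mfun_comp bfh).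
- apply: bounded_mfunM; first exact: bounded_mfun_comp.
  apply: (bounded_mfun_comp bf); exact: (measurableT_comp (mH _)).
- by move=> x x01; rewrite even_bits_half// odd_bits_half// mulrC.
Qed.

Lemma subrBB (R : zmodType) (c a b : R) : (a - c) - (b - c) = a - b.
Proof. by rewrite opprB addrA subrK. Qed.

(** The total error is exactly the average of the errors over the four pairs of branches, so the
    induction on the number of steps loses nothing. *)
Lemma avg4_dist (R : realFieldType) (a b c e f0 f1 h0 h1 k : R) :
  `|a - f0 * h0| <= k -> `|b - f0 * h1| <= k ->
  `|c - f1 * h0| <= k -> `|e - f1 * h1| <= k ->
  `|2^-1 * (2^-1 * a + 2^-1 * b) + 2^-1 * (2^-1 * c + 2^-1 * e) -
    (2^-1 * f0 + 2^-1 * f1) * (2^-1 * h0 + 2^-1 * h1)| <= k.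
Proof.
set u1 := a - _; set u2 := b - _; set u3 := c - _; set u4 := e - _ => k1 k2 k3 k4.
have -> : 2^-1 * (2^-1 * a + 2^-1 * b) + 2^-1 * (2^-1 * c + 2^-1 * e) -
    (2^-1 * f0 + 2^-1 * f1) * (2^-1 * h0 + 2^-1 * h1) =
    4^-1 * (u1 + u2 + u3 + u4) by rewrite /u1 /u2 /u3 /u4; field.
clearbody u1 u2 u3 u4; move: k1 k2 k3 k4; rewrite !ler_norml.
by move=> /andP[? ?] /andP[? ?] /andP[? ?] /andP[? ?]; apply/andP; split; lra.
Qed.

(* Each use of the identity halves the Lipschitz constants. *)
Lemma bits_decorrelation (R : realType) n (L : R) (f h : R -> R) :
  unit_lipschitz L f -> unit_lipschitz L h ->
  `|\int[uniform_law (@ltr01 R)]_x (f (even_bits x) * h (odd_bits x)) -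
    \int[uniform_law (@ltr01 R)]_x f x * \int[uniform_law (@ltr01 R)]_x h x|
  <= 4 * L / 2 ^+ n.
Proof.
have b0 L' g : @unit_lipschitz R L' g -> bounded_mfun g /\ forall x, 0 <= g x.
  move=> Lg; split; first exact: unit_lipschitz_bounded_mfun Lg.
  by move=> x; case: Lg => _ /(_ x)/andP[].
elim: n L f h => [|n IH] L f h Lf Lh.
  have [bf f0] := b0 _ _ Lf; have [bh h0] := b0 _ _ Lh.
  have [L0 f01 fL] := Lf; have [_ h01 hL] := Lh.
  have n1 (g : R -> R) : (forall x, 0 <= g x <= 1) -> forall x, `|g x| <= 1.
    by move=> g01 x; rewrite ger0_norm//; case/andP: (g01 x).
  have close (g : R -> R) x : (forall x y, `|g x - g y| <= L * `|x - y|) ->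
      0 <= x <= 1 -> `|g x - g 0| <= L.
    move=> gL /andP[x0 x1]; rewrite (le_trans (gL _ _))// subr0 ger0_norm//.
    by rewrite -[leRHS]mulr1 ler_wpM2l.
  have tri (a b c d : R) : `|a| <= 1 -> `|d| <= 1 ->
      `|a - c| <= L -> `|b - d| <= L -> `|a * b - c * d| <= 2 * L.
    move=> a1 d1 ac bd; have -> : a * b - c * d = a * (b - d) + (a - c) * d by ring.
    rewrite (le_trans (ler_normD _ _))// !normrM mulr2n mulrDl !mul1r lerD//.
      by rewrite -[leRHS]mul1r ler_pM.
    by rewrite -[leRHS]mulr1 ler_pM.
  (* On [0, 1] both functions stay within L of their values at 0. Hence the mean of the product and
     the product of the means each lie within 2 L of [f 0 * h 0], which gives the constant 4. *)
  have h1 : `|\int[uniform_law (@ltr01 R)]_x (f (even_bits x) * h (odd_bits x))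
      - f 0 * h 0| <= 2 * L.
    apply: normr_Rintegral_sub; first by rewrite mulr_ge0.
      apply: bounded_mfunM; apply: bounded_mfun_comp => //.
        exact: measurable_even_bits.
      exact: measurable_odd_bits.
    apply: aeW => x; apply: tri; [exact: n1|exact: n1|apply: close => //|apply: close => //].
      exact: even_bits01.
    exact: even_bits01.
  have h2 (g : R -> R) : bounded_mfun g ->
      (forall x y, `|g x - g y| <= L * `|x - y|) ->
      `|\int[uniform_law (@ltr01 R)]_x g x - g 0| <= L.
    move=> bg gL; apply: normr_Rintegral_sub => //.
    apply: filterS (@uniform_law01_ae R) => x /andP[x0 x1]; apply: close => //.
    by rewrite x0 ltW.
  have h3 : `|\int[uniform_law (@ltr01 R)]_x f x| <= 1.
    rewrite -[X in `|X|]subr0; apply: normr_Rintegral_sub => //.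
    by apply: aeW => x; rewrite subr0; exact: n1.
  have h4 := tri _ _ _ _ h3 (n1 _ h01 0) (h2 _ bf fL) (h2 _ bh hL).
  rewrite expr0 divr1.
  rewrite -(subrBB (f 0 * h 0)).
  rewrite (le_trans (ler_normB _ _))//.
  have -> : 4 * L = 2 * L + 2 * L by ring.
  exact: lerD h1 h4.
have [bf f0] := b0 _ _ Lf; have [bh h0] := b0 _ _ Lh.
have Lfi i := unit_lipschitz_half i Lf; have Lhi i := unit_lipschitz_half i Lh.
have [bft ft0] := b0 _ _ (Lfi true); have [bff ff0] := b0 _ _ (Lfi false).
(* The identity is used a second time with f and h exchanged, producing one mean for each pair of
   branches, to which the induction hypothesis applies with constant L / 2. *)
rewrite bits_mean_half//.
rewrite (bits_mean_half bh bft)// (bits_mean_half bh bff)//.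
rewrite (Rintegral01_half bf f0) (Rintegral01_half bh h0).
have := IH _ _ _ (Lfi true) (Lhi true).
have := IH _ _ _ (Lfi true) (Lhi false).
have := IH _ _ _ (Lfi false) (Lhi true).
have := IH _ _ _ (Lfi false) (Lhi false).
set k := 4 * (L / 2) / 2 ^+ n.
have -> : 4 * L / 2 ^+ n.+1 = k by rewrite /k exprS; field; rewrite expf_neq0.
by move=> *; exact: avg4_dist.
Qed.

Lemma bits_factor (R : realType) (L : R) (f h : R -> R) :
  unit_lipschitz L f -> unit_lipschitz L h ->
  \int[uniform_law (@ltr01 R)]_x (f (even_bits x) * h (odd_bits x)) =
  \int[uniform_law (@ltr01 R)]_x f x * \int[uniform_law (@ltr01 R)]_x h x.
Proof.
move=> Lf Lh; apply/eqP; rewrite -subr_eq0 -normr_le0.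
have h0 : (fun n => 4 * L / 2 ^+ n) @ \oo --> (0 : R).
  rewrite (_ : (fun n => _) = geometric (4 * L) 2^-1).
    by apply: cvg_geometric; rewrite ger0_norm ?invr_ge0// invf_lt1// ltr1n.
  by apply/funext => n; rewrite /= exprVn.
suff : forall r : R, (forall n, r <= 4 * L / 2 ^+ n) -> r <= 0.
  by apply => n; exact: bits_decorrelation.
move=> r rL; rewrite -(cvg_lim _ h0)//; apply: limr_ge; last exact: nearW.
by apply/cvg_ex; exists 0.
Qed.

Lemma bits_independent_rays (R : realType) (x y : R) :
  uniform_law (@ltr01 R) [set z | (x < even_bits z) /\ (y < odd_bits z)] =
  (uniform_law (@ltr01 R) `]x, +oo[%classic *
   uniform_law (@ltr01 R) `]y, +oo[%classic)%E.
Proof.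
set P := uniform_law _.
have mr x' n : measurable_fun setT (@ramp R x' n).
  by have [] := unit_lipschitz_bounded_mfun (unit_lipschitz_ramp x' n).
have r1 x' n z : `|@ramp R x' n z| <= 1.
  have [_ /(_ z)/andP[h0 h1] _] := unit_lipschitz_ramp x' n.
  by rewrite ger0_norm.
have mE := @measurable_even_bits R; have mO := @measurable_odd_bits R.
pose A := [set z : R | (x < even_bits z) /\ (y < odd_bits z)].
have mA : measurable A.
  apply: measurableI.
    rewrite -[X in measurable X]setTI.
    have := mE measurableT `]x, +oo[%classic (measurable_itv _).
    by congr measurable; apply/seteqP; split => z /=; rewrite in_itv/= andbT.
  rewrite -[X in measurable X]setTI.
  have := mO measurableT `]y, +oo[%classic (measurable_itv _).
  by congr measurable; apply/seteqP; split => z /=; rewrite in_itv/= andbT.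
have PE (B : set R) : measurable B -> P B = (\int[P]_z \1_B z)%:E.
  move=> mB; rewrite Rintegral_EFin; first by rewrite integral_indic// setIT.
  split; first exact: measurable_indic.
  by exists 1 => z; rewrite indicE ger0_norm// lern1 leq_b1.
rewrite !PE// -EFinM; congr EFin.
have L1 : \int[P]_z (ramp x n (even_bits z) * ramp y n (odd_bits z)) @[n --> \oo]
    --> \int[P]_z \1_A z.
  apply: (@bounded_convergence _ _ _ _ _ _ 1).
  - by move=> n; apply: measurable_funM; apply: measurableT_comp.
  - exact: measurable_indic.
  - by move=> n z; rewrite normrM -[leRHS]mulr1 ler_pM.
  - apply: aeW => z.
    rewrite (_ : \1_A z = \1_(`]x, +oo[%classic) (even_bits z) * \1_(`]y, +oo[%classic) (odd_bits z)).
      by apply: cvgM; exact: ramp_cvg.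
    rewrite !indicE -natrM mulnb; congr (nat_of_bool _)%:R.
    apply/idP/andP; rewrite !inE/= !in_itv/= !andbT.
      by move=> [-> ->].
    by move=> [? ?]; split.
have L2 x' : \int[P]_z ramp x' n z @[n --> \oo] --> \int[P]_z \1_(`]x', +oo[%classic) z.
  apply: (@bounded_convergence _ _ _ _ _ _ 1) => //.
  by apply: aeW => z; exact: ramp_cvg.
have L3 : (\int[P]_z ramp x n z * \int[P]_z ramp y n z) @[n --> \oo] -->
    \int[P]_z \1_(`]x, +oo[%classic) z * \int[P]_z \1_(`]y, +oo[%classic) z.
  by apply: cvgM; exact: L2.
apply: cvg_unique L3 => //; apply: cvg_trans L1; apply: near_eq_cvg.
apply: nearW => n /=.
by rewrite (bits_factor (unit_lipschitz_ramp x n) (unit_lipschitz_ramp y n)).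
Qed.

(** Rays are replaced by Borel sets in one coordinate at a time: with the other set fixed, both
    sides are finite measures that agree on rays. *)
Lemma bits_independent (R : realType) (A B : set R) :
  measurable A -> measurable B ->
  uniform_law (@ltr01 R) [set z | A (even_bits z) /\ B (odd_bits z)] =
  (uniform_law (@ltr01 R) A * uniform_law (@ltr01 R) B)%E.
Proof.
move=> mA mB; set P := uniform_law _.
have mE := @measurable_even_bits R; have mO := @measurable_odd_bits R.
pose e : {mfun R >-> R} := mfun_Sub (mem_set mE).
pose o : {mfun R >-> R} := mfun_Sub (mem_set mO).
have mpre (f : {mfun R >-> R}) C : measurable C -> measurable (f @^-1` C).
  by move=> mC; rewrite -[X in measurable X]setTI; exact: measurable_funP.
have fP C : measurable C -> (fine (P C))%:E = P C.
  by move=> mC; rewrite fineK// fin_num_measure.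
have f0 C : 0 <= fine (P C) by rewrite fine_ge0.
have key (g1 g2 : {mfun R >-> R}) (C : set R) : measurable C ->
    (forall x : R, P (g1 @^-1` `]x, +oo[ `&` g2 @^-1` C) =
       (P `]x, +oo[%classic * P C)%E) ->
    forall D, measurable D -> P (g1 @^-1` D `&` g2 @^-1` C) = (P D * P C)%E.
  move=> mC gC D mD.
  have mg1 : measurable_fun setT g1 by [].
  rewrite muleC -(fP C mC).
  apply: (@measure_unique_rays R (@pushforward _ _ _ _ _ (mrestr P (mpre g2 C mC)) g1)
      (mscale (NngNum (f0 C)) P) _ _ D mD) => //.
    apply: (le_lt_trans (probability_le1 P _)); last exact: ltry.
    by apply: measurableI; exact: mpre.
  move=> x; change (P (g1 @^-1` `]x, +oo[ `&` g2 @^-1` C) =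
    ((fine (P C))%:E * P `]x, +oo[%classic)%E).
  by rewrite gC fP// muleC.
have step1 y D : measurable D ->
    P (e @^-1` D `&` o @^-1` `]y, +oo[) = (P D * P `]y, +oo[%classic)%E.
  move=> mD; apply: key => // x.
  rewrite -(bits_independent_rays x y); congr (P _).
  by apply/seteqP; split => z /=; rewrite !in_itv/= !andbT.
have := key o e A mA.
rewrite muleC => <- //; first by congr (P _); rewrite setIC.
by move=> x; rewrite setIC step1// muleC.
Qed.

Lemma bigsetI_seqE (T : Type) (I : eqType) (s : seq I) (F : I -> set T) :
  \big[setI/setT]_(k <- s) F k = [set w | forall k, k \in s -> F k w].
Proof.
elim: s => [|i s IH]; first by rewrite big_nil; apply/seteqP; split.
rewrite big_cons IH; apply/seteqP; split => w /=.
  by move=> [Fi Fs] k; rewrite inE => /predU1P[->//|]; exact: Fs.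
by move=> Fs; split=> [|k ks]; apply: Fs; rewrite inE ?eqxx// ks orbT.
Qed.

Lemma bigsetI_iotaE (T : Type) (n : nat) (F : nat -> set T) :
  \big[setI/setT]_(k <- iota 0 n) F k =
  [set w | forall k, (k < n)%N -> F k w].
Proof.
rewrite bigsetI_seqE; apply/seteqP; split => w h k; have := h k.
  by rewrite mem_iota.
by move=> {}h; rewrite mem_iota; exact: h.
Qed.

(* It suffices to test initial segments: take A k = setT off the subfamily. *)
Lemma mutually_independent_initial (R : realType) (d : measure_display)
    (T : measurableType d) (P : probability T R) (X : nat -> {RV P >-> R}) :
  (forall n (A : nat -> set R), (forall k, measurable (A k)) ->
    P [set w | forall k, (k < n)%N -> A k (X k w)] =
    (\prod_(0 <= k < n) P (X k @^-1` A k))%E) ->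
  mutually_independent X.
Proof.
move=> H J A mA.
pose n := (\max_(k <- J) k).+1.
have Jn k : k \in J -> (k < n)%N.
  by move=> kJ; rewrite ltnS; exact: leq_bigmax_seq.
pose A' k := if k \in J then A k else setT.
have mA' k : measurable (A' k) by rewrite /A'; case: ifP.
rewrite bigsetI_seqE; transitivity (P [set w | forall k, (k < n)%N -> A' k (X k w)]).
  congr (P _); apply/seteqP; split => w /= h k.
    by rewrite /A'; case: ifP => // kJ _; exact: h.
  by move=> kJ; have := h k (Jn _ kJ); rewrite /A' kJ.
rewrite H//.
transitivity (\prod_(0 <= k < n | k \in J) P (X k @^-1` A k))%E.
  rewrite [RHS]big_mkcond/=; apply: eq_bigr => k _; rewrite /A'.
  by case: ifP => // _; rewrite preimage_setT; exact: probability_setT.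
rewrite -big_filter; apply: perm_big; apply: uniq_perm.
- by rewrite filter_uniq// iota_uniq.
- exact: fset_uniq.
- move=> k; rewrite mem_filter mem_index_iota/=.
  by case: (boolP (k \in J)) => // /Jn ->.
Qed.

Lemma mutually_independent_prefix (R : realType) (d : measure_display)
    (T : measurableType d) (P : probability T R) (X : nat -> {RV P >-> R})
    (n : nat) (A : nat -> set R) :
  mutually_independent X -> (forall k, measurable (A k)) ->
  P [set w | forall k, (k < n)%N -> A k (X k w)] =
    (\prod_(0 <= k < n) P (X k @^-1` A k))%E.
Proof.
move=> indX mA; have := indX [fset k in iota 0 n]%fset A mA.
rewrite bigsetI_seqE => h.
transitivity (P [set w | forall k, k \in [fset k0 in iota 0 n]%fset -> (X k @^-1` A k) w]).
  by congr (P _); apply/seteqP; split => w /= h' k; rewrite ?inE ?mem_iota => kn; apply: h'; rewrite ?inE ?mem_iota.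
rewrite h; apply: perm_big; apply: uniq_perm.
- exact: fset_uniq.
- exact: iota_uniq.
- by move=> k; rewrite inE /= /index_iota subn0.
Qed.

Lemma iid_uniform_exists (R : realType) :
  exists X : nat -> {RV (uniform_law (@ltr01 R)) >-> R},
    mutually_independent X /\ forall k, uniform_on 0 1 (X k).
Proof.
set P := uniform_law _.
have mE := @measurable_even_bits R; have mO := @measurable_odd_bits R.
have mI k : measurable_fun setT (fun x : R => even_bits (iter k (@odd_bits R) x)).
  apply: measurableT_comp => //; elim: k => [|k IH]; first exact: measurable_id.
  exact: (measurableT_comp mO IH).
pose X k : {RV P >-> R} := mfun_Sub (mem_set (mI k)).
have XE k x : X k x = even_bits (iter k (@odd_bits R) x) by []; clearbody X.
have PT : P setT = 1%E := probability_setT P.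
have Pe A : measurable A -> P [set z | A (even_bits z)] = P A.
  move=> mA; have := bits_independent mA measurableT.
  rewrite -/P PT mule1 => <-; congr (P _).
  by apply/seteqP; split => z /=; [split|case].
have Po A : measurable A -> P [set z | A (odd_bits z)] = P A.
  move=> mA; have := bits_independent measurableT mA.
  rewrite -/P PT mul1e => <-; congr (P _).
  by apply/seteqP; split => z /=; [split|case].
have mpre (f : R -> R) C : measurable_fun setT f -> measurable C -> measurable [set z | C (f z)].
  by move=> mf mC; rewrite -[X in measurable X]setTI; exact: mf.
have PX k A : measurable A -> P (X k @^-1` A) = P A.
  move=> mA; elim: k => [|k IH].
    rewrite -[RHS](Pe A mA); congr (P _).
    by apply/seteqP; split => z /=; rewrite XE.
  rewrite -IH -(Po (X k @^-1` A)); last exact: mpre.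
  by congr (P _); apply/seteqP; split => z /=; rewrite !XE iterSr.
exists X; split; last first.
  move=> k; split => //.
  - by move=> ab A mA; rewrite -uniform_lawE /distribution /pushforward PX//.
  - by move=> /eqP; rewrite eq_sym oner_eq0.
apply: mutually_independent_initial => n.
elim: n => [|n IH] A mA.
  rewrite big_geq//; rewrite -PT; congr (P _); by apply/seteqP; split.
(* [X k.+1] is [X k] composed with [odd_bits], so the conditions on all variables but the first form
   one event B in the odd digits. This event is independent of the even digits, and its probability
   is known by induction. *)
pose B := [set w | forall k, (k < n)%N -> A k.+1 (X k w)].
have mB : measurable B.
  rewrite /B -(bigsetI_iotaE n (fun k => X k @^-1` A k.+1)).
  by apply: bigsetI_measurable => k _; apply: mpre.
transitivity (P [set z | A 0%N (even_bits z) /\ B (odd_bits z)]).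
  congr (P _); apply/seteqP; split => z /=.
    move=> h; split; first by have := h 0%N isT; rewrite XE.
    by move=> k kn; have := h k.+1 kn; rewrite !XE iterSr.
  move=> [h0 h] [|k] kn; rewrite XE//.
  by rewrite iterSr -XE; exact: h.
rewrite (bits_independent (mA 0%N) mB) -/P (IH (fun k => A k.+1))//.
rewrite big_nat_recl//; congr (_ * _)%E; first by rewrite PX.
by apply: eq_bigr => k _; rewrite !PX.
Qed.

(** * Independence of the past *)

(** Rectangles in the first n variables: a pi-system generating their sigma-algebra. The inequality
    k < n is strict, so that functions adapted at n are independent of [X n] itself. *)
Definition past (R : realType) (d : measure_display) (T : measurableType d)
    (P : probability T R) (X : nat -> {RV P >-> R}) (n : nat) : set (set T) :=
  [set E | exists A : nat -> set R, (forall k, measurable (A k)) /\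
    E = [set w | forall k, (k < n)%N -> A k (X k w)]].

Definition adapted (R : realType) (d : measure_display) (T : measurableType d)
    (P : probability T R) (X : nat -> {RV P >-> R}) (n : nat) (W : T -> R) : Prop :=
  measurable_fun [set: g_sigma_algebraType (past X n)] W.

Lemma measurable_prefix (R : realType) (d : measure_display)
    (T : measurableType d) (P : probability T R) (X : nat -> {RV P >-> R})
    (n : nat) (A : nat -> set R) : (forall k, measurable (A k)) ->
  measurable [set w | forall k, (k < n)%N -> A k (X k w)].
Proof.
move=> mA.
rewrite -(bigsetI_iotaE n (fun k => X k @^-1` A k)).
apply: bigsetI_measurable => k _.
by rewrite -[X in measurable X]setTI; exact: measurable_funP.
Qed.

Lemma past_measurable (R : realType) (d : measure_display)
    (T : measurableType d) (P : probability T R) (X : nat -> {RV P >-> R}) n :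
  <<s past X n >> `<=` measurable.
Proof.
apply: smallest_sub; first exact: sigma_algebra_measurable.
by move=> _ [A [mA ->]]; exact: measurable_prefix.
Qed.

Lemma adapted_measurable (R : realType) (d : measure_display)
    (T : measurableType d) (P : probability T R) (X : nat -> {RV P >-> R})
    n (W : T -> R) : adapted X n W -> measurable_fun setT W.
Proof.
move=> aW _ B mB; rewrite setTI; apply: (@past_measurable _ _ _ _ X n).
by have := aW measurableT B mB; rewrite setTI.
Qed.

Lemma adapted_past (R : realType) (d : measure_display)
    (T : measurableType d) (P : probability T R) (X : nat -> {RV P >-> R})
    n k : (k < n)%N -> adapted X n (X k).
Proof.
move=> kn _ B mB; rewrite setTI; apply: sub_sigma_algebra.
exists (fun j => if j == k then B else setT); split.
  by move=> j; case: ifP.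
apply/seteqP; split => w /=.
  by move=> Bw j jn; case: eqP => // ->.
by move=> /(_ k kn); rewrite eqxx.
Qed.

Lemma adapted_sum (R : realType) (d : measure_display)
    (T : measurableType d) (P : probability T R) (X : nat -> {RV P >-> R}) m n :
  (m <= n)%N -> adapted X n (fun w => \sum_(0 <= k < m) X k w).
Proof.
move=> mn; rewrite /adapted.
(* Variables of index at least n are not adapted; cutting them off makes every term of the family
   measurable for the past without changing the sum. *)
have -> : (fun w => \sum_(0 <= k < m) X k w) =
    (fun w => \sum_(0 <= k < m) (if (k < n)%N then X k w else 0)).
  apply/funext => w; apply: eq_big_nat => k /andP[_ km].
  by rewrite (leq_trans km mn).
apply: measurable_sum => k; have [kn|_] := boolP (k < n)%N.
  exact: adapted_past.
exact: measurable_cst.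
Qed.

(** For fixed B both sides are finite measures in the event that W lies in A. They agree on the
    rectangles of the past by mutual independence, hence on the sigma-algebra these generate. *)
Lemma independent_of_past (R : realType) (d : measure_display)
    (T : measurableType d) (P : probability T R) (X : nat -> {RV P >-> R})
    n (W : T -> R) (A B : set R) :
  mutually_independent X -> adapted X n W -> measurable A -> measurable B ->
  P (W @^-1` A `&` X n @^-1` B) = (P (W @^-1` A) * P (X n @^-1` B))%E.
Proof.
move=> iX aW mA mB; set D := X n @^-1` B.
have mD : measurable D.
  by rewrite -[X in measurable X]setTI; exact: measurable_funP.
have fD : (fine (P D))%:E = P D by rewrite fineK// fin_num_measure.
have f0 : 0 <= fine (P D) by rewrite fine_ge0.
rewrite muleC -fD.
change (mrestr P mD (W @^-1` A) = mscale (NngNum f0) P (W @^-1` A)).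
apply: (@g_sigma_algebra_measure_unique d R T (past X n) _ (fun=> setT)).
- by move=> E pE; apply: (@past_measurable _ _ _ _ X n); exact: sub_sigma_algebra.
- move=> _; exists (fun=> setT); split => //.
  by apply/seteqP; split.
- by apply/seteqP; split => // w _; exists 0%N.
- move=> _ _ [A1 [mA1 ->]] [A2 [mA2 ->]]; exists (fun k => A1 k `&` A2 k).
  split; first by move=> k; exact: measurableI.
  apply/seteqP; split => w /=; first by move=> [h1 h2] k kn; split; [exact: h1|exact: h2].
  by move=> h; split => k /h[].
- move=> _ [C [mC ->]].
  change (P ([set w | forall k, (k < n)%N -> C k (X k w)] `&` D) =
    ((fine (P D))%:E * P [set w | forall k, (k < n)%N -> C k (X k w)])%E).
  rewrite fD (mutually_independent_prefix n iX mC).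
  (* With B in coordinate n the intersection is again an event on an initial segment, now of length
     n + 1. *)
  pose C' k := if k == n then B else C k.
  have mC' k : measurable (C' k) by rewrite /C'; case: ifP.
  have := mutually_independent_prefix n.+1 iX mC'.
  rewrite big_nat_recr//= {3}/C' eqxx muleC => h.
  transitivity (P [set w | forall k, (k < n.+1)%N -> C' k (X k w)]).
    congr (P _); apply/seteqP; split => w /=.
      move=> [h1 h2] k; rewrite ltnS leq_eqVlt /C'; case: eqP => [->//|_ /=]; exact: h1.
    move=> h1; split; last by have := h1 n (ltnSn n); rewrite /C' eqxx.
    by move=> k kn; have := h1 k (ltnW kn); rewrite /C' lt_eqF.
  rewrite h; congr (_ * _)%E; apply: eq_big_nat => k /andP[_ kn].
  by rewrite /C' lt_eqF.
- move=> _; apply: (le_lt_trans (probability_le1 P _)); last exact: ltry.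
  exact: measurableI.
- by have := aW measurableT A mA; rewrite setTI.
Qed.

(** The hypothesis says that the law of the pair agrees with the product of the two laws on
    rectangles, hence everywhere; the rest is Tonelli. *)
Lemma fubini_pair_ge0 (R : realType) (d : measure_display)
    (T : measurableType d) (P : probability T R) (W X : {RV P >-> R})
    (h : R * R -> \bar R) :
  (forall A B : set R, measurable A -> measurable B ->
    P (W @^-1` A `&` X @^-1` B) = (P (W @^-1` A) * P (X @^-1` B))%E) ->
  measurable_fun setT h -> (forall z, 0 <= h z)%E ->
  (\int[P]_w h (W w, X w) = \int[P]_w \int[distribution P X]_x h (W w, x))%E.
Proof.
move=> indep mh h0.
have mWX : measurable_fun setT (fun w => (W w, X w)) by exact: measurable_fun_pair.
pose F : {mfun T >-> (R * R)%type} := mfun_Sub (mem_set mWX).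
transitivity (\int[distribution P F]_z h z)%E.
  by rewrite ge0_integral_distribution.
transitivity (\int[(distribution P W \x distribution P X)%E]_z h z)%E.
  apply: eq_measure_integral => A mA _; apply/esym/product_measure_unique => //.
rewrite fubini_tonelli1//= ge0_integral_distribution//.
- exact: measurable_fun_fubini_tonelli_F.
- by move=> y; exact: integral_ge0.
Qed.

Lemma fubini_pair (R : realType) (d : measure_display)
    (T : measurableType d) (P : probability T R) (W X : {RV P >-> R})
    (h : R * R -> R) :
  (forall A B : set R, measurable A -> measurable B ->
    P (W @^-1` A `&` X @^-1` B) = (P (W @^-1` A) * P (X @^-1` B))%E) ->
  bounded_mfun h ->
  \int[P]_w h (W w, X w) = \int[P]_w \int[distribution P X]_x h (W w, x).
Proof.
move=> indep bh.
have [mh [M hM]] := bh.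
have M0 : 0 <= M by rewrite (le_trans _ (hM (0, 0))).
have mWX : measurable_fun setT (fun w => (W w, X w)) by exact: measurable_fun_pair.
(* Adding the bound M makes the integrand nonnegative, so that the previous lemma applies; both
   sides are shifted by the same M. *)
have bhM : bounded_mfun (fun z => h z + M) by apply: bounded_mfunD => //; exact: bounded_mfun_cst.
have hs u : bounded_mfun (fun x => h (u, x)).
  by apply: (bounded_mfun_comp bh); exact: measurable_fun_pair.
have hsM u : bounded_mfun (fun x => h (u, x) + M) by apply: bounded_mfunD => //; exact: bounded_mfun_cst.
have E u : \int[distribution P X]_x (h (u, x) + M) = \int[distribution P X]_x h (u, x) + M.
  rewrite RintegralD ?Rintegral_prob_cst//; apply: bounded_mfun_integrable => //.
  exact: bounded_mfun_cst.
have pos z : 0 <= h z + M.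
  by have := hM z; rewrite ler_norml => /andP[+ _]; rewrite -subr_ge0 opprK.
have := @fubini_pair_ge0 R d T P W X (fun z => (h z + M)%:E) indep.
have mhM : measurable_fun setT (fun z => (h z + M)%:E) by apply/measurable_EFinP; case: bhM.
move=> /(_ mhM pos) key.
have mI : measurable_fun setT (fun u => \int[distribution P X]_x h (u, x)).
  rewrite (_ : (fun _ => _) = (fun u => fine (\int[distribution P X]_x (h (u, x) + M)%:E)%E - M)).
    apply: measurable_funB => //; apply: measurableT_comp => //.
    exact: (@measurable_fun_fubini_tonelli_F _ _ _ _ _ (distribution P X)
      (fun z : R * R => (h z + M)%:E)).
  by apply/funext => u; rewrite -/(Rintegral _ _ _) E addrK.
have bI : bounded_mfun (fun w => \int[distribution P X]_x h (W w, x)).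
  split; first exact: (measurableT_comp mI).
  exists M => w; rewrite -[X in `|X|]subr0; apply: normr_Rintegral_sub => //.
  by apply: aeW => x; rewrite subr0.
apply: (addIr M).
have bWX : bounded_mfun (fun w => h (W w, X w)) by exact: (bounded_mfun_comp bh).
have D (g : T -> R) : bounded_mfun g -> \int[P]_w g w + M = \int[P]_w (g w + M).
  move=> bg; rewrite RintegralD ?Rintegral_prob_cst//; apply: bounded_mfun_integrable => //.
  exact: bounded_mfun_cst.
rewrite !D//; congr fine; rewrite key; apply: eq_integral => w _.
by rewrite -E Rintegral_EFin.
Qed.

Lemma expectation_mul_adapted (R : realType) (d : measure_display)
    (T : measurableType d) (P : probability T R) (X : nat -> {RV P >-> R})
    n (W : T -> R) :
  mutually_independent X -> adapted X n W -> bounded_mfun W ->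
  bounded_mfun (X n) ->
  \int[P]_w (W w * X n w) = \int[P]_w W w * \int[P]_w X n w.
Proof.
move=> iX aW bW bX; have mW := adapted_measurable aW.
pose V : {RV P >-> R} := mfun_Sub (mem_set mW).
have [_ [M' WM']] := bW; have [_ [N' XN']] := bX.
pose M := `|M'|; pose N := `|N'|.
have WM w : `|W w| <= M by rewrite (le_trans (WM' w))// ler_norm.
have XN w : `|X n w| <= N by rewrite (le_trans (XN' w))// ler_norm.
(* Truncation makes the integrand bounded on the whole plane. *)
pose c (K x : R) : R := Num.min K (Num.max (- K) x).
have cE K x : `|x| <= K -> c K x = x.
  by rewrite ler_norml => /andP[h1 h2]; rewrite /c (max_idPr h1) (min_idPr h2).
have cK K x : 0 <= K -> `|c K x| <= K.
  move=> K0; rewrite ler_norml /c ge_min lexx/= andbT.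
  by rewrite le_min le_max lexx/= andbT ge0_cp.
have mc K : measurable_fun setT (c K).
  by apply: measurable_minr => //; exact: measurable_maxr.
have bc K : 0 <= K -> bounded_mfun (c K).
  by move=> K0; split => //; exists K => x; exact: cK.
have bM := bc _ (normr_ge0 M'); have bN := bc _ (normr_ge0 N').
have h1 := @fubini_pair R d T P V (X n) (fun z => c M z.1 * c N z.2)
  (fun A B mA mB => independent_of_past iX aW mA mB)
  (bounded_mfunM (bounded_mfun_comp bM measurable_fst) (bounded_mfun_comp bN measurable_snd)).
transitivity (\int[P]_w (c M (V w) * c N (X n w))).
  by apply: eq_Rintegral => w _; rewrite !cE.
rewrite h1 /=.
have iN : \int[distribution P (X n)]_x c N x = \int[P]_w X n w.
  transitivity (\int[P]_w c N (X n w)); last by apply: eq_Rintegral => w _; rewrite cE.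
  congr fine; rewrite integral_distribution//; first by apply/measurable_EFinP.
  by apply: bounded_mfun_integrable; exact: bounded_mfun_comp.
transitivity (\int[P]_w (W w * \int[P]_w X n w)).
  apply: eq_Rintegral => w _; rewrite RintegralZl//.
    by rewrite iN cE.
  exact: bounded_mfun_integrable.
by rewrite RintegralZr//; exact: bounded_mfun_integrable.
Qed.

Lemma uniform_on_same_law (R : realType) (d : measure_display)
    (T : measurableType d) (P : probability T R) (X : {RV P >-> R})
    (d' : measure_display) (T' : measurableType d') (Q : probability T' R)
    (Y : {RV Q >-> R}) (a b : R) :
  uniform_on a b X -> uniform_on a b Y -> forall A, measurable A ->
  distribution P X A = distribution Q Y A.
Proof.
move=> [ab Xab Xa] [_ Yab Ya] A mA.
move: ab; rewrite le_eqVlt => /predU1P[ab|ab].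
  by rewrite Xa// Ya.
by rewrite (Xab ab)// (Yab ab).
Qed.

(** Integrating out the last variable replaces f by its average over the law of that variable, so
    the induction has to run over all nonnegative f. *)
Lemma partial_sum_same_law (R : realType) (d : measure_display)
    (T : measurableType d) (P : probability T R) (X : nat -> {RV P >-> R})
    (d' : measure_display) (T' : measurableType d') (Q : probability T' R)
    (Y : nat -> {RV Q >-> R}) n (f : R -> \bar R) :
  mutually_independent X -> mutually_independent Y ->
  (forall k A, measurable A -> distribution P (X k) A = distribution Q (Y k) A) ->
  measurable_fun setT f -> (forall x, 0 <= f x)%E ->
  (\int[P]_w f (\sum_(0 <= k < n) X k w)%R =
   \int[Q]_w f (\sum_(0 <= k < n) Y k w)%R)%E.
Proof.
move=> iX iY XY; elim: n f => [|n IH] f mf f0.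
  under eq_integral do rewrite big_geq//.
  under [RHS]eq_integral do rewrite big_geq//.
  rewrite !integral_cst//; congr (_ * _)%E.
  by transitivity (1%E : \bar R); [|apply/esym]; exact: probability_setT.
have step (d1 : measure_display) (T1 : measurableType d1) (P1 : probability T1 R)
    (Z : nat -> {RV P1 >-> R}) : mutually_independent Z ->
    (\int[P1]_w f (\sum_(0 <= k < n.+1) Z k w)%R =
     \int[P1]_w \int[distribution P1 (Z n)]_x f (\sum_(0 <= k < n) Z k w + x)%R)%E.
  move=> iZ; have aS := @adapted_sum _ _ _ _ Z n n (leqnn n).
  pose S : {RV P1 >-> R} := mfun_Sub (mem_set (adapted_measurable aS)).
  rewrite -(@fubini_pair_ge0 R _ _ P1 S (Z n) (fun z => f (z.1 + z.2)%R)) //.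
  - by apply: eq_integral => w _; rewrite big_nat_recr.
  - by move=> A B mA mB; exact: independent_of_past.
  - by apply: (measurableT_comp mf); exact: measurable_funD.
rewrite !step//.
pose g (y : R) := (\int[distribution P (X n)]_x f (y + x)%R)%E.
transitivity (\int[Q]_w g (\sum_(0 <= k < n) Y k w)%R)%E.
  apply: IH; last by move=> y; exact: integral_ge0.
  apply: (@measurable_fun_fubini_tonelli_F _ _ _ _ _ (distribution P (X n))
    (fun z : R * R => f (z.1 + z.2)%R)) => //.
  by apply: (measurableT_comp mf); exact: measurable_funD.
apply: eq_integral => w _; apply: eq_measure_integral => A mA _; exact: XY.
Qed.

(** * Kolmogorov's inequality *)

Lemma mutually_independent_comp (R : realType) (d : measure_display)
    (T : measurableType d) (P : probability T R) (X Y : nat -> {RV P >-> R})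
    (g : nat -> R -> R) :
  (forall k, measurable_fun setT (g k)) ->
  (forall k w, Y k w = g k (X k w)) ->
  mutually_independent X -> mutually_independent Y.
Proof.
move=> mg Yg iX J A mA.
have YE k : Y k @^-1` A k = X k @^-1` (g k @^-1` A k).
  by apply/seteqP; split => w /=; rewrite Yg.
under eq_bigr do rewrite YE; under [RHS]eq_bigr do rewrite YE.
by apply: iX => k; rewrite -[X in measurable X]setTI; exact: mg.
Qed.

Lemma mutually_independent_reindex (R : realType) (d : measure_display)
    (T : measurableType d) (P : probability T R) (X : nat -> {RV P >-> R})
    (r : nat -> nat) :
  injective r -> mutually_independent X -> mutually_independent (fun k => X (r k)).
Proof.
move=> rI iX J A mA.
(* The sets are carried along r, injectivity making the preimage unique. An index outside the range
   of r receives the set [A 0], which is measurable like the others. *)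
pose A' j := A (xget 0%N [set k | r k = j]).
have A'E k : A' (r k) = A k.
  congr A; apply: (rI).
  exact: (@xgetPex _ 0%N [set j | r j = r k] (ex_intro _ k erefl)).
have mA' j : measurable (A' j) by exact: mA.
have := iX [fset r k | k in J]%fset A' mA'.
rewrite !big_imfset/=; try by move=> ? ? _ _ /rI.
under eq_bigr do rewrite A'E; under [in X in _ = X]eq_bigr do rewrite A'E.
by [].
Qed.

Lemma adapted_mono (R : realType) (d : measure_display)
    (T : measurableType d) (P : probability T R) (X : nat -> {RV P >-> R})
    m n (W : T -> R) : (m <= n)%N -> adapted X m W -> adapted X n W.
Proof.
move=> mn aW _ B mB; rewrite setTI; have := aW measurableT B mB; rewrite setTI.
apply: smallest_sub; first exact: smallest_sigma_algebra.
move=> _ [A [mA ->]]; apply: sub_sigma_algebra.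
exists (fun k => if (k < m)%N then A k else setT); split.
  by move=> k; case: ifP.
apply/seteqP; split => w /= h k; first by case: ifP => // km _; exact: h.
by move=> km; have := h k (leq_trans km mn); rewrite km.
Qed.

Lemma bounded_mfun_sum (d : measure_display) (T : measurableType d)
    (R : realType) (f : nat -> T -> R) n :
  (forall k, bounded_mfun (f k)) ->
  bounded_mfun (fun w => \sum_(0 <= k < n) f k w).
Proof.
move=> bf; elim: n => [|n IH].
  by under eq_fun do rewrite big_geq//; exact: bounded_mfun_cst.
by under eq_fun do rewrite big_nat_recr//=; exact: bounded_mfunD.
Qed.

(** The cross terms vanish: [H n] times the sum so far is adapted at n, hence independent of [X n],
    which has mean 0. It serves twice, with stopping indicators for the maximal inequality and with
    constant 0-1 weights for rearrangements. *)
Lemma martingale_transform_L2 (R : realType) (d : measure_display)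
    (T : measurableType d) (P : probability T R) (X : nat -> {RV P >-> R})
    (C h : nat -> R) (H : nat -> T -> R) n :
  mutually_independent X -> (forall k w, `|X k w| <= C k) ->
  (forall k, \int[P]_w X k w = 0) ->
  (forall k, adapted X k (H k)) -> (forall k w, `|H k w| <= h k) ->
  \int[P]_w (\sum_(0 <= k < n) H k w * X k w) ^+ 2 <=
  \sum_(0 <= k < n) (h k * C k) ^+ 2.
Proof.
move=> iX XC X0 aH Hh.
have bX k : bounded_mfun (X k) by split => //; exists (C k).
have bH k : bounded_mfun (H k).
  by split; [exact: adapted_measurable (aH k)|exists (h k)].
pose M m w := \sum_(0 <= k < m) H k w * X k w.
have bM m : bounded_mfun (M m).
  by apply: bounded_mfun_sum => k; exact: bounded_mfunM.
have aM m : adapted X m (M m).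
  rewrite /adapted /M.
  have -> : (fun w => \sum_(0 <= k < m) H k w * X k w) =
      (fun w => \sum_(0 <= k < m) (if (k < m)%N then H k w * X k w else 0)).
    by apply/funext => w; apply: eq_big_nat => k /andP[_ ->].
  apply: measurable_sum => k; have [km|_] := boolP (k < m)%N.
    apply: measurable_funM; last exact: adapted_past.
    exact: adapted_mono (ltnW km) (aH k).
  exact: measurable_cst.
rewrite -/(M n); elim: n => [|n IH].
  rewrite big_geq//; under eq_Rintegral do rewrite /M big_geq// expr2 mulr0.
  by rewrite Rintegral_prob_cst.
have b2 (f g : T -> R) : bounded_mfun f -> bounded_mfun g -> P.-integrable setT (EFin \o (fun w => f w * g w)).
  by move=> bf bg; apply: bounded_mfun_integrable; exact: bounded_mfunM.
have E w : M n.+1 w ^+ 2 = M n w * M n w + (2 * (M n w * H n w * X n w) + (H n w * X n w) * (H n w * X n w)).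
  by rewrite /M big_nat_recr//= -/(M n w); ring.
under eq_Rintegral do rewrite E.
have bMH : bounded_mfun (fun w => M n w * H n w) by exact: bounded_mfunM.
have bHX : bounded_mfun (fun w => H n w * X n w) by exact: bounded_mfunM.
rewrite RintegralD//; last 2 first.
- exact: b2.
- apply: bounded_mfun_integrable; apply: bounded_mfunD; last exact: bounded_mfunM.
  by apply: bounded_mfunM; [exact: bounded_mfun_cst|exact: bounded_mfunM].
rewrite RintegralD//; last 2 first.
- apply: bounded_mfun_integrable.
  by apply: bounded_mfunM; [exact: bounded_mfun_cst|exact: bounded_mfunM].
- exact: b2.
rewrite RintegralZl//; last exact: b2.
rewrite (expectation_mul_adapted iX _ bMH (bX n)); last first.
  by apply: measurable_funM; [exact: aM|exact: aH].
rewrite X0 mulr0 mulr0 add0r big_nat_recr//= lerD//.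
rewrite -[leRHS](Rintegral_prob_cst P); apply: le_Rintegral => //.
- exact: b2.
- by apply: bounded_mfun_integrable; exact: bounded_mfun_cst.
- move=> w _; rewrite -expr2 -[leLHS]ger0_norm ?sqr_ge0// normrX normrM lerXn2r// ?nnegrE ?mulr_ge0 ?ler_pM//.
  + by rewrite (le_trans _ (Hh n w)).
  + by rewrite (le_trans _ (XC n w)).
Qed.

(** Stopping the sum at its first exit is a transform by indicators of past events, so its second
    moment is still bounded by the sum of the [C k ^+ 2]; Chebyshev's inequality for the stopped sum
    concludes. The bounds [C k] stand in for standard deviations. *)
Lemma kolmogorov_inequality (R : realType) (d : measure_display)
    (T : measurableType d) (P : probability T R) (X : nat -> {RV P >-> R})
    (C : nat -> R) (e : R) n :
  mutually_independent X -> (forall k w, `|X k w| <= C k) ->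
  (forall k, \int[P]_w X k w = 0) -> 0 < e ->
  (P [set w | exists2 k, (k <= n)%N & (e <= `|\sum_(0 <= j < k) X j w|)%R] <=
   ((\sum_(0 <= k < n) C k ^+ 2) / e ^+ 2)%:E)%E.
Proof.
move=> iX XC X0 e0; set E := mkset _.
pose S k w := \sum_(0 <= j < k) X j w.
(* The sum is frozen at the first time it leaves the interval ]-e, e[. *)
pose G j := [set w | forall i, (i <= j)%N -> `|S i w| < e].
have mG j : (past X j).-sigma.-measurable (G j).
  have h i : (i <= j)%N -> (past X j).-sigma.-measurable (S i @^-1` [set x | `|x| < e]).
    move=> ij; rewrite -[X in measurable X]setTI; apply: (adapted_sum ij) => //.
    have -> : [set x : R | `|x| < e] = `]-e, e[%classic.
      by apply/seteqP; split => x /=; rewrite in_itv/= ltr_norml.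
    exact: measurable_itv.
  rewrite /G -(bigsetI_iotaE j.+1 (fun i => S i @^-1` [set x | `|x| < e])).
  rewrite big_seq; apply: (@bigsetI_measurable _ (g_sigma_algebraType (past X j))) => i.
  by rewrite mem_iota => /andP[_ ij]; apply: h.
pose H j : T -> R := \1_(G j).
have aH j : adapted X j (H j) by exact: (@measurable_indic _ (g_sigma_algebraType (past X j)) R setT).
have H1 j w : `|H j w| <= 1 by rewrite /H indicE ger0_norm// lern1 leq_b1.
have mE : measurable E.
  have -> : E = \bigcup_(k in `I_n.+1) (S k @^-1` [set x | e <= `|x|]).
    apply/seteqP; split => w /=; first by move=> [k kn h]; exists k => //=; rewrite ltnS.
    by move=> [k /= kn h]; exists k => //; rewrite -ltnS.
  apply: bigcup_measurable => k _; rewrite -[X in measurable X]setTI.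
  apply: (adapted_measurable (@adapted_sum _ _ _ _ X k k (leqnn k))) => //.
  have -> : [set x : R | e <= `|x|] = ~` `]-e, e[%classic.
    apply/seteqP; split => x /=; rewrite in_itv/= -ltr_norml leNgt; first exact/negP.
    by move/negP.
  exact: measurableC.
have key w : e ^+ 2 * \1_E w <= (\sum_(0 <= k < n) H k w * X k w) ^+ 2.
  rewrite indicE; case: (boolP (w \in E)); last by rewrite mulr0 sqr_ge0.
  rewrite inE mulr1 => Ew.
  have ex : exists k, (k <= n)%N && (e <= `|S k w|) by case: Ew => k kn h; exists k; rewrite kn.
  case: (ex_minnP ex) => k /andP[kn ek] kmin.
  suff -> : \sum_(0 <= j < n) H j w * X j w = S k w.
    by rewrite -[leRHS]real_normK ?num_real// lerXn2r// ?nnegrE ?ltW// normr_ge0.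
  rewrite (big_cat_nat (leq0n k) kn)/= [X in _ + X]big1_seq ?addr0.
    apply: eq_big_nat => j /andP[_ jk].
    rewrite /H indicE mem_set ?mul1r// => i ij; rewrite ltNge; apply/negP => ei.
    have ik := leq_ltn_trans ij jk.
    by have := kmin i; rewrite (leq_trans (ltnW ik) kn) ei => /(_ isT); rewrite leqNgt ik.
  move=> j; rewrite mem_index_iota => /andP[_ /andP[kj _]].
  rewrite /H indicE memNset ?mul0r// => /(_ k kj).
  by rewrite ltNge ek.
have := @martingale_transform_L2 R d T P X C (fun=> 1) H n iX XC X0 aH H1.
under eq_bigr do rewrite mul1r.
move=> le2.
have bE : bounded_mfun (\1_E : T -> R).
  by split; [exact: measurable_indic|exists 1 => w; rewrite indicE ger0_norm// lern1 leq_b1].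
have bS : bounded_mfun (fun w => (\sum_(0 <= k < n) H k w * X k w) ^+ 2).
  under eq_fun do rewrite expr2.
  have bs : bounded_mfun (fun w => \sum_(0 <= k < n) H k w * X k w).
    apply: bounded_mfun_sum => k; apply: bounded_mfunM.
      by split; [exact: adapted_measurable (aH k)|exists 1].
    by split => //; exists (C k).
  exact: bounded_mfunM.
have PE : P E = (\int[P]_w \1_E w)%:E.
  by rewrite Rintegral_EFin// integral_indic// setIT.
rewrite PE lee_fin ler_pdivlMr ?exprn_gt0// mulrC -RintegralZl//; last first.
  exact: bounded_mfun_integrable.
apply: le_trans le2; apply: le_Rintegral => //; apply: bounded_mfun_integrable => //.
by apply: bounded_mfunM => //; exact: bounded_mfun_cst.
Qed.

(** The bound does not depend on n, so it passes to the increasing union of the events and yields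
    one exceptional event for all partial sums. *)
Lemma kolmogorov_inequality_infinite (R : realType) (d : measure_display)
    (T : measurableType d) (P : probability T R) (X : nat -> {RV P >-> R})
    (C : nat -> R) (e B : R) :
  mutually_independent X -> (forall k w, `|X k w| <= C k) ->
  (forall k, \int[P]_w X k w = 0) -> 0 < e ->
  (forall n, \sum_(0 <= k < n) C k ^+ 2 <= B) ->
  exists E, [/\ measurable E, (P E <= (B / e ^+ 2)%:E)%E &
    forall w, ~ E w -> forall k, `|\sum_(0 <= j < k) X j w| < e].
Proof.
move=> iX XC X0 e0 CB.
pose E n := [set w | exists2 k, (k <= n)%N & (e <= `|\sum_(0 <= j < k) X j w|)%R].
have mE n : measurable (E n).
  have -> : E n = \bigcup_(k in `I_n.+1) ((fun w => \sum_(0 <= j < k) X j w) @^-1` [set x | e <= `|x|]).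
    apply/seteqP; split => w /=; first by move=> [k kn h]; exists k => //=; rewrite ltnS.
    by move=> [k /= kn h]; exists k => //; rewrite -ltnS.
  apply: bigcup_measurable => k _; rewrite -[X in measurable X]setTI.
  apply: (adapted_measurable (@adapted_sum _ _ _ _ X k k (leqnn k))) => //.
  have -> : [set x : R | e <= `|x|] = ~` `]-e, e[%classic.
    apply/seteqP; split => x /=; rewrite in_itv/= -ltr_norml leNgt; first exact/negP.
    by move/negP.
  exact: measurableC.
exists (\bigcup_n E n); split.
- exact: bigcupT_measurable.
- have cv : P (E n) @[n --> \oo] --> P (\bigcup_n E n).
    apply: nondecreasing_cvg_mu => //; first exact: bigcupT_measurable.
    by move=> m n mn; apply/subsetPset => w [k km h]; exists k => //; exact: leq_trans mn.
  rewrite -(cvg_lim _ cv)//; apply: lime_le; first by apply/cvg_ex; eexists; exact: cv.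
  apply: nearW => n; apply: le_trans (kolmogorov_inequality n iX XC X0 e0) _.
  by rewrite lee_fin ler_wpM2r// invr_ge0 exprn_ge0// ltW.
- move=> w nE k; rewrite ltNge; apply/negP => h; apply: nE.
  by exists k => //; exists k.
Qed.

Lemma sum_nat_shift (V : zmodType) (N n : nat) (f : nat -> V) :
  \sum_(N <= k < N + n) f k = \sum_(0 <= k < n) f (N + k)%N.
Proof.
rewrite -[X in \sum_(X <= _ < _) _]add0n big_addn addKn.
by apply: eq_bigr => k _; rewrite addnC.
Qed.

(** Apply the maximal inequality to the tail from N at height 1 / (m + 1). The exceptional events
    have probability at most (l - s N) (m + 1)^2, which tends to 0 with N, so their intersection
    over N is null for each m. Off the union over m of these null sets, the partial sums are
    Cauchy. *)
Lemma kolmogorov_cvg (R : realType) (d : measure_display)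
    (T : measurableType d) (P : probability T R) (X : nat -> {RV P >-> R})
    (C : nat -> R) :
  mutually_independent X -> (forall k w, `|X k w| <= C k) ->
  (forall k, \int[P]_w X k w = 0) ->
  cvgn (series (fun k => C k ^+ 2)) ->
  {ae P, forall w, cvgn (fun n => \sum_(0 <= k < n) X k w)}.
Proof.
move=> iX XC X0 cC.
pose s := series (fun k => C k ^+ 2); pose l := limn s.
have sl n : s n <= l.
  apply: nondecreasing_cvgn_le => //; apply: nondecreasing_series => k _ _.
  exact: sqr_ge0.
have ex (N m : nat) : exists E, [/\ measurable E,
    (P E <= ((l - s N) * m.+1%:R ^+ 2)%:E)%E &
    forall w, ~ E w -> forall k, `|\sum_(N <= j < N + k) X j w| < m.+1%:R^-1].
  have iX' : mutually_independent (fun k => X (N + k)%N).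
    by apply: mutually_independent_reindex iX => a b; exact: addnI.
  have [||||E [mE PE EP]] := @kolmogorov_inequality_infinite R d T P
      (fun k => X (N + k)%N) (fun k => C (N + k)%N) m.+1%:R^-1 (l - s N) iX'.
  - by move=> k w; exact: XC.
  - by move=> k; exact: X0.
  - by rewrite invr_gt0.
  - move=> n; rewrite lerBrDl; apply: le_trans (sl (N + n)%N).
    rewrite /s /series/= (big_cat_nat (leq0n N) (leq_addr n N))/= lerD2l.
    by rewrite (sum_nat_shift N n (fun i => C i ^+ 2)).
  exists E; split => //; first by rewrite exprVn invrK in PE.
  move=> w nE k; have := EP w nE k.
  by rewrite -(sum_nat_shift N k (fun j => X j w)).
pose E N m := sval (cid (ex N m)).
have EP N m : [/\ measurable (E N m),
    (P (E N m) <= ((l - s N) * m.+1%:R ^+ 2)%:E)%E &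
    forall w, ~ E N m w -> forall k, `|\sum_(N <= j < N + k) X j w| < m.+1%:R^-1].
  by rewrite /E; case: cid.
have neg m : P (\bigcap_N E N m) = 0%E.
  apply/eqP; rewrite eq_le measure_ge0 andbT.
  have mI : measurable (\bigcap_N E N m).
    by apply: bigcapT_measurable => N; case: (EP N m).
  have cv : ((l - s N) * m.+1%:R ^+ 2)%:E @[N --> \oo] --> 0%E.
    apply: cvg_EFin; first exact: nearW.
    rewrite /comp/= -[X in _ --> X](mul0r (m.+1%:R ^+ 2 : R)) -(subrr l).
    by apply: cvgM; [apply: cvgB => //; exact: cvg_cst|exact: cvg_cst].
  rewrite -(cvg_lim _ cv)//; apply: lime_ge; first by apply/cvg_ex; eexists; exact: cv.
  apply: nearW => N; have [mE PE _] := EP N m.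
  apply: le_trans PE; apply: le_measure; rewrite ?inE//.
  by move=> w; exact.
have neg2 : P.-negligible (\bigcup_m \bigcap_N E N m).
  apply: negligible_bigcup => m; exists (\bigcap_N E N m).
  split; [|exact: neg|by []].
  by apply: bigcapT_measurable => N; case: (EP N m).
apply: negligibleS neg2 => w /= ncv.
apply: contrapT => nE; apply: ncv.
apply/cauchy_cvgP/cauchy_seriesP => e e0.
have e2 : 0 < e / 2 by rewrite divr_gt0.
have [m] := ltr_add_invr e2; rewrite add0r => me.
have [N nN] : exists N, ~ E N m w.
  apply: contrapT => /forallNP h; apply: nE; exists m => // N _.
  exact: contrapT (h N).
have [_ _ /(_ w nN) EN] := EP N m.
have {}EN k : (N <= k)%N -> `|\sum_(N <= j < k) X j w| < e / 2.
  by move=> /subnKC <-; exact: lt_trans (EN _) me.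
exists ([set n | (N <= n)%N], [set n | (N <= n)%N]); first by split; exists N.
move=> [a b] /= [Na Nb]; have [ba|/ltnW ab] := leqP b a.
  by rewrite big_geq// normr0.
have -> : \sum_(a <= k < b) X k w = \sum_(N <= k < b) X k w - \sum_(N <= k < a) X k w.
  by rewrite (big_cat_nat Na ab)/= addrAC subrr add0r.
by rewrite (le_lt_trans (ler_normB _ _))// [ltRHS]splitr ltrD// EN.
Qed.

(** Setting the sequence to 0 on a measurable null set makes it converge everywhere, which gives a
    measurable limit. *)
Lemma ae_limit_exists (R : realType) (d : measure_display)
    (T : measurableType d) (P : probability T R) (S_ : nat -> T -> R) :
  (forall n, measurable_fun setT (S_ n)) ->
  {ae P, forall w, cvgn (fun n => S_ n w)} ->
  exists S : {RV P >-> R}, {ae P, forall w, S_ n w @[n --> \oo] --> S w}.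
Proof.
move=> mS [N [mN PN SN]].
pose g n w := S_ n w * \1_(~` N) w.
have cg w : g n w @[n --> \oo] --> limn (fun n => g n w).
  have [Nw|Nw] := pselect (N w).
    have -> : (fun n => g n w) = fun=> 0.
      by apply/funext => n; rewrite /g indicE memNset ?mulr0//; exact.
    exact: is_cvg_cst.
  apply: is_cvgM; last exact: is_cvg_cst.
  by apply: contrapT => /SN.
have mg : measurable_fun setT (fun w => limn (fun n => g n w)).
  apply: (@measurable_fun_cvg _ _ _ _ g) => // n.
  by apply: measurable_funM => //; apply: measurable_indic; exact: measurableC.
exists (mfun_Sub (mem_set mg)); exists N; split => // w /= h.
apply: contrapT => Nw; apply: h.
apply: cvg_trans (cg w); apply: near_eq_cvg; apply: nearW => n /=.
by rewrite /g indicE mem_set// mulr1.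
Qed.

(** The bound is asked only eventually, because a partial sum can be compared with a rearranged one
    only after it has passed all the indices involved; the sequence is therefore shifted before
    Fatou's lemma. *)
Lemma fatou_sqr (R : realType) (d : measure_display)
    (T : measurableType d) (P : probability T R) (Y_ : nat -> T -> R)
    (Y : T -> R) (b : R) :
  (forall n, measurable_fun setT (Y_ n)) -> measurable_fun setT Y ->
  {ae P, forall w, Y_ n w @[n --> \oo] --> Y w} ->
  (\forall n \near \oo, (\int[P]_w (Y_ n w ^+ 2)%:E <= b%:E)%E) ->
  (\int[P]_w (Y w ^+ 2)%:E <= b%:E)%E.
Proof.
move=> mY_ mY YY [N _ Yb].
have mf n : measurable_fun setT (fun w => (Y_ (n + N)%N w ^+ 2)%:E).
  by apply/measurable_EFinP; exact: measurable_funX.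
have f0 n w : setT w -> (0 <= (Y_ (n + N)%N w ^+ 2)%:E)%E.
  by move=> _; rewrite lee_fin sqr_ge0.
have h := @fatou _ _ _ P setT measurableT _ mf f0.
rewrite (ae_eq_integral (fun w => limn_einf (fun n => (Y_ (n + N)%N w ^+ 2)%:E)))//.
- apply: le_trans h _; rewrite limn_einf_lim; apply: lime_le.
    exact: is_cvg_einfs.
  apply: nearW => n; apply: (le_trans _ (Yb (n + N)%N (leq_addl _ _))).
  by apply: ereal_inf_lbound; exists n => //=.
- by apply/measurable_EFinP; exact: measurable_funX.
- under eq_fun do rewrite limn_einf_lim.
  apply: (emeasurable_fun_cvg (fun n w => einfs (fun n => (Y_ (n + N)%N w ^+ 2)%:E) n)).
    exact: measurable_fun_einfs.
  by move=> w _; exact: is_cvg_einfs.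
- apply: filterS YY => w Yw _; apply/esym.
  apply: (cvg_limn_einf_sup _).1; apply: cvg_EFin; first exact: nearW.
  have h2 : (Y_ n w ^+ 2) @[n --> \oo] --> Y w ^+ 2.
    by under eq_fun do rewrite expr2; rewrite expr2; exact: cvgM.
  by rewrite -(cvg_shiftn N) in h2.
Qed.

(** * The characteristic function of a uniform sum *)

Lemma Rintegral_distribution (R : realType) (d : measure_display)
    (T : measurableType d) (P : probability T R) (X : {RV P >-> R})
    (f : R -> R) : bounded_mfun f ->
  \int[distribution P X]_x f x = \int[P]_w f (X w).
Proof.
move=> bf; congr fine; rewrite integral_distribution//.
  by apply/measurable_EFinP; case: bf.
by apply: bounded_mfun_integrable; exact: bounded_mfun_comp.
Qed.

Lemma ae_eq_law (R : realType) (d : measure_display)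
    (T : measurableType d) (P : probability T R) (X Y : T -> R) (A : set R) :
  measurable_fun setT X -> measurable_fun setT Y -> measurable A ->
  {ae P, forall w, X w = Y w} -> P (X @^-1` A) = P (Y @^-1` A).
Proof.
move=> mX mY mA XY.
have mp (f : T -> R) : measurable_fun setT f -> measurable (f @^-1` A).
  by move=> mf; rewrite -[X in measurable X]setTI; exact: mf.
have E f : measurable_fun setT f -> P (f @^-1` A) = (\int[P]_w (\1_A (f w))%:E)%E.
  by move=> mf; rewrite -(setIT (f @^-1` A)) -integral_indic//; exact: mp.
rewrite !E//; apply: ae_eq_integral => //.
- by apply/measurable_EFinP; apply: measurableT_comp mX; exact: measurable_indic.
- by apply/measurable_EFinP; apply: measurableT_comp mY; exact: measurable_indic.
- by apply: filterS XY => w -> _.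
Qed.

Lemma uniform_on_ae (R : realType) (d : measure_display)
    (T : measurableType d) (P : probability T R) (a b : R) (X : {RV P >-> R}) :
  uniform_on a b X -> {ae P, forall w, a <= X w <= b}.
Proof.
move=> [ab Xab Xa]; exists (X @^-1` (~` `[a, b]%classic)); split.
- by rewrite -[X in measurable X]setTI; apply: measurable_funP => //; exact: measurableC.
- have mI : measurable (~` `[a, b]%classic : set R) by exact: measurableC.
  move: ab; rewrite le_eqVlt => /predU1P[ab|ab].
    have := Xa ab _ mI; rewrite /distribution /pushforward => ->.
    by rewrite diracE memNset// => h; apply: h; rewrite /= in_itv/= ab lexx.
  have := Xab ab _ mI; rewrite /distribution /pushforward => ->.
  by rewrite /uniform_prob integral_uniform_pdf setICl integral_set0.
- by move=> w /= h; rewrite in_itv/=.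
Qed.

(** Clamping each variable to its interval changes it on a null set only, and supplies the pointwise
    bounds that the moment inequalities require. *)
Lemma uniform_seq_bounded (R : realType) (d : measure_display)
    (T : measurableType d) (P : probability T R) (a b : nat -> R)
    (X : nat -> {RV P >-> R}) :
  mutually_independent X -> (forall k, uniform_on (a k) (b k) (X k)) ->
  exists Y : nat -> {RV P >-> R},
    [/\ mutually_independent Y, forall k, uniform_on (a k) (b k) (Y k),
        {ae P, forall w k, X k w = Y k w} & forall k w, a k <= Y k w <= b k].
Proof.
move=> iX uX.
have ab k : a k <= b k by case: (uX k).
pose g k x : R := Num.max (a k) (Num.min (b k) x).
have mg k : measurable_fun setT (g k).
  by apply: measurable_maxr => //; exact: measurable_minr.
have mY k : measurable_fun setT (fun w => g k (X k w)) by exact: measurableT_comp.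
pose Y k : {RV P >-> R} := mfun_Sub (mem_set (mY k)).
have YE k w : Y k w = g k (X k w) by [].
have XY k : {ae P, forall w, X k w = Y k w}.
  apply: filterS (uniform_on_ae (uX k)) => w /andP[h1 h2].
  by rewrite YE /g (min_idPr h2) (max_idPr h1).
clearbody Y.
exists Y; split.
- exact: mutually_independent_comp mg YE iX.
- move=> k; have [_ h1 h2] := uX k.
  have E A : measurable A -> distribution P (Y k) A = distribution P (X k) A.
    by move=> mA; apply/esym; exact: (@ae_eq_law _ _ _ P (X k) (Y k) A).
  split => // [ab' A mA|ab' A mA]; rewrite E//; [exact: h1|exact: h2].
- exact: ae_foralln.
- by move=> k w; rewrite YE /g le_max lexx/= ge_max ab ge_min lexx.
Qed.

Lemma uniform_sum_bounded (R : realType) (d : measure_display)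
    (T : measurableType d) (P : probability T R) (a b : nat -> R)
    (S : {RV P >-> R}) :
  is_uniform_sum a b S -> exists X : nat -> {RV P >-> R},
    [/\ mutually_independent X, forall k, uniform_on (a k) (b k) (X k),
        {ae P, forall w, (fun n => \sum_(0 <= k < n) X k w) @ \oo --> S w} &
        forall k w, a k <= X k w <= b k].
Proof.
move=> [X [iX uX cX]]; have [Y [iY uY XY Yab]] := uniform_seq_bounded iX uX.
exists Y; split => //; apply: filterS2 cX XY => w cw h.
by under eq_fun do under eq_bigr do rewrite -h.
Qed.

(** The integrand is taken nonnegative; this is why the mean is computed from a truncation of x - a,
    and the cosine transform from 1 + cos. *)
Lemma Rintegral_uniform_FTC (R : realType) (a b : R) (ab : a < b)
    (f F : R -> R) :
  continuous f -> (forall x, 0 <= f x) -> continuous F ->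
  (forall x, a < x < b -> is_derive x 1 F (f x)) ->
  \int[uniform_law ab]_x f x = (F b - F a) / (b - a).
Proof.
move=> cf f0 cF dF.
rewrite /Rintegral ge0_integral_uniform_law//; last first.
  by apply/measurable_EFinP; exact: continuous_measurable_fun.
rewrite (@continuous_FTC2 _ f F)//.
- by rewrite -EFinB -EFinM/= mulrC.
- exact: continuous_subspaceT.
- split.
  + by move=> x; rewrite in_itv/= => /dF h; exact: ex_derive.
  + by apply: cvg_at_right_filter; exact: cF.
  + by apply: cvg_at_left_filter; exact: cF.
- by move=> x; rewrite in_itv/= => /dF h; rewrite derive1E derive_val.
Qed.

Lemma uniform_on_Rintegral (R : realType) (d : measure_display)
    (T : measurableType d) (P : probability T R) (a b : R) (ab : a < b)
    (X : {RV P >-> R}) (f : R -> R) :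
  uniform_on a b X -> bounded_mfun f ->
  \int[P]_w f (X w) = \int[uniform_law ab]_x f x.
Proof.
move=> [_ Xab _] bf; rewrite -Rintegral_distribution//; congr fine.
by apply: eq_measure_integral => A mA _; exact: Xab.
Qed.

Lemma uniform_on_diag (R : realType) (d : measure_display)
    (T : measurableType d) (P : probability T R) (a : R)
    (X : {RV P >-> R}) (f : R -> R) :
  uniform_on a a X -> bounded_mfun f -> \int[P]_w f (X w) = f a.
Proof.
move=> [_ _ Xa] bf; rewrite -Rintegral_distribution//.
have mf : measurable_fun setT (EFin \o f) by apply/measurable_EFinP; case: bf.
rewrite /Rintegral (eq_measure_integral (\d_a)); last by move=> A mA _; exact: Xa.
by rewrite integral_dirac// diracT mul1e.
Qed.

Lemma uniform_on_mean (R : realType) (d : measure_display)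
    (T : measurableType d) (P : probability T R) (a b : R)
    (X : {RV P >-> R}) :
  uniform_on a b X -> (forall w, a <= X w <= b) ->
  \int[P]_w X w = (a + b) / 2.
Proof.
move=> uX Xab; have [ab _ _] := uX.
move: ab; rewrite le_eqVlt => /predU1P[ab|ab].
  rewrite (@eq_Rintegral _ _ _ _ _ (fun=> a)) ?Rintegral_prob_cst.
    by rewrite -ab; field.
  by move=> w _; have := Xab w; rewrite -ab => h; apply/esym/eqP; rewrite eq_le.
pose f (x : R) := Num.min (b - a) (Num.max (x - a) 0).
have cf : continuous f.
  move=> x; apply: (@continuous_min R _ (cst (b - a)) (fun x => Num.max (x - a) 0)).
    exact: cvg_cst.
  apply: (@continuous_max R _ (fun x => x - a) (cst 0)); last exact: cvg_cst.
  by apply: cvgB; [exact: cvg_id|exact: cvg_cst].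
have f0 x : 0 <= f x by rewrite /f le_min subr_ge0 (ltW ab) le_max lexx orbT.
have bf : bounded_mfun f.
  split; first exact: continuous_measurable_fun.
  by exists (b - a) => x; rewrite ger0_norm// /f ge_min lexx.
have fE x : a <= x <= b -> f x = x - a.
  by move=> /andP[ax xb]; rewrite /f (max_idPl _) ?subr_ge0// (min_idPr _)// lerD2r.
pose F (x : R) := 2^-1 * ((x - a) * (x - a)).
have cF : continuous F.
  by move=> x; apply: cvgM; [exact: cvg_cst|apply: cvgM; apply: cvgB; [exact: cvg_id|exact: cvg_cst|exact: cvg_id|exact: cvg_cst]].
have dF x : a < x < b -> is_derive x 1 F (f x).
  move=> /andP[ax xb]; rewrite fE ?(ltW ax) ?(ltW xb)//.
  have -> : F = 2^-1 *: ((id - cst a : R -> R) * (id - cst a)) by [].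
  by apply: is_derive_eq; rewrite /GRing.scale/= subr0 mulr1 !fctE; field.
have := @uniform_on_Rintegral _ _ _ P a b ab X f uX bf.
rewrite (Rintegral_uniform_FTC ab cf f0 cF dF).
have -> : \int[P]_w f (X w) = \int[P]_w X w - a.
  rewrite (@eq_Rintegral _ _ _ _ _ (fun w => X w - a)).
    rewrite RintegralB ?Rintegral_prob_cst//; apply: bounded_mfun_integrable.
      split => //; exists (`|a| + `|b|) => w; have /andP[h1 h2] := Xab w.
      rewrite ler_norml; apply/andP; split.
        rewrite opprD (le_trans _ h1)// lerBlDr (le_trans _ (_ : a <= _))//.
          by rewrite lerNl -normrN ler_norm.
        by rewrite lerDl.
      by rewrite (le_trans h2)// (le_trans (ler_norm b))// lerDr.
    exact: bounded_mfun_cst.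
  by move=> w _; rewrite fE.
move=> /(congr1 (+%R^~ a)); rewrite subrK => ->; rewrite /F subrr.
by field; rewrite subr_eq0 gt_eqF.
Qed.

Definition sinc (R : realType) (x : R) : R := if x == 0 then 1 else sin x / x.

Lemma sincE (R : realType) (x : R) : sin x = x * sinc x.
Proof.
by rewrite /sinc; case: eqP => [->|/eqP x0]; [rewrite sin0 mul0r|field].
Qed.

Lemma bounded_mfun_cos (R : realType) (s z : R) :
  bounded_mfun (fun x => cos (s * x + z)).
Proof.
split; last by exists 1 => x; exact: cos_max.
apply: (measurableT_comp (continuous_measurable_fun (@continuous_cos R))).
by apply: measurable_funD => //; exact: measurable_funM.
Qed.

(** [sm] and [cm] stand for sine and cosine at the midpoint phase, [ce] and [sc] for cosine and sinc
    at s (b - a) / 2. The bare a and b, and the final -1, come from the constant 1 added to the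
    cosine. *)
Lemma mean_cos_algebra (F : fieldType) (a b s sm ce cm sc : F) :
  s != 0 -> b != a -> 2 != 0 :> F ->
  (b + s^-1 * (sm * ce + cm * (s * (b - a) / 2 * sc)) -
   (a + s^-1 * (sm * ce - cm * (s * (b - a) / 2 * sc)))) / (b - a) - 1 = cm * sc.
Proof.
by move=> s0; rewrite -subr_eq0 => ba two0; field; apply/and3P; split.
Qed.

Lemma uniform_on_cos (R : realType) (d : measure_display)
    (T : measurableType d) (P : probability T R) (a b s z : R)
    (X : {RV P >-> R}) :
  uniform_on a b X -> s != 0 ->
  \int[P]_w cos (s * X w + z) =
  cos (s * ((a + b) / 2) + z) * sinc (s * (b - a) / 2).
Proof.
move=> uX s0; have [ab _ _] := uX; have bc := bounded_mfun_cos s z.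
move: ab; rewrite le_eqVlt => /predU1P[ab|ab].
  move: uX; rewrite -ab => uX; rewrite (uniform_on_diag uX bc).
  rewrite subrr mulr0 mul0r /sinc eqxx mulr1.
  by congr (cos (s * _ + _)); field.
pose f (x : R) := 1 + cos (s * x + z).
pose F (x : R) := x + s^-1 * sin (s * x + z).
have ca : continuous (fun x : R => s * x + z).
  move=> x; apply: cvgD; last exact: cvg_cst.
  by apply: cvgM; [exact: cvg_cst|exact: cvg_id].
have cf : continuous f.
  move=> x; apply: cvgD; first exact: cvg_cst.
  by apply: continuous_comp; [exact: ca|exact: continuous_cos].
have f0 x : 0 <= f x.
  by have := cos_max (s * x + z); rewrite ler_norml /f => /andP[h _]; rewrite -lerBlDl sub0r.
have cF : continuous F.
  move=> x; apply: cvgD; first exact: cvg_id.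
  apply: cvgM; first exact: cvg_cst.
  by apply: continuous_comp; [exact: ca|exact: continuous_sin].
have dF x : a < x < b -> is_derive x 1 F (f x).
  move=> _.
  have d1 : is_derive x 1 (fun x : R => s * x + z) s.
    have -> : (fun x => s * x + z) = s *: (id : R -> R) + cst z by [].
    by apply: is_derive_eq; rewrite addr0 /GRing.scale/= mulr1.
  have d2 : is_derive x 1 (fun x : R => sin (s * x + z)) (s * cos (s * x + z)).
    have := @is_derive1_comp R (@sin R) (fun x => s * x + z) x _ _ (is_derive_sin _) d1.
    by rewrite mulrC.
  have -> : F = (id : R -> R) + s^-1 *: (fun x : R => sin (s * x + z)) by [].
  apply: (is_derive_eq (is_deriveD (is_derive_id x 1) (is_deriveZ s^-1 d2))).
  by rewrite /GRing.scale/= mulrA mulVf// mul1r.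
have bf : bounded_mfun f by apply: bounded_mfunD => //; exact: bounded_mfun_cst.
have := @uniform_on_Rintegral _ _ _ P a b ab X f uX bf.
rewrite (Rintegral_uniform_FTC ab cf f0 cF dF).
rewrite RintegralD ?Rintegral_prob_cst//; last 2 first.
- by apply: bounded_mfun_integrable; exact: bounded_mfun_cst.
- by apply: bounded_mfun_integrable; exact: bounded_mfun_comp bc _.
move=> /(congr1 (fun x => x - 1)); rewrite addrC addKr => ->.
set m := s * _ + z; set e := s * _ / 2.
have sb : s * b + z = m + e by rewrite /m /e; field.
have sa : s * a + z = m - e by rewrite /m /e; field.
rewrite /F sb sa sinD sinB !(sincE e).
by apply: mean_cos_algebra; rewrite // gt_eqF.
Qed.

(** Integrating out the last variable yields its sinc and moves its midpoint into the phase, so the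
    induction needs every z. *)
Lemma cos_partial_sum (R : realType) (d : measure_display)
    (T : measurableType d) (P : probability T R) (a b : nat -> R) (s z : R)
    (X : nat -> {RV P >-> R}) n :
  mutually_independent X -> (forall k, uniform_on (a k) (b k) (X k)) -> s != 0 ->
  \int[P]_w cos (s * (\sum_(0 <= k < n) X k w) + z) =
  cos (s * (\sum_(0 <= k < n) (a k + b k) / 2) + z) *
  \prod_(0 <= k < n) sinc (s * (b k - a k) / 2).
Proof.
move=> iX uX s0; elim: n z => [|n IH] z.
  under eq_Rintegral do rewrite big_geq// mulr0.
  by rewrite Rintegral_prob_cst !big_geq// mulr0 mulr1.
have aS := @adapted_sum _ _ _ _ X n n (leqnn n).
pose S : {RV P >-> R} := mfun_Sub (mem_set (adapted_measurable aS)).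
have bh : bounded_mfun (fun u : R * R => cos (s * (u.1 + u.2) + z)).
  by apply: (bounded_mfun_comp (bounded_mfun_cos s z)); exact: measurable_funD.
have := @fubini_pair R d T P S (X n) _ (fun A B mA mB => independent_of_past iX aS mA mB) bh.
rewrite /= => h.
transitivity (\int[P]_w cos (s * (\sum_(0 <= k < n) X k w + X n w) + z)).
  by apply: eq_Rintegral => w _; rewrite big_nat_recr.
rewrite h.
transitivity (\int[P]_w (cos (s * (\sum_(0 <= k < n) X k w) + (s * ((a n + b n) / 2) + z)) *
    sinc (s * (b n - a n) / 2))).
  apply: eq_Rintegral => w _.
  set u := \sum_(0 <= k < n) X k w.
  have -> : (fun x => cos (s * (u + x) + z)) = (fun x => cos (s * x + (s * u + z))).
    by apply/funext => x; congr cos; ring.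
  rewrite Rintegral_distribution; last exact: bounded_mfun_cos.
  rewrite (uniform_on_cos _ (uX n) s0); congr (cos _ * _); ring.
rewrite RintegralZr//; last first.
  apply: bounded_mfun_integrable; apply: (bounded_mfun_comp (bounded_mfun_cos s _)).
  exact: adapted_measurable aS.
rewrite IH (big_nat_recr n)//= (big_nat_recr n)//= [RHS]mulrA.
by congr (cos _ * _ * _); ring.
Qed.

Lemma cos_uniform_sum (R : realType) (d : measure_display)
    (T : measurableType d) (P : probability T R) (a b : nat -> R) (s z : R)
    (X : nat -> {RV P >-> R}) (S : {RV P >-> R}) :
  mutually_independent X -> (forall k, uniform_on (a k) (b k) (X k)) ->
  {ae P, forall w, (fun n => \sum_(0 <= k < n) X k w) @ \oo --> S w} -> s != 0 ->
  cos (s * (\sum_(0 <= k < n) (a k + b k) / 2) + z) *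
  \prod_(0 <= k < n) sinc (s * (b k - a k) / 2) @[n --> \oo] -->
  \int[P]_w cos (s * S w + z).
Proof.
move=> iX uX cX s0.
under eq_fun do rewrite -(cos_partial_sum z _ iX uX s0).
have bc := bounded_mfun_cos s z.
apply: (@bounded_convergence _ _ _ _ _ _ 1).
- move=> n; have [] // := bounded_mfun_comp bc (adapted_measurable (@adapted_sum _ _ _ _ X n n (leqnn n))).
- by have [] := bounded_mfun_comp bc (@measurable_funP _ _ _ _ _ S).
- by move=> n w; exact: cos_max.
- apply: filterS cX => w cw.
  apply: continuous_cvg; first exact: continuous_cos.
  apply: cvgD; last exact: cvg_cst.
  by apply: cvgM => //; exact: cvg_cst.
Qed.

(** * Products of sincs *)

Lemma sin_mean_value (R : realType) (x : R) : 0 <= x ->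
  exists2 c, 0 <= c <= x & sin x = cos c * x.
Proof.
move=> x0; have [] := @MVT_segment R (@sin R) (@cos R) 0 x x0.
- by apply: continuous_subspaceT; exact: continuous_sin.
- by move=> c; rewrite in_itv/= sin0 !subr0 => cx ->; exists c.
Qed.

Lemma norm_sin_le (R : realType) (x : R) : `|sin x| <= `|x|.
Proof.
wlog x0 : x / 0 <= x.
  move=> h; have [/h//|/ltW x0] := lerP 0 x.
  by have := h (- x); rewrite oppr_ge0 sinN !normrN => /(_ x0).
have [c _ ->] := sin_mean_value x0.
by rewrite normrM -[leRHS]mul1r ler_wpM2r// cos_max.
Qed.

Lemma cos_half (R : realType) (x : R) : cos x = 1 - 2 * sin (x / 2) ^+ 2.
Proof.
rewrite {1}(splitr x) cosD -!expr2.
by have := cos2Dsin2 (x / 2) => /(canRL (addrK _)) ->; ring.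
Qed.

Lemma cos_ge_quadratic (R : realType) (x : R) : 1 - x ^+ 2 / 2 <= cos x.
Proof.
rewrite cos_half lerD2l lerN2.
have h := norm_sin_le (x / 2).
have -> : x ^+ 2 / 2 = 2 * (x / 2) ^+ 2 by field.
rewrite ler_pM2l// -[leLHS]real_normK ?num_real// -[leRHS]real_normK ?num_real//.
by rewrite lerXn2r ?nnegrE.
Qed.

Lemma sinc_ge_quadratic (R : realType) (x : R) : 0 <= x ->
  1 - x ^+ 2 / 2 <= sinc x.
Proof.
move=> x0; rewrite /sinc; case: eqP => [->|/eqP nx]; first by rewrite expr0n/= mul0r subr0.
have [c /andP[c0 cx] ->] := sin_mean_value x0; rewrite mulfK//.
apply: le_trans (cos_ge_quadratic c); rewrite lerD2l lerN2 ler_pM2r ?invr_gt0//.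
by rewrite lerXn2r ?nnegrE.
Qed.

Lemma norm_sinc_le1 (R : realType) (x : R) : `|sinc x| <= 1.
Proof.
rewrite /sinc; case: eqP => [_|/eqP nx]; first by rewrite normr1.
by rewrite normrM normfV ler_pdivrMr ?normr_gt0// mul1r norm_sin_le.
Qed.

(** The double angle formula for sine. Through it the quadratic estimates, valid near 0, give an
    upper bound and reach arguments close to pi. *)
Lemma sinc_double (R : realType) (x : R) : sinc x = sinc (x / 2) * cos (x / 2).
Proof.
have [->|x0] := eqVneq x 0; first by rewrite mul0r /sinc eqxx cos0 mulr1.
apply: (mulfI x0); rewrite -sincE {1}(splitr x) sinD [sin (x / 2)]sincE; by field.
Qed.

(** sinc x is at most cos (x / 2), which equals 1 - 2 sin (x / 4)^2, and sin (x / 4) is at least x /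
    8; hence the 32. *)
Lemma sinc_le_quadratic (R : realType) (x : R) : 0 <= x <= 1 ->
  sinc x <= 1 - x ^+ 2 / 32.
Proof.
move=> /andP[x0 x1].
have c0 : 0 <= cos (x / 2).
  apply: le_trans (cos_ge_quadratic _).
  have -> : (x / 2) ^+ 2 / 2 = x ^+ 2 / 8 by field.
  have : x ^+ 2 <= 1 by rewrite expr_le1.
  lra.
have h1 : sinc x <= cos (x / 2).
  rewrite sinc_double -[leRHS]mul1r ler_wpM2r//.
  by rewrite (le_trans (ler_norm _))// norm_sinc_le1.
apply: (le_trans h1); rewrite cos_half lerD2l lerN2.
have -> : x / 2 / 2 = x / 4 by field.
have x4 : 0 <= x / 4 by rewrite divr_ge0.
have h2 : x / 8 <= sin (x / 4).
  rewrite sincE; apply: (@le_trans _ _ (x / 4 * 2^-1)); first by lra.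
  rewrite ler_wpM2l//; apply: le_trans (sinc_ge_quadratic x4).
  have -> : (x / 4) ^+ 2 / 2 = x ^+ 2 / 32 by field.
  have : x ^+ 2 <= 1 by rewrite expr_le1.
  lra.
have : (x / 8) ^+ 2 <= sin (x / 4) ^+ 2.
  by rewrite lerXn2r ?nnegrE ?divr_ge0// (le_trans _ h2)// divr_ge0.
have -> : (x / 8) ^+ 2 = x ^+ 2 / 64 by field.
lra.
Qed.

(** The quadratic bound is negative near pi, so the argument is halved twice. As x < 4, sinc (x / 4)
    and cos (x / 4) are at least 1/2, and the remaining factor cos (x / 2) is at least cos (th / 2),
    the only part that degenerates as th approaches pi. *)
Lemma sinc_lower_bound (R : realType) (th : R) : 0 <= th < pi ->
  exists2 k : R, 0 < k <= 1 & forall x, 0 <= x <= th -> k <= sinc x.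
Proof.
move=> /andP[th0 thpi].
have pi2 : 2 <= pi :> R := pi_ge2 R.
have pi4 : pi < 4 :> R by have := pihalf_lt2 R; rewrite ltr_pdivrMr// -natrM.
have cp y : 0 <= y < pi / 2 -> 0 < cos y.
  by move=> /andP[y0 y1]; apply: cos_gt0_pihalf; rewrite y1 andbT (lt_le_trans _ y0)// oppr_lt0 divr_gt0// pi_gt0.
have cm x : 0 <= x <= th -> cos (th / 2) <= cos (x / 2).
  move=> /andP[x0 xt]; move: xt; rewrite le_eqVlt => /predU1P[->//|xt].
  apply/ltW; rewrite ltr_cos ?in_itv/=; first by rewrite ltr_pM2r ?invr_gt0.
  - by rewrite divr_ge0//=; lra.
  - by rewrite divr_ge0//=; lra.
have hb x : 0 <= x <= th -> 2^-1 / 2 <= sinc (x / 2).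
  move=> /andP[x0 xt].
  rewrite sinc_double ler_pM ?invr_ge0//.
    apply: le_trans (sinc_ge_quadratic _); last by rewrite !divr_ge0.
    have -> : (x / 2 / 2) ^+ 2 / 2 = x ^+ 2 / 32 by field.
    have : x ^+ 2 <= 4 ^+ 2 by rewrite lerXn2r ?nnegrE//; lra.
    lra.
  apply: le_trans (cos_ge_quadratic _).
  have -> : (x / 2 / 2) ^+ 2 / 2 = x ^+ 2 / 32 by field.
  have : x ^+ 2 <= 4 ^+ 2 by rewrite lerXn2r ?nnegrE//; lra.
  lra.
exists (2^-1 / 2 * cos (th / 2)).
  have c0 : 0 < cos (th / 2) by apply: cp; rewrite divr_ge0//= ltr_pM2r ?invr_gt0.
  rewrite mulr_gt0// ?divr_gt0 ?invr_gt0//=.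
  by have := cos_le1 (th / 2); lra.
move=> x xt; rewrite sinc_double; apply: ler_pM => //.
- by apply/ltW/cp; rewrite divr_ge0//= ltr_pM2r ?invr_gt0.
- exact: hb.
- exact: cm.
Qed.

Lemma prod_one_minus_ge (R : realType) (a : nat -> R) m n :
  (forall k, 0 <= a k) -> (forall k, (m <= k)%N -> a k <= 1) ->
  1 - \sum_(m <= k < n) a k <= \prod_(m <= k < n) (1 - a k).
Proof.
move=> a0 a1; have [nm|/ltnW mn] := leqP n m.
  by rewrite !big_geq// subr0.
rewrite -(subnKC mn); elim: (n - m)%N => [|j IH].
  by rewrite addn0 !big_geq// subr0.
have mj : (m <= m + j)%N by exact: leq_addr.
rewrite addnS !big_nat_recr//=.
have h1 := a0 (m + j)%N; have h2 := a1 _ mj.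
have s0 : 0 <= \sum_(m <= k < m + j) a k by apply: sumr_ge0.
apply: (@le_trans _ _ ((1 - \sum_(m <= k < m + j) a k) * (1 - a (m + j)%N))).
  by rewrite mulrBl mul1r mulrBr mulr1 opprB; have := mulr_ge0 s0 h1; lra.
by rewrite ler_wpM2r// subr_ge0.
Qed.

(** Rests on (1 - a) (1 + a) <= 1. It is used backwards: a lower bound on the product bounds the
    sum. *)
Lemma prod_one_minus_le (R : realType) (a : nat -> R) n :
  (forall k, (k < n)%N -> 0 <= a k <= 1) ->
  (\prod_(0 <= k < n) (1 - a k)) * (1 + \sum_(0 <= k < n) a k) <= 1.
Proof.
elim: n => [|n IH] a01; first by rewrite !big_geq// addr0 mulr1.
rewrite !big_nat_recr//=; have /andP[h1 h2] := a01 n (ltnSn n).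
set p := \prod_(_ <= _ < _) _; set s := \sum_(_ <= _ < _) _.
have p0 : 0 <= p.
  rewrite /p big_nat; apply: prodr_ge0 => k /andP[_ kn].
  by rewrite subr_ge0; case/andP: (a01 k (ltnW kn)).
have s0 : 0 <= s.
  rewrite /s big_nat; apply: sumr_ge0 => k /andP[_ kn].
  by case/andP: (a01 k (ltnW kn)).
apply: le_trans (IH _); last by move=> k kn; apply: a01; exact: ltnW.
rewrite -/p -/s -mulrA ler_wpM2l//.
have := mulr_ge0 s0 h1; have := mulr_ge0 h1 h1; lra.
Qed.

(** Zeros of sine are isolated: starting at a zero the next one is pi away, and starting elsewhere
    the 1-Lipschitz bound keeps the value nonzero for a while. *)
Lemma sin_avoid (R : realType) (x t : R) : 0 < t ->
  exists2 e : R, 0 < e & forall h, 0 < h < e -> sin (x + h * t) != 0.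
Proof.
move=> t0; have [sx|sx] := eqVneq (sin x) 0.
  exists (pi / t); first by rewrite divr_gt0// pi_gt0.
  move=> h /andP[h0 hp]; rewrite sinD sx mul0r add0r mulf_neq0//.
    by rewrite -normr_gt0 sin0cos1.
  by rewrite gt_eqF// sin_gt0_pi// mulr_gt0//= -ltr_pdivlMr.
exists (`|sin x| / t); first by rewrite divr_gt0// normr_gt0.
move=> h /andP[h0 hs]; apply/eqP => s0.
have : `|sin x| <= h * t.
  have [||c _] := @MVT_segment R (@sin R) (@cos R) x (x + h * t).
  - by rewrite lerDl mulr_ge0// ltW.
  - by apply: continuous_subspaceT; exact: continuous_sin.
  rewrite s0 sub0r addrC addKr => hc.
  rewrite -normrN hc normrM (ger0_norm (_ : 0 <= h * t)) ?mulr_ge0 ?(ltW t0) ?(ltW h0)//.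
  by rewrite -[leRHS]mul1r ler_wpM2r ?cos_max// mulr_ge0 ?(ltW t0) ?(ltW h0).
by rewrite leNgt -ltr_pdivlMr// hs.
Qed.

Lemma sin_avoid_finite (R : realType) (x : R) (t : nat -> R) n :
  (forall k, (k < n)%N -> 0 < t k) ->
  exists2 e : R, 0 < e &
    forall h, 0 < h < e -> forall k, (k < n)%N -> sin ((x + h) * t k / 2) != 0.
Proof.
elim: n => [|n IH] tp; first by exists 1.
have [k kn|e e0 He] := IH; first by apply: tp; exact: ltnW.
have t2 : 0 < t n / 2 by rewrite divr_gt0// tp.
have [e' e'0 He'] := sin_avoid (x * t n / 2) t2.
exists (Num.min e e'); first by rewrite lt_min e0.
move=> h; rewrite lt_min => /and3P[h0 he he'] k; rewrite ltnS leq_eqVlt => /predU1P[->|kn].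
  have -> : (x + h) * t n / 2 = x * t n / 2 + h * (t n / 2) by ring.
  by apply: He'; rewrite h0.
by apply: He => //; rewrite h0.
Qed.

Lemma l2_tilde_nonincreasing (R : realType) (t : nat -> R) m n :
  l2_tilde t -> (m <= n)%N -> t n <= t m.
Proof.
move=> [ti _ _] /subnKC <-; elim: (n - m)%N => [|k IH]; first by rewrite addn0.
by rewrite addnS (le_trans (ti _)).
Qed.

Lemma cvg_series_tail (R : realType) (a : nat -> R) (e : R) :
  (forall k, 0 <= a k) -> cvgn (series a) -> 0 < e ->
  exists N, forall n, \sum_(N <= k < n) a k <= e.
Proof.
move=> a0 ca e0; pose l := limn (series a).
have sl n : series a n <= l.
  by apply: nondecreasing_cvgn_le => //; apply: nondecreasing_series.
have [N _ HN] : \forall n \near \oo, `|l - series a n| < e.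
  exact: (@cvgr_dist_lt _ _ _ _ _ _ _ ca).
exists N => n; have [nN|/ltnW Nn] := leqP n N; first by rewrite big_geq// ltW.
have := HN N (leqnn N); rewrite ger0_norm ?subr_ge0// => /ltW h.
apply: le_trans h; rewrite lerBrDr addrC.
apply: le_trans (sl n); rewrite /series/= (big_cat_nat (leq0n N) Nn)/=.
exact: lexx.
Qed.

(** Monotonicity of u keeps all arguments below s1 u_n / 2 < pi, so finitely many factors are at
    least a common k <= 1. The others are compared with 1 - a_j, whose product is at least 1/2 once
    the tail of the sum of the a_j is. The bound is uniform in s and m, as needed both for all small
    s and to the right of a zero. *)
Lemma sinc_product_lower_bound (R : realType) (u : nat -> R) (s1 : R) n :
  l2_tilde u -> 0 < s1 -> s1 * u n / 2 < pi ->
  exists2 c : R, 0 < c & forall s m, 0 < s <= s1 ->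
    c <= \prod_(n <= k < m) sinc (s * u k / 2).
Proof.
move=> lu s10 spi; have [_ u0 cu] := lu.
have su0 k : 0 <= s1 * u k / 2 by rewrite divr_ge0// mulr_ge0// ltW.
have [|k /andP[k0 k1] Hk] := @sinc_lower_bound R (s1 * u n / 2); first by rewrite su0.
pose a j := (s1 * u j / 2) ^+ 2 / 2.
have a0 j : 0 <= a j by rewrite divr_ge0// sqr_ge0.
have ca : cvgn (series a).
  have -> : a = (s1 ^+ 2 / 8) *: (fun j => u j ^+ 2).
    by apply/funext => j; rewrite /a fctE /GRing.scale/=; field.
  by apply: is_cvg_seriesZ.
have h2 : 0 < 2^-1 :> R by rewrite invr_gt0.
have [N HN] := cvg_series_tail a0 ca h2.
have scale s j : 0 < s <= s1 -> 0 <= s * u j / 2 <= s1 * u j / 2.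
  move=> /andP[s0 ss]; rewrite divr_ge0 ?mulr_ge0 ?(ltW s0)//=.
  by rewrite ler_pM2r ?invr_gt0// ler_wpM2r.
have small j : (N <= j)%N -> a j <= 1.
  move=> Nj; have := HN j.+1; rewrite big_nat_recr//= => h.
  have : a j <= 2^-1 by apply: le_trans h; rewrite lerDr sumr_ge0.
  by move=> /le_trans; apply; rewrite invf_le1// ler1n.
have pos s j : 0 < s <= s1 -> (n <= j)%N -> k <= sinc (s * u j / 2).
  move=> ss nj; apply: Hk; have /andP[h1 h3] := scale s j ss; rewrite h1/=.
  apply: (le_trans h3); rewrite ler_pM2r ?invr_gt0// ler_pM2l//.
  exact: l2_tilde_nonincreasing.
pose M := maxn n N.
have tail s m : 0 < s <= s1 -> 2^-1 <= \prod_(M <= j < m) sinc (s * u j / 2).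
  move=> ss; apply: (@le_trans _ _ (\prod_(M <= j < m) (1 - a j))).
    apply: le_trans (prod_one_minus_ge _ a0 _); last first.
      by move=> j Mj; apply: small; rewrite (leq_trans _ Mj)// leq_maxr.
    have : \sum_(M <= j < m) a j <= 2^-1.
      apply: le_trans (HN m).
      have [mM|/ltnW Mm] := leqP m M; first by rewrite big_geq// sumr_ge0.
      by rewrite (big_cat_nat (leq_maxr n N) Mm)/= lerDr sumr_ge0.
    lra.
  rewrite !big_nat; apply: ler_prod => j /andP[Mj _].
  have Nj : (N <= j)%N by rewrite (leq_trans _ Mj)// leq_maxr.
  rewrite subr_ge0 small//=; have /andP[h1 h3] := scale s j ss.
  apply: le_trans (sinc_ge_quadratic h1).
  by rewrite lerD2l lerN2 ler_pM2r ?invr_gt0// lerXn2r ?nnegrE.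
have head s m m' : 0 < s <= s1 -> (n <= m)%N -> k ^+ (m' - m) <= \prod_(m <= j < m') sinc (s * u j / 2).
  move=> ss nm; rewrite -prodr_const_nat !big_nat; apply: ler_prod => j /andP[mj _].
  by rewrite (ltW k0)/= pos// (leq_trans nm).
exists (k ^+ (M - n) * 2^-1); first by rewrite mulr_gt0// exprn_gt0.
move=> s m ss; have [mM|/ltnW Mm] := leqP m M.
  apply: (@le_trans _ _ (k ^+ (m - n))); last exact: head.
  have h : k ^+ (M - n) <= k ^+ (m - n).
    by rewrite ler_wiXn2l ?(ltW k0)// leq_sub2r.
  apply: le_trans h; rewrite -[leRHS]mulr1 ler_wpM2l ?exprn_ge0 ?(ltW k0)//.
  by rewrite invf_le1// ler1n.
rewrite (big_cat_nat (leq_maxl n N) Mm)/=; apply: ler_pM.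
- by rewrite exprn_ge0// ltW.
- by rewrite invr_ge0.
- exact: head.
- exact: tail.
Qed.

Lemma cvg_norm_le (R : realType) (v : nat -> R) (l b : R) N :
  v @ \oo --> l -> (forall n, (N <= n)%N -> `|v n| <= b) -> `|l| <= b.
Proof.
move=> vl vb; have cn : `|v n| @[n --> \oo] --> `|l| by exact: cvg_norm.
rewrite -(cvg_lim _ cn)//; apply: limr_le; first by apply/cvg_ex; eexists; exact: cn.
by exists N.
Qed.

Lemma cvg_norm_ge (R : realType) (v : nat -> R) (l b : R) N :
  v @ \oo --> l -> (forall n, (N <= n)%N -> b <= `|v n|) -> b <= `|l|.
Proof.
move=> vl vb; have cn : `|v n| @[n --> \oo] --> `|l| by exact: cvg_norm.
rewrite -(cvg_lim _ cn)//; apply: limr_ge; first by apply/cvg_ex; eexists; exact: cn.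
by exists N.
Qed.

(* Evaluated just to the right of s0 = 2 pi / t_n, where the sinc of index n is
   almost 0, and where the shared factors are invertible. *)
Lemma sinc_products_le (R : realType) (t u : nat -> R) (phi : R -> R) n :
  l2_tilde t -> l2_tilde u -> (forall k, (k < n)%N -> t k = u k) ->
  (forall s, 0 < s -> \prod_(0 <= k < m) sinc (s * t k / 2) @[m --> \oo] --> phi s) ->
  (forall s, 0 < s -> \prod_(0 <= k < m) sinc (s * u k / 2) @[m --> \oo] --> phi s) ->
  t n <= u n.
Proof.
move=> lt lu tu ct cu; rewrite leNgt; apply/negP => untn.
have [_ u0 _] := lu; have [_ t0 _] := lt.
have tn0 : 0 < t n by exact: le_lt_trans untn.
have pi0 : 0 < pi :> R := pi_gt0 R.
pose s0 := 2 * pi / t n.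
have s00 : 0 < s0 by rewrite /s0 divr_gt0// mulr_gt0.
(* Chosen so that s1 u_n < s0 t_n = 2 pi: the product of u from index n on is then bounded below up
   to s1. *)
pose e1 := s0 * (t n - u n) / (2 * t n).
have d0 : 0 < t n - u n by rewrite subr_gt0.
have e10 : 0 < e1 by rewrite /e1 divr_gt0// mulr_gt0.
pose s1 := s0 + e1.
have s10 : 0 < s1 by rewrite addr_gt0.
have s1pi : s1 * u n / 2 < pi.
  have -> : pi = s0 * t n / 2 by rewrite /s0; field; rewrite gt_eqF.
  rewrite ltr_pM2r ?invr_gt0//.
  have -> : s1 = s0 * (1 + (t n - u n) / (2 * t n)) by rewrite /s1 /e1; field; rewrite gt_eqF.
  rewrite -mulrA ltr_pM2l//.
  have -> : (1 + (t n - u n) / (2 * t n)) * u n = t n - (t n - u n) * (2 * t n - u n) / (2 * t n).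
    by field; rewrite gt_eqF.
  rewrite gtrBl divr_gt0//; apply: mulr_gt0 => //; lra.
have [c c0 Hc] := sinc_product_lower_bound lu s10 s1pi.
have tk0 k : (k < n)%N -> 0 < t k.
  by move=> kn; apply: (lt_le_trans tn0); apply: l2_tilde_nonincreasing => //; exact: ltnW.
have [e2 e20 He2] := sin_avoid_finite s0 tk0.
(* Below e1 the lower bound for u holds, below e2 the shared factors are nonzero, and below 2 c /
   t_n the sinc of index n at y + pi, with y = h t_n / 2 < c, is smaller than c. The final halving
   makes these inequalities strict. *)
pose h : R := Num.min (Num.min e1 e2) (2 * c / t n) / 2.
have h0 : 0 < h by rewrite divr_gt0// !lt_min e10 e20 divr_gt0// mulr_gt0.
have hlt : h < Num.min (Num.min e1 e2) (2 * c / t n).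
  by rewrite /h ltr_pdivrMr// ltr_pMr ?ltr1n// !lt_min e10 e20 divr_gt0// mulr_gt0.
move: hlt; rewrite !lt_min => /andP[/andP[he1 he2] hc].
have A0 : \prod_(0 <= k < n) sinc ((s0 + h) * t k / 2) != 0.
  rewrite big_nat prodf_seq_neq0; apply/allP => k _; apply/implyP => /andP[_ kn].
  have := He2 h; rewrite h0 he2 => /(_ isT k kn).
  by apply: contra => /eqP sk; rewrite sincE sk mulr0.
have s0h : 0 < s0 + h by rewrite addr_gt0.
set A := \prod_(0 <= k < n) _ in A0.
have split v m : (n <= m)%N -> (forall k, (k < n)%N -> t k = v k) ->
   \prod_(0 <= k < m) sinc ((s0 + h) * v k / 2) =
   A * \prod_(n <= k < m) sinc ((s0 + h) * v k / 2).
  move=> nm tv; rewrite (big_cat_nat (leq0n n) nm)/=; congr (_ * _).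
  by apply: eq_big_nat => k /andP[_ kn]; rewrite tv.
(* For t, the factors after n are bounded by 1; for u, all factors from n on are bounded below by c.
   Cancelling the common A leaves c against a single sinc. *)
have up : `|phi (s0 + h)| <= `|A| * `|sinc ((s0 + h) * t n / 2)|.
  apply: (cvg_norm_le (ct _ s0h) (N := n.+1)) => m nm; rewrite (split t m (ltnW nm))// normrM ler_wpM2l//.
  rewrite big_ltn// normrM -[leRHS]mulr1 ler_wpM2l// normr_prod.
  by apply: prodr_ile1 => k _; rewrite normr_ge0 norm_sinc_le1.
have lo : `|A| * c <= `|phi (s0 + h)|.
  apply: (cvg_norm_ge (cu _ s0h) (N := n)) => m nm; rewrite (split u m nm)// normrM ler_wpM2l//.
  apply: le_trans (ler_norm _); apply: Hc.
  by rewrite s0h /s1 lerD2l ltW.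
have := le_trans lo up; rewrite ler_pM2l ?normr_gt0// leNgt => /negP; apply.
have -> : (s0 + h) * t n / 2 = h * t n / 2 + pi by rewrite /s0; field; rewrite gt_eqF.
set y : R := h * t n / 2.
have y0 : 0 < y by rewrite /y divr_gt0// mulr_gt0.
have yc : y < c by rewrite /y ltr_pdivrMr// -ltr_pdivlMr// [c * 2]mulrC.
have ypi : 0 < y + pi by rewrite addr_gt0.
have -> : sinc (y + pi) = - sin y / (y + pi) by rewrite /sinc (gt_eqF ypi) sinDpi.
rewrite normrM normrN normfV (gtr0_norm ypi) ltr_pdivrMr//.
apply: (le_lt_trans (norm_sin_le y)); rewrite (gtr0_norm y0).
apply: (lt_le_trans yc); rewrite -[leLHS]mulr1 ler_pM2l//.
by have := pi_ge2 R; lra.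
Qed.

Lemma sinc_products_inj (R : realType) (t u : nat -> R) (phi : R -> R) :
  l2_tilde t -> l2_tilde u ->
  (forall s, 0 < s -> \prod_(0 <= k < m) sinc (s * t k / 2) @[m --> \oo] --> phi s) ->
  (forall s, 0 < s -> \prod_(0 <= k < m) sinc (s * u k / 2) @[m --> \oo] --> phi s) ->
  t = u.
Proof.
move=> lt lu ct cu; apply/funext => n.
elim/ltn_ind: n => n IH; apply/eqP; rewrite eq_le.
by rewrite (sinc_products_le lt lu IH ct cu) (sinc_products_le lu lt _ cu ct)// => k /IH.
Qed.

(** * Uniqueness and injectivity of the law *)

Lemma law_eq_measure (R : realType) (d : measure_display)
    (T : measurableType d) (P : probability T R) (X : T -> R)
    (d' : measure_display) (T' : measurableType d') (Q : probability T' R)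
    (Y : T' -> R) :
  law P X = law Q Y <->
  (forall A, measurable A -> P (X @^-1` A) = Q (Y @^-1` A)).
Proof.
split=> [h A mA|h]; first by have := congr1 (fun f => f (exist _ A mA)) h.
by apply/funext => -[A mA]; rewrite /law/=; exact: h.
Qed.

Lemma law_eq_integral (R : realType) (d : measure_display)
    (T : measurableType d) (P : probability T R) (X : T -> R)
    (d' : measure_display) (T' : measurableType d') (Q : probability T' R)
    (Y : T' -> R) (f : R -> \bar R) :
  measurable_fun setT X -> measurable_fun setT Y -> law P X = law Q Y ->
  measurable_fun setT f ->
  (\int[P]_w f (X w) = \int[Q]_w f (Y w))%E.
Proof.
move=> mX mY /law_eq_measure XY mf.
have key (g : R -> \bar R) : measurable_fun setT g -> (forall x, 0 <= g x)%E ->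
    (\int[P]_w g (X w) = \int[Q]_w g (Y w))%E.
  move=> mg g0.
  pose X' : {RV P >-> R} := mfun_Sub (mem_set mX).
  pose Y' : {RV Q >-> R} := mfun_Sub (mem_set mY).
  have := @ge0_integral_distribution _ _ _ _ _ P X' g mg g0.
  have := @ge0_integral_distribution _ _ _ _ _ Q Y' g mg g0.
  rewrite /= => <- <-; apply: eq_measure_integral => A mA _; exact: XY.
have pE (d1 : measure_display) (T1 : measurableType d1) (P1 : probability T1 R) (Z : T1 -> R) :
    (\int[P1]_w f (Z w) = \int[P1]_w (f^\+ (Z w)) - \int[P1]_w (f^\- (Z w)))%E.
  have -> : (fun w => f (Z w)) = f \o Z by [].
  by rewrite integralE funepos_comp funeneg_comp.
by rewrite !pE !key//; [exact: measurable_funeneg|exact: measurable_funepos].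
Qed.

Lemma law_comp (R : realType) (d : measure_display)
    (T : measurableType d) (P : probability T R) (X : T -> R)
    (d' : measure_display) (T' : measurableType d') (Q : probability T' R)
    (Y : T' -> R) (g : R -> R) :
  measurable_fun setT g -> law P X = law Q Y ->
  law P (fun w => g (X w)) = law Q (fun w => g (Y w)).
Proof.
move=> mg /law_eq_measure XY; apply/law_eq_measure => A mA.
have := XY (g @^-1` A); apply.
by rewrite -[X in measurable X]setTI; exact: mg.
Qed.

(** Partial sums have equal laws, and bounded convergence carries the means of Lipschitz functions
    over to the limits. *)
Lemma uniform_sum_law_unique (R : realType) (d : measure_display)
    (T : measurableType d) (P : probability T R) (S : {RV P >-> R})
    (d' : measure_display) (T' : measurableType d') (Q : probability T' R)
    (S' : {RV Q >-> R}) (a b : nat -> R) :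
  is_uniform_sum a b S -> is_uniform_sum a b S' -> law P S = law Q S'.
Proof.
move=> [X [iX uX cX]] [Y [iY uY cY]]; apply/law_eq_measure => A mA.
apply: (@measure_unique_lipschitz R (distribution P S) (distribution Q S')) => //.
  by rewrite (le_lt_trans (probability_le1 _ _))// ltry.
move=> L f Lf; have bf := unit_lipschitz_bounded_mfun Lf.
have cf := unit_lipschitz_continuous Lf.
have f0 x : 0 <= f x by case: Lf => _ /(_ x)/andP[].
have f1 x : `|f x| <= 1 by case: Lf => _ /(_ x)/andP[? ?] _; rewrite ger0_norm.
rewrite -!Rintegral_EFin//; congr EFin; rewrite !Rintegral_distribution//.
have lim (d1 : measure_display) (T1 : measurableType d1) (P1 : probability T1 R)
    (Z : nat -> {RV P1 >-> R}) (U : {RV P1 >-> R}) :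
    {ae P1, forall w, (fun n => \sum_(0 <= k < n) Z k w) @ \oo --> U w} ->
    \int[P1]_w f (\sum_(0 <= k < n) Z k w) @[n --> \oo] --> \int[P1]_w f (U w).
  move=> cZ; apply: (@bounded_convergence _ _ _ _ _ _ 1) => //.
  - move=> n; have aS := @adapted_sum _ _ _ _ Z n n (leqnn n).
    by have [] := bounded_mfun_comp bf (adapted_measurable aS).
  - by have [] := bounded_mfun_comp bf (@measurable_funP _ _ _ _ _ U).
  - by apply: filterS cZ => w cw; apply: continuous_cvg => //; exact: cf.
apply: cvg_unique (lim _ _ _ _ _ cY) => //.
apply: cvg_trans (lim _ _ _ _ _ cX); apply: near_eq_cvg; apply: nearW => n.
congr fine.
apply: (@partial_sum_same_law R _ _ P X _ _ Q Y n (EFin \o f)) => //.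
- by move=> k; exact: uniform_on_same_law (uX k) (uY k).
- by apply/measurable_EFinP; case: bf.
Qed.

(** A shift by e may be distributed over the summands as any series with sum e: the zero series for
    pure scaling, or c followed by zeros for a translation. *)
Lemma uniform_sum_affine (R : realType) (d : measure_display)
    (T : measurableType d) (P : probability T R) (a b m : nat -> R) (c e : R)
    (S S' : {RV P >-> R}) :
  0 <= c -> series m @ \oo --> e -> (forall w, S' w = c * S w + e) ->
  is_uniform_sum a b S ->
  is_uniform_sum (fun k => c * a k + m k) (fun k => c * b k + m k) S'.
Proof.
move=> c0 me SS' [X [iX uX cX]].
pose g k (x : R) := c * x + m k.
have mg k : measurable_fun setT (g k).
  by apply: measurable_funD => //; exact: measurable_funM.
pose Y k : {RV P >-> R} := mfun_Sub (mem_set (measurableT_comp (mg k) (@measurable_funP _ _ _ _ _ (X k)))).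
have YE k w : Y k w = g k (X k w) by [].
clearbody Y; exists Y; split.
- exact: mutually_independent_comp mg YE iX.
- by move=> k; apply: uniform_on_affine (uX k).
- apply: filterS cX => w cw; rewrite SS'.
  have -> : (fun n => \sum_(0 <= k < n) Y k w) =
      (fun n => c * (\sum_(0 <= k < n) X k w) + series m n).
    apply/funext => n; rewrite mulr_sumr /series/= -big_split/=.
    by apply: eq_bigr => k _; rewrite YE.
  by apply: cvgD => //; apply: cvgM => //; exact: cvg_cst.
Qed.

Lemma eq_is_uniform_sum (R : realType) (d : measure_display)
    (T : measurableType d) (P : probability T R) (a b a' b' : nat -> R)
    (S : {RV P >-> R}) : a =1 a' -> b =1 b' ->
  is_uniform_sum a b S -> is_uniform_sum a' b' S.
Proof. by move=> /funext -> /funext ->. Qed.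

Lemma calS_scale (R : realType) (d : measure_display)
    (T : measurableType d) (P : probability T R) (t : nat -> R) (c : R)
    (S S' : {RV P >-> R}) :
  0 <= c -> (forall w, S' w = c * S w) -> is_calS t S ->
  is_calS (fun k => c * t k) S'.
Proof.
move=> c0 SS' uS.
have m0 : series (fun=> 0 : R) @ \oo --> (0 : R).
  rewrite (_ : series _ = fun=> 0); first exact: cvg_cst.
  by apply/funext => n; rewrite /series/= big1.
have := @uniform_sum_affine R d T P _ _ (fun=> 0) c 0 S S' c0 m0 _ uS.
move=> /(_ (fun w => _)) h; apply: eq_is_uniform_sum (h _).
- by move=> k; rewrite addr0 mulrN mulrA.
- by move=> k; rewrite addr0 mulrA.
- by move=> w; rewrite addr0.
Qed.

Lemma calS_cos (R : realType) (d : measure_display)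
    (T : measurableType d) (P : probability T R) (t : nat -> R) (s z : R)
    (S : {RV P >-> R}) : is_calS t S -> s != 0 ->
  cos z * \prod_(0 <= k < n) sinc (s * t k / 2) @[n --> \oo] -->
  \int[P]_w cos (s * S w + z).
Proof.
move=> [X [iX uX cX]] s0.
apply: cvg_trans (cos_uniform_sum (z := z) iX uX cX s0); apply: near_eq_cvg.
apply: nearW => n; rewrite big1 => [|k _]; last by rewrite addNr mul0r.
rewrite mulr0 add0r; congr (_ * _); apply: eq_bigr => k _.
by congr sinc; congr (_ / _); congr (_ * _); rewrite opprK -splitr.
Qed.

(** At the phase z = pi / 2 - s c the left side of [key] vanishes while [fu s] is positive for small
    s, so sin (s (c - c')) = 0; as s |c - c'| <= 1 < pi, this forces c = c'. The phase z = - s c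
    then turns both cosines into 1 and equates the products at every s > 0. *)
Lemma calS_law_inj (R : realType) (d : measure_display)
    (T : measurableType d) (P : probability T R) (St : {RV P >-> R})
    (d' : measure_display) (T' : measurableType d') (Q : probability T' R)
    (Su : {RV Q >-> R}) (t u : nat -> R) (c c' : R) :
  l2_tilde t -> l2_tilde u -> is_calS t St -> is_calS u Su ->
  law P (fun w => c + St w) = law Q (fun w => c' + Su w) -> c = c' /\ t = u.
Proof.
move=> lt lu cSt cSu eqlaw.
pose ft s := \int[P]_w cos (s * St w + 0).
pose fu s := \int[Q]_w cos (s * Su w + 0).
have ct s : 0 < s -> \prod_(0 <= k < m) sinc (s * t k / 2) @[m --> \oo] --> ft s.
  move=> /lt0r_neq0 s0; have := calS_cos (z := 0) cSt s0.
  by under eq_fun do rewrite cos0 mul1r.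
have cu s : 0 < s -> \prod_(0 <= k < m) sinc (s * u k / 2) @[m --> \oo] --> fu s.
  move=> /lt0r_neq0 s0; have := calS_cos (z := 0) cSu s0.
  by under eq_fun do rewrite cos0 mul1r.
have Et s z : 0 < s -> \int[P]_w cos (s * St w + z) = cos z * ft s.
  move=> s0; apply: cvg_unique (calS_cos (z := z) cSt (lt0r_neq0 s0)) _ => //.
  by apply: cvgM; [exact: cvg_cst|exact: ct].
have Eu s z : 0 < s -> \int[Q]_w cos (s * Su w + z) = cos z * fu s.
  move=> s0; apply: cvg_unique (calS_cos (z := z) cSu (lt0r_neq0 s0)) _ => //.
  by apply: cvgM; [exact: cvg_cst|exact: cu].
have key s z : 0 < s -> cos (s * c + z) * ft s = cos (s * c' + z) * fu s.
  move=> s0; rewrite -Et// -Eu//.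
  have mX (T1 : measurableType _) (X : {mfun T1 >-> R}) e : measurable_fun setT (fun w => e + X w).
    by apply: measurable_funD.
  have mc : measurable_fun setT (EFin \o (fun x => cos (s * x + z))).
    by apply/measurable_EFinP; case: (bounded_mfun_cos s z).
  have := @law_eq_integral R _ _ P _ _ _ Q _ (EFin \o (fun x => cos (s * x + z))) (mX _ _ St c) (mX _ _ Su c') eqlaw mc.
  move=> /(congr1 fine) h; rewrite /Rintegral.
  transitivity (fine (\int[P]_w (EFin \o (fun x => cos (s * x + z))) (c + St w)%R)%E).
    by congr fine; apply: eq_integral => w _ /=; congr (cos _)%:E; ring.
  rewrite h; congr fine; apply: eq_integral => w _ /=; congr (cos _)%:E; ring.
have pos v (f : R -> R) : l2_tilde v ->
    (forall s, 0 < s -> \prod_(0 <= k < m) sinc (s * v k / 2) @[m --> \oo] --> f s) ->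
    forall s, 0 < s -> s * v 0%N <= 2 -> 0 < f s.
  move=> lv cv s s0 sv.
  have spi : s * v 0%N / 2 < pi.
    have h : s * v 0%N / 2 <= 1 by rewrite ler_pdivrMr// mul1r.
    by have := pi_ge2 R; lra.
  have [e e0 He] := sinc_product_lower_bound lv s0 spi.
  apply: (lt_le_trans e0); rewrite -(cvg_lim _ (cv s s0))//.
  apply: limr_ge; first by apply/cvg_ex; eexists; exact: cv.
  by apply: nearW => n; apply: He; rewrite s0 lexx.
have [_ t0 _] := lt; have [_ u0 _] := lu.
pose D := 1 + t 0%N + u 0%N + `|c - c'|.
have D0 : 0 < D by rewrite /D; have := t0 0%N; have := u0 0%N; have := normr_ge0 (c - c'); lra.
pose s := D^-1; have s0 : 0 < s by rewrite invr_gt0.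
have sD x : 0 <= x -> x <= D -> 0 <= s * x <= 1.
  by move=> x0 xD; rewrite mulr_ge0 ?(ltW s0)//= mulrC ler_pdivrMr// mul1r.
have cc : c = c'.
  have fu0 : 0 < fu s.
    have uD : u 0%N <= D by rewrite /D; have := t0 0%N; have := normr_ge0 (c - c'); lra.
    have /andP[_ h] := sD _ (u0 0%N) uD.
    by apply: (pos u) => //; rewrite (le_trans h)// ler1n.
  have := key s (pi / 2 - s * c) s0.
  have -> : s * c + (pi / 2 - s * c) = pi / 2 by ring.
  rewrite cos_pihalf mul0r => /esym/eqP; rewrite mulf_eq0 (gt_eqF fu0) orbF.
  have -> : s * c' + (pi / 2 - s * c) = - (s * (c - c')) + pi / 2 by ring.
  rewrite cosDpihalf oppr_eq0 sinN oppr_eq0 => /eqP h.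
  have /andP[_ h1] : 0 <= s * `|c - c'| <= 1.
    by apply: sD => //; rewrite /D; have := t0 0%N; have := u0 0%N; lra.
  apply/eqP; rewrite -subr_eq0; apply/negPn/negP => ncc.
  have : 0 < sin (s * `|c - c'|).
    apply: sin_gt0_pi; rewrite mulr_gt0 ?normr_gt0//=.
    by have := pi_ge2 R; lra.
  by case: (ger0P (c - c')) => _; rewrite ?mulrN ?sinN h ?oppr0 ltxx.
split => //; apply: (sinc_products_inj lt lu ct) => s' s'0.
suff -> : ft s' = fu s' by exact: cu.
have := key s' (- (s' * c)) s'0; rewrite -cc subrr cos0 !mul1r.
by [].
Qed.

(** * Decreasing rearrangements *)

(** If a positive value remains, the tail lies below it and the maximum is over a finite set.
    Otherwise all remaining values are 0 and any fresh index serves, which keeps the greedy sequence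
    infinite and injective. *)
Lemma argmax_outside (R : realType) (l : nat -> R) (s : seq nat) :
  (forall k, 0 <= l k) -> l @ \oo --> (0 : R) ->
  exists k : nat, k \notin s /\ forall j : nat, j \notin s -> l j <= l k.
Proof.
move=> l0 cl; have [[j js lj]|h] := pselect (exists2 j, j \notin s & 0 < l j).
  have [N _ HN] : \forall n \near \oo, `|0 - l n| < l j.
    exact: (@cvgr_dist_lt _ _ _ _ _ _ _ cl).
  pose M := maxn N j.+1; have jM : (j < M)%N by rewrite leq_maxr.
  have js' : Ordinal jM \in [pred i : 'I_M | (i : nat) \notin s] by rewrite inE.
  have [i iS imax] := @arg_maxP _ _ _ (Ordinal jM) [pred i : 'I_M | (i : nat) \notin s] (fun i : 'I_M => l i) js'.
  exists (nat_of_ord i); split; first exact: iS.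
  move=> k ks; have [kM|Mk] := ltnP k M; first exact: (imax (Ordinal kM)).
  apply: (@le_trans _ _ (l j)); last exact: (imax (Ordinal jM)).
  have := HN k; rewrite /= (leq_trans (leq_maxl N j.+1) Mk) => /(_ isT).
  by rewrite sub0r normrN ger0_norm// => /ltW.
exists (\max_(i <- s) i).+1; split.
  by apply/negP => ks; have := @leq_bigmax_seq _ s xpredT id _ ks isT; rewrite ltnn.
move=> j js; apply: le_trans (l0 _); rewrite leNgt; apply/negP => lj.
by apply: h; exists j.
Qed.

Fixpoint greedy_history (g : seq nat -> nat) (n : nat) : seq nat :=
  if n is m.+1 then g (greedy_history g m) :: greedy_history g m else [::].

(** The greedy choice always takes a largest value not yet used. Surjectivity is claimed only on
    positive values, since zeros are never chosen while positive values remain. *)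
Lemma decreasing_rearrangement (R : realType) (l : nat -> R) :
  (forall k, 0 <= l k) -> l @ \oo --> (0 : R) ->
  exists r : nat -> nat, [/\ injective r, forall n, l (r n.+1) <= l (r n) &
    forall k, 0 < l k -> exists n, r n = k].
Proof.
move=> l0 cl.
pose g s := sval (cid (argmax_outside s l0 cl)).
have gP s : g s \notin s /\ forall j, j \notin s -> l j <= l (g s).
  by rewrite /g; case: cid.
pose hist := greedy_history g.
pose r n := g (hist n).
have rin m n : (m < n)%N -> r m \in hist n.
  elim: n => [//|n IH]; rewrite ltnS leq_eqVlt => /predU1P[->|mn].
    by rewrite /= inE eqxx.
  by rewrite /= inE IH// orbT.
have rnin n : r n \notin hist n by case: (gP (hist n)).
have rI : injective r.
  move=> m n mn; case: (ltngtP m n) => // h.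
    by have := rnin n; rewrite -mn rin.
  by have := rnin m; rewrite mn rin.
exists r; split => //.
- move=> n; have [_ h] := gP (hist n); apply: h.
  by have := rnin n.+1; rewrite /= inE negb_or => /andP[].
- move=> k lk; apply: contrapT => /forallNP nk.
  have nin n : k \notin hist n.
    elim: n => [//|n IH]; rewrite /= inE negb_or IH andbT.
    by apply/eqP => kr; apply: (nk n).
  have [N _ HN] : \forall n \near \oo, `|0 - l n| < l k.
    exact: (@cvgr_dist_lt _ _ _ _ _ _ _ cl).
  (* An index k that is never chosen forces every chosen value to be at least l k, hence every
     chosen index to be below N; but N + 1 distinct indices have been chosen. *)
  have rN n : (r n < N)%N.
    rewrite ltnNge; apply/negP => Nr; have := HN _ Nr.
    rewrite sub0r normrN ger0_norm// ltNge => /negP; apply.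
    by have [_ h] := gP (hist n); exact: h (nin n).
  have hs : {subset map r (iota 0 N.+1) <= iota 0 N}.
    by move=> _ /mapP[i _ ->]; rewrite mem_iota add0n/= rN.
  have hu : uniq (map r (iota 0 N.+1)) by rewrite map_inj_uniq// iota_uniq.
  by have := uniq_leq_size hu hs; rewrite size_map !size_iota ltnn.
Qed.

(** Back in the original order, a rearranged partial sum has 0-1 weights, so its difference from a
    long enough ordinary partial sum is again a 0-1 weighted sum. *)
Lemma sum_image (V : zmodType) (r : nat -> nat) (f : nat -> V) n N :
  injective r -> (forall k, (k < n)%N -> (r k < N)%N) ->
  \sum_(0 <= k < n) f (r k) =
  \sum_(0 <= j < N) (if j \in map r (iota 0 n) then f j else 0).
Proof.
move=> rI rN; rewrite -[RHS]big_mkcond/= -[RHS]big_filter /index_iota !subn0.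
transitivity (\sum_(j <- map r (iota 0 n)) f j); first by rewrite big_map.
apply: perm_big; apply: uniq_perm.
- by rewrite map_inj_uniq// iota_uniq.
- by rewrite filter_uniq// iota_uniq.
- move=> j; rewrite mem_filter mem_iota/= add0n.
  case: (boolP (j \in map r (iota 0 n))) => //= /mapP[k]; rewrite mem_iota/= add0n => kn ->.
  by rewrite rN.
Qed.

Lemma rearrangement_bound (r : nat -> nat) n :
  exists N, forall k, (k < n)%N -> (r k < N)%N.
Proof.
exists (\max_(k < n) r k).+1 => k kn; rewrite ltnS.
exact: (@leq_bigmax _ (fun k : 'I_n => r k) (Ordinal kn)).
Qed.

Lemma sum_rearrangement_le (R : realType) (r : nat -> nat) (f : nat -> R) (L : R) n :
  injective r -> (forall k, 0 <= f k) ->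
  (forall n, \sum_(0 <= k < n) f k <= L) ->
  \sum_(0 <= k < n) f (r k) <= L.
Proof.
move=> rI f0 fL; have [N rN] := rearrangement_bound r n.
rewrite (sum_image f rI rN); apply: le_trans (fL N).
by apply: ler_sum => j _; case: ifP.
Qed.

Lemma sum_rearrangement_ge (R : realType) (r : nat -> nat) (f : nat -> R) N :
  injective r -> (forall k, 0 <= f k) -> (forall k, 0 < f k -> exists n, r n = k) ->
  exists n0, forall n, (n0 <= n)%N ->
    \sum_(0 <= k < N) f k <= \sum_(0 <= k < n) f (r k).
Proof.
move=> rI f0 hit.
have [n0 Hn0] : exists n0, forall k, (k < N)%N -> 0 < f k -> exists2 i, (i < n0)%N & r i = k.
  elim: N => [|N [n0 IH]]; first by exists 0%N.
  have [fN|fN] := boolP (0 < f N).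
    have [i ri] := hit N fN; exists (maxn n0 i.+1) => k.
    rewrite ltnS leq_eqVlt => /predU1P[->|kN] fk.
      by exists i => //; rewrite leq_max ltnSn orbT.
    by have [j jn <-] := IH k kN fk; exists j => //; rewrite leq_max jn.
  exists n0 => k; rewrite ltnS leq_eqVlt => /predU1P[->|kN] fk; last exact: IH.
  by rewrite fk in fN.
exists n0 => n nn; have [M rM] := rearrangement_bound r n.
have rM' k : (k < n)%N -> (r k < maxn M N)%N.
  by move=> /rM rk; rewrite (leq_trans rk)// leq_maxl.
rewrite (sum_image f rI rM').
apply: (@le_trans _ _ (\sum_(0 <= j < N) (if j \in map r (iota 0 n) then f j else 0))).
  rewrite !big_nat; apply: ler_sum => j /andP[_ jN]; case: ifPn => // jr.
  rewrite leNgt; apply/negP => fj; have [i ii ri] := Hn0 j jN fj.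
  move/negP : jr; apply; apply/mapP; exists i => //.
  by rewrite mem_iota/= add0n (leq_trans ii).
rewrite [leRHS](big_cat_nat (leq0n N) (leq_maxr M N))/= lerDl.
by apply: sumr_ge0 => j _; case: ifP.
Qed.

(** * Existence and rearrangement of centered sums *)

Lemma weighted_sum_L2 (R : realType) (d : measure_display)
    (T : measurableType d) (P : probability T R) (X : nat -> {RV P >-> R})
    (C : nat -> R) (e : nat -> bool) n :
  mutually_independent X -> (forall k w, `|X k w| <= C k) ->
  (forall k, \int[P]_w X k w = 0) ->
  (\int[P]_w ((\sum_(0 <= k < n) (if e k then X k w else 0)) ^+ 2)%:E <=
  (\sum_(0 <= k < n) (if e k then C k ^+ 2 else 0))%:E)%E.
Proof.
move=> iX XC X0.
pose E k : R := (e k)%:R.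
have bX k : bounded_mfun (X k) by split => //; exists (C k).
have bS : bounded_mfun (fun w => \sum_(0 <= k < n) E k * X k w).
  by apply: bounded_mfun_sum => k; apply: bounded_mfunM => //; exact: bounded_mfun_cst.
have sE w : \sum_(0 <= k < n) (if e k then X k w else 0) = \sum_(0 <= k < n) E k * X k w.
  by apply: eq_bigr => k _; rewrite /E; case: (e k); rewrite ?mul1r ?mul0r.
under eq_integral do rewrite sE.
rewrite -(@Rintegral_EFin _ _ _ P (fun w => (\sum_(0 <= k < n) E k * X k w) ^+ 2)); last first.
  by under eq_fun do rewrite expr2; exact: bounded_mfunM.
rewrite lee_fin.
apply: (le_trans (@martingale_transform_L2 R d T P X C E (fun k _ => E k) n iX XC X0 _ _)).
- by move=> k; exact: measurable_cst.
- by move=> k w; rewrite /E ger0_norm.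
- by apply: ler_sum => k _; rewrite /E; case: (e k); rewrite ?mul1r// mul0r expr0n.
Qed.

Lemma centered_sum_exists (R : realType) (d : measure_display)
    (T : measurableType d) (P : probability T R) (X : nat -> {RV P >-> R})
    (C : nat -> R) :
  mutually_independent X -> (forall k w, `|X k w| <= C k) ->
  (forall k, \int[P]_w X k w = 0) -> cvgn (series (fun k => C k ^+ 2)) ->
  exists S : {RV P >-> R},
    {ae P, forall w, (fun n => \sum_(0 <= k < n) X k w) @ \oo --> S w}.
Proof.
move=> iX XC X0 cC; apply: ae_limit_exists; last exact: kolmogorov_cvg cC.
by move=> n; exact: adapted_measurable (@adapted_sum _ _ _ _ X n n (leqnn n)).
Qed.

Lemma centered_sum_L2 (R : realType) (d : measure_display)
    (T : measurableType d) (P : probability T R) (X : nat -> {RV P >-> R})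
    (C : nat -> R) (S : {RV P >-> R}) (L : R) :
  mutually_independent X -> (forall k w, `|X k w| <= C k) ->
  (forall k, \int[P]_w X k w = 0) ->
  (forall n, \sum_(0 <= k < n) C k ^+ 2 <= L) ->
  {ae P, forall w, (fun n => \sum_(0 <= k < n) X k w) @ \oo --> S w} ->
  (\int[P]_w (S w ^+ 2)%:E <= L%:E)%E.
Proof.
move=> iX XC X0 CL cS; apply: fatou_sqr cS _ => //.
  by move=> n; exact: adapted_measurable (@adapted_sum _ _ _ _ X n n (leqnn n)).
apply: nearW => n.
have := @weighted_sum_L2 _ _ _ P X C xpredT n iX XC X0.
by move=> /le_trans; apply; rewrite lee_fin.
Qed.

Lemma ae_eq0_sqr (R : realType) (d : measure_display)
    (T : measurableType d) (P : probability T R) (Y : T -> R) :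
  measurable_fun setT Y -> (\int[P]_w (Y w ^+ 2)%:E <= 0)%E ->
  {ae P, forall w, Y w = 0}.
Proof.
move=> mY Y0.
have mY2 : measurable_fun setT (fun w => (Y w ^+ 2)%:E).
  by apply/measurable_EFinP; exact: measurable_funX.
have /(ae_eq_integral_abs _ measurableT mY2) : (\int[P]_w `|(Y w ^+ 2)%:E| = 0)%E.
  apply/eqP; rewrite eq_le integral_ge0// andbT; apply: le_trans Y0.
  rewrite le_eqVlt; apply/orP; left; apply/eqP; apply: eq_integral => w _.
  by rewrite gee0_abs// lee_fin sqr_ge0.
apply: filterS => w /(_ I)/= [] /eqP; rewrite sqrf_eq0.
by move/eqP.
Qed.

(** S minus n rearranged terms is a limit of sums over the omitted indices, so its second moment is
    at most L minus the sum of the [C (r k) ^+ 2]. This tends to 0 because r reaches every positive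
    [C k], and a second use of Fatou gives S - S' second moment 0. *)
Lemma rearranged_sum_ae_eq (R : realType) (d : measure_display)
    (T : measurableType d) (P : probability T R) (X : nat -> {RV P >-> R})
    (C : nat -> R) (r : nat -> nat) (S S' : {RV P >-> R}) :
  mutually_independent X -> (forall k w, `|X k w| <= C k) ->
  (forall k, \int[P]_w X k w = 0) -> cvgn (series (fun k => C k ^+ 2)) ->
  injective r -> (forall k, 0 < C k -> exists n, r n = k) ->
  {ae P, forall w, (fun n => \sum_(0 <= k < n) X k w) @ \oo --> S w} ->
  {ae P, forall w, (fun n => \sum_(0 <= k < n) X (r k) w) @ \oo --> S' w} ->
  {ae P, forall w, S w = S' w}.
Proof.
move=> iX XC X0 cC rI hit cS cS'.
pose s := series (fun k => C k ^+ 2); pose L := limn s.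
have sL n : s n <= L.
  apply: nondecreasing_cvgn_le => //; apply: nondecreasing_series => k _ _.
  exact: sqr_ge0.
have C2 k : 0 <= C k ^+ 2 by exact: sqr_ge0.
have mS n : measurable_fun setT (fun w => \sum_(0 <= k < n) X k w).
  exact: adapted_measurable (@adapted_sum _ _ _ _ X n n (leqnn n)).
have mS' n : measurable_fun setT (fun w => \sum_(0 <= k < n) X (r k) w).
  exact: adapted_measurable (@adapted_sum _ _ _ _ (fun k => X (r k)) n n (leqnn n)).
have step n : (\int[P]_w ((S w - \sum_(0 <= k < n) X (r k) w) ^+ 2)%:E <=
    (L - \sum_(0 <= k < n) C (r k) ^+ 2)%:E)%E.
  apply: (@fatou_sqr _ _ _ P (fun N w => \sum_(0 <= k < N) X k w - \sum_(0 <= k < n) X (r k) w)).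
  - by move=> N; exact: measurable_funB.
  - exact: measurable_funB.
  - by apply: filterS cS => w cw; apply: cvgB => //; exact: cvg_cst.
  have [M rM] := rearrangement_bound r n.
  exists M => // N /= MN.
  have rN k : (k < n)%N -> (r k < N)%N by move=> /rM rk; exact: leq_trans MN.
  pose e k := k \notin map r (iota 0 n).
  have E (V : zmodType) (f : nat -> V) : \sum_(0 <= k < N) f k - \sum_(0 <= k < n) f (r k) =
      \sum_(0 <= k < N) (if e k then f k else 0).
    rewrite (sum_image f rI rN) -sumrB; apply: eq_bigr => k _; rewrite /e.
    by case: (k \in _) => /=; rewrite ?subrr ?subr0.
  under eq_integral do rewrite (E _ (fun k => X k _)).
  apply: (le_trans (@weighted_sum_L2 _ _ _ P X C e N iX XC X0)).
  by rewrite lee_fin -(E _ (fun k => C k ^+ 2)) lerD2r; exact: sL.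
suff h : (\int[P]_w ((S w - S' w) ^+ 2)%:E <= 0)%E.
  have := @ae_eq0_sqr _ _ _ P (fun w => S w - S' w) _ h.
  move=> /(_ (measurable_funB _ _)) h0.
  by apply: filterS (h0 _ _) => // w /eqP; rewrite subr_eq0 => /eqP.
apply/lee_addgt0Pr => e e0; rewrite add0e.
have [N HN] := cvg_series_tail C2 cC e0.
have hit2 k : 0 < C k ^+ 2 -> exists n, r n = k.
  rewrite lt0r sqrf_eq0 => /andP[Ck _]; apply: hit.
  (* That [C k] is nonnegative is read off from the bound on [X k] at an arbitrary outcome. *)
  rewrite lt0r Ck/=; apply: le_trans (XC k point); exact: normr_ge0.
have [n0 Hn0] := @sum_rearrangement_ge R r (fun k => C k ^+ 2) N rI C2 hit2.
apply: (@fatou_sqr _ _ _ P (fun n w => S w - \sum_(0 <= k < n) X (r k) w)).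
- by move=> n; exact: measurable_funB.
- exact: measurable_funB.
- by apply: filterS cS' => w cw; apply: cvgB => //; exact: cvg_cst.
exists n0 => // n /= nn; apply: (le_trans (step n)); rewrite lee_fin lerBlDl.
apply: (@le_trans _ _ (s N + e)); last by rewrite lerD2r; exact: Hn0.
apply: limr_le => //; apply: nearW => m; rewrite /s /series/=.
have [mN|/ltnW Nm] := leqP m N.
  rewrite (@le_trans _ _ (\sum_(0 <= k < N) C k ^+ 2))//; last by rewrite lerDl ltW.
  by rewrite [leRHS](big_cat_nat (leq0n m) mN)/= lerDl sumr_ge0.
by rewrite (big_cat_nat (leq0n N) Nm)/= lerD2l.
Qed.

Lemma ae_nonempty (R : realType) (d : measure_display)
    (T : measurableType d) (P : probability T R) (Q : T -> Prop) :
  {ae P, forall w, Q w} -> exists w, Q w.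
Proof.
move=> [N [mN PN QN]]; apply: contrapT => /forallNP nQ.
have NT : N = setT by apply/seteqP; split => // w _; apply: QN; exact: nQ.
have := @probability_setT _ _ _ P; rewrite -NT PN => /eqP.
by rewrite eq_sym onee_eq0.
Qed.

Lemma cvg_series_half_sqr (R : realType) (t : nat -> R) :
  cvgn (series (fun k => t k ^+ 2)) -> cvgn (series (fun k => (t k / 2) ^+ 2)).
Proof.
move=> ct; have -> : (fun k => (t k / 2) ^+ 2) = 4^-1 *: (fun k => t k ^+ 2).
  by apply/funext => k; rewrite fctE /GRing.scale/=; field.
exact: is_cvg_seriesZ.
Qed.

Lemma centered_uniform (R : realType) (d : measure_display)
    (T : measurableType d) (P : probability T R) (X : {RV P >-> R}) (t : R) :
  uniform_on (- (t / 2)) (t / 2) X -> (forall w, - (t / 2) <= X w <= t / 2) ->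
  (forall w, `|X w| <= t / 2) /\ \int[P]_w X w = 0.
Proof.
move=> uX Xt; split; first by move=> w; rewrite ler_norml.
by rewrite (uniform_on_mean uX Xt) addNr mul0r.
Qed.

Lemma calS_L2 (R : realType) (d : measure_display)
    (T : measurableType d) (P : probability T R) (t : nat -> R) (S : {RV P >-> R}) :
  l2_tilde t -> is_calS t S ->
  exists B : R, (\int[P]_w (S w ^+ 2)%:E <= B%:E)%E.
Proof.
move=> [_ _ ct] /uniform_sum_bounded[X [iX uX cX Xab]].
have h k := centered_uniform (uX k) (Xab k).
have XC k w : `|X k w| <= t k / 2 by case: (h k).
have X0 k : \int[P]_w X k w = 0 by case: (h k).
exists (limn (series (fun k => (t k / 2) ^+ 2))).
apply: (centered_sum_L2 iX XC X0 _ cX) => n.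
apply: nondecreasing_cvgn_le; last exact: cvg_series_half_sqr.
by apply: nondecreasing_series => k _ _; exact: sqr_ge0.
Qed.

Lemma calS_exists (R : realType) (t : nat -> R) : l2_tilde t ->
  exists (d : measure_display) (T : measurableType d) (P : probability T R)
    (S : {RV P >-> R}), is_calS t S.
Proof.
move=> [_ t0 ct]; have [U [iU uU]] := iid_uniform_exists R.
set P := uniform_law _ in U iU uU *.
pose g k (x : R) := t k * x + - (t k / 2).
have mg k : measurable_fun setT (g k).
  by apply: measurable_funD => //; exact: measurable_funM.
pose Y k : {RV P >-> R} := mfun_Sub (mem_set (measurableT_comp (mg k) (@measurable_funP _ _ _ _ _ (U k)))).
have YE k w : Y k w = g k (U k w) by [].
clearbody Y.
have iY : mutually_independent Y := mutually_independent_comp mg YE iU.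
have uY k : uniform_on (- (t k / 2)) (t k / 2) (Y k).
  have := uniform_on_affine (t0 k) (YE k) (uU k).
  have -> : t k * 0 + - (t k / 2) = - (t k / 2) by ring.
  by have -> : t k * 1 + - (t k / 2) = t k / 2 by field.
have [X [iX uX _ Xab]] := uniform_seq_bounded iY uY.
have h k := centered_uniform (uX k) (Xab k).
have XC k w : `|X k w| <= t k / 2 by case: (h k).
have X0 k : \int[P]_w X k w = 0 by case: (h k).
have [S cS] := centered_sum_exists iX XC X0 (cvg_series_half_sqr ct).
by exists _, _, P, S, X; split.
Qed.

(** * Finite variance forces square-summable lengths *)

Lemma variance_integral (R : realType) (d : measure_display)
    (T : measurableType d) (P : probability T R) (X : T -> R) :
  ('V_P[X] = \int[P]_w ((X w - fine 'E_P[X]) ^+ 2)%:E)%E.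
Proof.
rewrite /variance unlock; set m := fine _; rewrite unlock.
by apply: eq_integral => w _; rewrite expr2.
Qed.

Lemma expectation_integral (R : realType) (d : measure_display)
    (T : measurableType d) (P : probability T R) (X : T -> R) :
  ('E_P[X] = \int[P]_w (X w)%:E)%E.
Proof. by rewrite unlock. Qed.

Lemma L2_sqr_integrable (R : realType) (d : measure_display)
    (T : measurableType d) (P : probability T R) (S : T -> R) (B : R) :
  measurable_fun setT S -> (\int[P]_w (S w ^+ 2)%:E <= B%:E)%E ->
  P.-integrable setT (fun w => (S w ^+ 2)%:E).
Proof.
move=> mS SB; apply/integrableP; split.
  by apply/measurable_EFinP; exact: measurable_funX.
apply: le_lt_trans (ltry B); apply: le_trans SB.
rewrite le_eqVlt; apply/orP; left; apply/eqP; apply: eq_integral => w _.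
by rewrite gee0_abs// lee_fin sqr_ge0.
Qed.

Lemma L2_integrable (R : realType) (d : measure_display)
    (T : measurableType d) (P : probability T R) (S : T -> R) (B : R) :
  measurable_fun setT S -> (\int[P]_w (S w ^+ 2)%:E <= B%:E)%E ->
  P.-integrable setT (EFin \o S).
Proof.
move=> mS /(L2_sqr_integrable mS) iS.
have i1 : P.-integrable setT (EFin \o (fun=> 1 : R)).
  by apply: bounded_mfun_integrable; exact: bounded_mfun_cst.
apply: le_integrable (integrableD measurableT iS i1) => //.
  exact/measurable_EFinP.
move=> w _; change (`|S w|%:E <= `|S w ^+ 2 + 1|%:E)%E.
rewrite lee_fin [leRHS]ger0_norm ?addr_ge0 ?sqr_ge0//.
rewrite -[S w ^+ 2]real_normK ?num_real//.
have [h|/ltW h] := lerP `|S w| 1; first by rewrite (le_trans h)// lerDr sqr_ge0.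
by rewrite expr2 (@le_trans _ _ (`|S w| * `|S w|)) ?lerDl// ler_peMr.
Qed.

Lemma L2_variance_lty (R : realType) (d : measure_display)
    (T : measurableType d) (P : probability T R) (S : T -> R) (B : R) :
  measurable_fun setT S -> (\int[P]_w (S w ^+ 2)%:E <= B%:E)%E ->
  ('V_P[S] < +oo)%E.
Proof.
move=> mS /(L2_sqr_integrable mS) iS; rewrite variance_integral.
set m := fine _.
have i1 : P.-integrable setT (EFin \o (fun=> 2 * m ^+ 2 : R)).
  by apply: bounded_mfun_integrable; exact: bounded_mfun_cst.
have i2 := integrableD measurableT (integrableZl measurableT 2 iS) i1.
apply: (@le_lt_trans _ _ (\int[P]_w (2%:E * (S w ^+ 2)%:E + (2 * m ^+ 2)%:E)))%E.
  apply: ge0_le_integral => //.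
  - by move=> w _; rewrite lee_fin sqr_ge0.
  - by apply/measurable_EFinP; apply: measurable_funX; exact: measurable_funB.
  - by case/integrableP: i2.
  - move=> w _; rewrite -EFinM -EFinD lee_fin.
    by have := sqr_ge0 (S w + m); rewrite !expr2; lra.
have /integrableP[_] := i2; apply: le_lt_trans; apply: ge0_le_integral => //.
- move=> w _; rewrite -EFinM -EFinD lee_fin.
  by rewrite addr_ge0// mulr_ge0// sqr_ge0.
- by case/integrableP: i2.
- by apply: measurableT_comp => //; case/integrableP: i2.
- by move=> w _; exact: lee_abs.
Qed.

Lemma uniform_sum_l2 (R : realType) (d : measure_display)
    (T : measurableType d) (P : probability T R) (a b : nat -> R)
    (S : {RV P >-> R}) :
  is_uniform_sum a b S -> ('V_P[S] < +oo)%E ->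
  cvgn (series (fun k => (b k - a k) ^+ 2)).
Proof.
move=> [X [iX uX cX]]; rewrite variance_integral; set m := fine _ => Voo.
pose l k := b k - a k.
have l0 k : 0 <= l k by rewrite subr_ge0; case: (uX k).
have mSm : measurable_fun setT (fun w => S w - m) by exact: measurable_funB.
have V0 : (0 <= \int[P]_w ((S w - m) ^+ 2)%:E)%E.
  by apply: integral_ge0 => w _; rewrite lee_fin sqr_ge0.
pose V := fine (\int[P]_w ((S w - m) ^+ 2)%:E)%E.
have VE : (\int[P]_w ((S w - m) ^+ 2)%:E = V%:E)%E by rewrite fineK// ge0_fin_numE.
have iV : P.-integrable setT (fun w => ((S w - m) ^+ 2)%:E).
  by apply: (@L2_sqr_integrable _ _ _ P (fun w => S w - m) V mSm); rewrite VE.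
have V00 : 0 <= V by rewrite fine_ge0.
suff bnd n : \sum_(0 <= k < n) l k ^+ 2 <= 128 * V.
  apply: nondecreasing_is_cvgn.
    by apply: nondecreasing_series => k _ _; exact: sqr_ge0.
  by exists (128 * V) => _ [n _ <-]; exact: bnd.
(* With s = 1 / D all of s, s V and s l_k for k < n are at most 1. Thus s depends on n, but it
   cancels from the final bound 128 V. *)
pose D := 1 + V + \sum_(0 <= k < n) l k.
have sl : 0 <= \sum_(0 <= k < n) l k by apply: sumr_ge0.
have D1 : 1 <= D by rewrite /D; lra.
have D0 : 0 < D by lra.
pose s := D^-1.
have s0 : 0 < s by rewrite invr_gt0.
have s1 : s <= 1 by rewrite invf_le1.
have sx x : 0 <= x -> x <= D -> s * x <= 1.
  by move=> x0 xD; rewrite mulrC ler_pdivrMr// mul1r.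
have sl1 k : (k < n)%N -> 0 <= s * l k / 2 <= 1.
  move=> kn; have lD : l k <= D.
    have : l k <= \sum_(0 <= j < n) l j.
      rewrite (big_cat_nat (leq0n k) (ltnW kn))/= [X in _ + X]big_ltn// addrCA lerDl.
      by rewrite addr_ge0// sumr_ge0.
    by rewrite /D; lra.
  by have := sx _ (l0 k) lD; have := mulr_ge0 (ltW s0) (l0 k); lra.
(* The characteristic function of S - m is at least 1 - s^2 V / 2 ... *)
have lo : 1 - s ^+ 2 * V / 2 <= \int[P]_w cos (s * S w + - (s * m)).
  have bc : bounded_mfun (fun w => cos (s * S w + - (s * m))).
    exact: (bounded_mfun_comp (bounded_mfun_cos s (- (s * m)))).
  have i1 : P.-integrable setT (EFin \o (fun=> 1 : R)).
    by apply: bounded_mfun_integrable; exact: bounded_mfun_cst.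
  have i2 : P.-integrable setT (EFin \o (fun w => s ^+ 2 / 2 * (S w - m) ^+ 2)).
    by apply: eq_integrable (integrableZl measurableT (s ^+ 2 / 2) iV).
  have -> : 1 - s ^+ 2 * V / 2 = \int[P]_w (1 - s ^+ 2 / 2 * (S w - m) ^+ 2).
    rewrite RintegralB// Rintegral_prob_cst RintegralZl// /Rintegral VE/=.
    by ring.
  apply: le_Rintegral => //.
  - by apply: eq_integrable (integrableB measurableT i1 i2).
  - exact: bounded_mfun_integrable.
  - move=> w _; have := cos_ge_quadratic (s * S w + - (s * m)).
    by congr (_ <= _); field.
(* ... and at most the modulus of any partial product of sincs. *)
have up : \int[P]_w cos (s * S w + - (s * m)) <= \prod_(0 <= k < n) `|sinc (s * l k / 2)|.
  apply: (le_trans (ler_norm _)).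
  apply: (cvg_norm_le (cos_uniform_sum (z := - (s * m)) iX uX cX (lt0r_neq0 s0)) (N := n)) => j nj.
  rewrite normrM -[leRHS]mul1r ler_pM ?cos_max//.
  rewrite (big_cat_nat (leq0n n) nj)/= normrM -normr_prod -[leRHS]mulr1 ler_pM//.
  by rewrite normr_prod; apply: prodr_ile1 => k _; rewrite normr_ge0 norm_sinc_le1.
(* The quadratic upper bound for sinc at s l_k / 2: the factor 32 times the square of 2. *)
pose A k := s ^+ 2 * l k ^+ 2 / 128.
have le3 : \prod_(0 <= k < n) `|sinc (s * l k / 2)| <= \prod_(0 <= k < n) (1 - A k).
  rewrite !big_nat; apply: ler_prod => k /andP[_ kn]; rewrite normr_ge0/=.
  have h := sl1 k kn; have /andP[h0 h1] := h.
  rewrite ger0_norm; last first.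
    apply: le_trans (sinc_ge_quadratic h0).
    have : (s * l k / 2) ^+ 2 <= 1 by rewrite expr_le1.
    lra.
  apply: le_trans (sinc_le_quadratic h) _.
  by rewrite lerD2l lerN2 /A le_eqVlt; apply/orP; left; apply/eqP; field.
have A01 k : (k < n)%N -> 0 <= A k <= 1.
  move=> kn; have /andP[h0 h1] := sl1 k kn.
  have : (s * l k / 2) ^+ 2 <= 1 by rewrite expr_le1.
  have -> : A k = (s * l k / 2) ^+ 2 / 32 by rewrite /A; field.
  by have := sqr_ge0 (s * l k / 2); lra.
have := prod_one_minus_le A01.
set Q := \prod_(0 <= k < n) (1 - A k) in le3 *.
have -> : \sum_(0 <= k < n) A k = s ^+ 2 / 128 * \sum_(0 <= k < n) l k ^+ 2.
  by rewrite mulr_sumr; apply: eq_bigr => k _; rewrite /A; ring.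
set W := \sum_(0 <= k < n) l k ^+ 2.
have W0 : 0 <= W by apply: sumr_ge0 => k _; exact: sqr_ge0.
have Qlo : 1 - s ^+ 2 * V / 2 <= Q := le_trans lo (le_trans up le3).
move=> h.
have s20 : 0 < s ^+ 2 by rewrite exprn_gt0.
have sV : s ^+ 2 * V <= 1.
  apply: (@le_trans _ _ (s * V)).
    by rewrite expr2 -mulrA ler_piMl// mulr_ge0// ltW.
  by apply: sx => //; rewrite /D; lra.
have : (1 - s ^+ 2 * V / 2) * (1 + s ^+ 2 / 128 * W) <= 1.
  apply: le_trans h; rewrite ler_wpM2r// addr_ge0// mulr_ge0// divr_ge0// ltW//.
move: s20 sV; set q := s ^+ 2; move: (q) => {}q q0 qV hq.
(* With q = s^2 the product inequality rearranges so that one factor q cancels. As q V <= 1, the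
   bracket is at least 1/2, whence W <= 128 V. *)
have : q * (W / 128) * (1 - q * V / 2) <= q * (V / 2) by lra.
rewrite -mulrA ler_pM2l// => h2.
have : W / 128 * 2^-1 <= W / 128 * (1 - q * V / 2).
  by rewrite ler_wpM2l ?divr_ge0//; lra.
lra.
Qed.

(** * Surjectivity and standardization *)

Lemma uniform_sum_canonical_form (R : realType) (d : measure_display)
    (T : measurableType d) (P : probability T R) (a b : nat -> R)
    (S : {RV P >-> R}) :
  is_uniform_sum a b S -> ('V_P[S] < +oo)%E ->
  exists (c : R) (t : nat -> R) (S' : {RV P >-> R}),
    [/\ l2_tilde t, is_calS t S' & law P S = law P (fun w => c + S' w)].
Proof.
move=> uS Voo; pose l k := b k - a k.
have cl : cvgn (series (fun k => l k ^+ 2)) by exact: uniform_sum_l2 uS Voo.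
have [X [iX uX cX Xab]] := uniform_sum_bounded uS.
have l0 k : 0 <= l k by rewrite subr_ge0; case: (uX k).
pose m k := (a k + b k) / 2.
pose g k (x : R) := 1 * x + - m k.
have mg k : measurable_fun setT (g k).
  by apply: measurable_funD => //; exact: measurable_funM.
pose Z k : {RV P >-> R} := mfun_Sub (mem_set (measurableT_comp (mg k) (@measurable_funP _ _ _ _ _ (X k)))).
have ZE k w : Z k w = g k (X k w) by [].
clearbody Z.
have iZ : mutually_independent Z := mutually_independent_comp mg ZE iX.
have al k : 1 * a k + - m k = - (l k / 2) by rewrite /m /l; field.
have bl k : 1 * b k + - m k = l k / 2 by rewrite /m /l; field.
have uZ k : uniform_on (- (l k / 2)) (l k / 2) (Z k).
  by rewrite -al -bl; apply: uniform_on_affine (uX k).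
have Zab k w : - (l k / 2) <= Z k w <= l k / 2.
  by rewrite -al -bl ZE /g !mul1r !lerD2r.
have h k := centered_uniform (uZ k) (Zab k).
have ZC k w : `|Z k w| <= l k / 2 by case: (h k).
have Z0 k : \int[P]_w Z k w = 0 by case: (h k).
have cC := cvg_series_half_sqr cl.
have [S0 cS0] := centered_sum_exists iZ ZC Z0 cC.
(* The original and the centered partial sums differ by the deterministic [series m], so a single
   outcome at which both converge proves its convergence and yields c. *)
have [w0 [c1 c2]] : exists w,
    ((fun n => \sum_(0 <= k < n) X k w) @ \oo --> S w) /\
    ((fun n => \sum_(0 <= k < n) Z k w) @ \oo --> S0 w).
  by apply: ae_nonempty; apply: filterS2 cX cS0.
pose c := S w0 - S0 w0.
have sumE w n : \sum_(0 <= k < n) X k w - \sum_(0 <= k < n) Z k w = series m n.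
  rewrite -sumrB; apply: eq_bigr => k _; rewrite ZE /g; ring.
have cm : series m @ \oo --> c.
  rewrite (_ : series m = (fun n => \sum_(0 <= k < n) X k w0 - \sum_(0 <= k < n) Z k w0)).
    by apply: cvgB.
  by apply/funext => n; rewrite (sumE w0).
have SS0 : {ae P, forall w, S w = c + S0 w}.
  apply: filterS2 cX cS0 => w h1 h2.
  have h3 : (fun n => \sum_(0 <= k < n) X k w) @ \oo --> c + S0 w.
    rewrite (_ : (fun n => _) = (fun n => series m n + \sum_(0 <= k < n) Z k w)).
      by apply: cvgD.
    by apply/funext => n; rewrite -(sumE w) subrK.
  exact: cvg_unique h1 h3.
have cl0 : l @ \oo --> (0 : R).
  apply/cvgrPdist_lt => e e0; have e20 : 0 < e ^+ 2 by rewrite exprn_gt0.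
  have /cvgrPdist_lt /(_ _ e20) := cvg_series_cvg_0 cl.
  apply: filterS => k; rewrite !sub0r !normrN normrX => h3.
  by rewrite -(@ltr_pXn2r _ 2)// nnegrE ?normr_ge0// ltW.
have [r [rI rdec rhit]] := decreasing_rearrangement l0 cl0.
pose t k := l (r k).
have lt : l2_tilde t.
  split => [k|k|]; [exact: rdec|exact: l0|]; apply: nondecreasing_is_cvgn.
    by apply: nondecreasing_series => k _ _; exact: sqr_ge0.
  exists (limn (series (fun k => l k ^+ 2))) => _ [n _ <-].
  apply: (@sum_rearrangement_le R r (fun k => l k ^+ 2)) => // [k|j]; first exact: sqr_ge0.
  apply: nondecreasing_cvgn_le => //; apply: nondecreasing_series => k _ _.
  exact: sqr_ge0.
have ct : cvgn (series (fun k => t k ^+ 2)) by case: lt.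
have iY : mutually_independent (fun k => Z (r k)).
  exact: mutually_independent_reindex iZ.
have [S' cS'] := centered_sum_exists iY (fun k => ZC (r k)) (fun k => Z0 (r k)) (cvg_series_half_sqr ct).
exists c, t, S'; split => //.
  by exists (fun k => Z (r k)); split => // k; exact: uZ.
have S0S' : {ae P, forall w, S0 w = S' w}.
  apply: (rearranged_sum_ae_eq iZ ZC Z0 cC rI _ cS0 cS').
  by move=> k lk; apply: rhit; move: lk; rewrite pmulr_lgt0.
apply/law_eq_measure => A mA; apply: ae_eq_law => //.
  exact: measurable_funD.
by apply: filterS2 SS0 S0S' => w -> ->.
Qed.

(** One realization makes the set of laws nonempty and uniqueness of the law makes it a singleton,
    so the definite description is proper. *)
Lemma shifted_calS_lawE (R : realType) (d : measure_display)
    (T : measurableType d) (P : probability T R) (c : R) (t : nat -> R)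
    (S : {RV P >-> R}) :
  is_calS t S -> shifted_calS_law c t = law P (fun w => c + S w).
Proof.
move=> cS; rewrite /shifted_calS_law; set A := [set m | _].
have A1 : A (law P (fun w => c + S w)).
  apply/seteqP; split; last by move=> _ ->; exists d, T, P, S.
  move=> _ [d' [T' [P' [S' [cS' ->]]]]] /=.
  have := uniform_sum_law_unique cS' cS.
  apply: (law_comp (g := fun x => c + x)); exact: measurable_funD.
have h : shifted_calS_laws c t = [set xget (fun=> 0%E) A] :=
  @xgetPex _ (fun=> 0%E) A (ex_intro _ _ A1).
have : shifted_calS_laws c t (xget (fun=> 0%E) A) by rewrite h.
by rewrite (A1 : shifted_calS_laws c t = [set _]).
Qed.

Lemma l2_tilde_scale (R : realType) (t : nat -> R) (c : R) :
  0 <= c -> l2_tilde t -> l2_tilde (fun k => c * t k).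
Proof.
move=> c0 [dt t0 ct]; split => [k|k|]; first by rewrite ler_wpM2l.
  exact: mulr_ge0.
rewrite (_ : (fun k => _) = c ^+ 2 *: (fun k => t k ^+ 2)).
  by apply: is_cvg_seriesZ.
by apply/funext => k; rewrite exprMn.
Qed.

Lemma calS_moments (R : realType) (d : measure_display)
    (T : measurableType d) (P : probability T R) (t : nat -> R) (S : {RV P >-> R}) :
  l2_tilde t -> is_calS t S ->
  P.-integrable setT (EFin \o S) /\ ('V_P[S] < +oo)%E.
Proof.
move=> lt cS; have [B SB] := calS_L2 lt cS.
by split; [exact: L2_integrable SB|exact: L2_variance_lty SB].
Qed.

(* A vanishing variance would give S_t the law of a constant, contradicting
   injectivity. *)
Lemma calS_variance_gt0 (R : realType) (d : measure_display)
    (T : measurableType d) (P : probability T R) (t : nat -> R) (S : {RV P >-> R}) :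
  l2_tilde t -> is_calS t S -> t <> (fun=> 0) -> 0 < fine 'V_P[S].
Proof.
move=> lt cS tn0; have [iS Voo] := calS_moments lt cS.
rewrite lt0r fine_ge0 ?variance_ge0// andbT; apply/eqP => V0; apply: tn0.
set m := fine 'E_P[S].
have VE : (\int[P]_w ((S w - m) ^+ 2)%:E <= 0)%E.
  rewrite -variance_integral -[leLHS]fineK ?V0//.
  by rewrite ge0_fin_numE// variance_ge0.
have mSm : measurable_fun setT (fun w => S w - m) by exact: measurable_funB.
have Sm := ae_eq0_sqr mSm VE.
(* The constant 0 realizes the sum with parameters [0 * t k], so the almost sure identity S = m
   gives S and m + Z the same law. *)
pose Z : {RV P >-> R} := mfun_Sub (mem_set (@measurable_cst _ _ T R setT 0)).
have Z0 w : Z w = 0 by [].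
have cZ : is_calS (fun k => 0 * t k) Z.
  by apply: calS_scale cS => // w; rewrite mul0r.
have [|_ ->] := calS_law_inj (c := 0) (c' := m) lt (l2_tilde_scale (lexx 0) lt) cS cZ; last first.
  by apply/funext => k; rewrite mul0r.
apply/law_eq_measure => A mA; apply: ae_eq_law => //.
- exact: measurable_funD.
- exact: measurable_funD.
- by apply: filterS Sm => w /eqP; rewrite subr_eq0 Z0 add0r addr0 => /eqP.
Qed.

Lemma standardize_law (R : realType) (d : measure_display)
    (T : measurableType d) (P : probability T R) (X : {RV P >-> R})
    (d' : measure_display) (T' : measurableType d') (Q : probability T' R)
    (Y : {RV Q >-> R}) :
  law P X = law Q Y -> law P (standardize P X) = law Q (standardize Q Y).
Proof.
move=> XY.
have EE : 'E_P[X]%E = 'E_Q[Y]%E.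
  by rewrite !expectation_integral; apply: (law_eq_integral (f := EFin)).
have VV : 'V_P[X]%E = 'V_Q[Y]%E.
  rewrite !variance_integral EE.
  apply: (law_eq_integral (f := fun x => ((x - fine 'E_Q[Y]%E) ^+ 2)%:E)) => //.
  by apply/measurable_EFinP; apply: measurable_funX; exact: measurable_funB.
rewrite /standardize EE VV.
apply: (law_comp (g := fun x => (x - fine 'E_Q[Y]%E) / Num.sqrt (fine 'V_Q[Y]%E))) => //.
by apply: measurable_funM => //; exact: measurable_funB.
Qed.

Lemma standardize_scale (R : realType) (d : measure_display)
    (T : measurableType d) (P : probability T R) (X Y : {RV P >-> R}) (c : R) :
  0 < c -> P.-integrable setT (EFin \o X) -> ('V_P[X] < +oo)%E ->
  (forall w, Y w = c * X w) -> standardize P Y = standardize P X.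
Proof.
move=> c0 iX Voo YX; apply/funext => w; rewrite /standardize.
have EY : fine 'E_P[Y]%E = c * fine 'E_P[X]%E.
  rewrite !expectation_integral.
  have := @RintegralZl _ _ _ P setT X c measurableT iX; rewrite /Rintegral => <-.
  by congr fine; apply: eq_integral => z _; rewrite YX.
have VY : fine 'V_P[Y]%E = c ^+ 2 * fine 'V_P[X]%E.
  rewrite !variance_integral EY; set m := fine 'E_P[X]%E.
  have mXm : measurable_fun setT (fun w => X w - m) by exact: measurable_funB.
  have iV : P.-integrable setT (EFin \o (fun w => (X w - m) ^+ 2)).
    apply: (@L2_sqr_integrable _ _ _ P (fun w => X w - m) (fine 'V_P[X]%E) mXm).
    by rewrite -variance_integral fineK// ge0_fin_numE// variance_ge0.
  have := @RintegralZl _ _ _ P setT (fun w => (X w - m) ^+ 2) (c ^+ 2) measurableT iV.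
  rewrite /Rintegral => <-; congr fine; apply: eq_integral => z _.
  by rewrite YX -mulrBr exprMn.
rewrite EY VY YX sqrtrM ?sqr_ge0// sqrtr_sqr gtr0_norm// -mulrBr.
by rewrite invfM mulrACA divff ?mul1r// gt_eqF.
Qed.

Lemma shifted_calS_generalized (R : realType) (d : measure_display)
    (T : measurableType d) (P : probability T R) (c : R) (t : nat -> R)
    (S : {RV P >-> R}) :
  l2_tilde t -> is_calS t S ->
  generalized_uniform_sum_laws (law P (fun w => c + S w)).
Proof.
move=> lt cS.
have mS : measurable_fun setT (fun w => c + S w) by exact: measurable_funD.
pose S' : {RV P >-> R} := mfun_Sub (mem_set mS).
have S'E w : S' w = c + S w by [].
clearbody S'.
(* The whole translation is put into the first summand. *)
pose m k : R := if k is 0%N then c else 0.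
have cm : series m @ \oo --> c.
  apply: (@cvg_trans _ ((fun=> c) @ \oo)); last exact: cvg_cst.
  apply: near_eq_cvg; near=> n.
  have : (0 < n)%N by near: n; exact: nbhs_infty_gt.
  by move=> n0; rewrite /series/= big_ltn// big_nat big1 ?addr0// => -[].
have [B SB] := calS_L2 lt cS.
have S'B : (\int[P]_w (S' w ^+ 2)%:E <= (2 * c ^+ 2 + 2 * B)%:E)%E.
  have iS := L2_sqr_integrable (@measurable_funP _ _ _ _ _ S) SB.
  have i1 : P.-integrable setT (EFin \o (fun=> 2 * c ^+ 2 : R)).
    by apply: bounded_mfun_integrable; exact: bounded_mfun_cst.
  have i2 := integrableZl measurableT 2 iS.
  apply: (@le_trans _ _ (\int[P]_w ((2 * c ^+ 2)%:E + 2%:E * (S w ^+ 2)%:E)))%E.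
    apply: ge0_le_integral => //.
    - by move=> w _; rewrite lee_fin sqr_ge0.
    - by apply/measurable_EFinP; exact: measurable_funX.
    - by case/integrableP: (integrableD measurableT i1 i2).
    - move=> w _; rewrite -EFinM -EFinD lee_fin S'E.
      by have := sqr_ge0 (c - S w); rewrite !expr2; lra.
  rewrite (integralD measurableT i1 i2) integralZl// [leRHS]EFinD; apply: leeD.
    by rewrite integral_cst// -[leRHS]mule1 lee_wpmul2l ?probability_le1// lee_fin mulr_ge0// sqr_ge0.
  by rewrite EFinM lee_wpmul2l// lee_fin.
exists d, T, P, (fun k => 1 * - (t k / 2) + m k), (fun k => 1 * (t k / 2) + m k), S'; split.
- by apply: uniform_sum_affine cm _ cS => // w; rewrite S'E mul1r addrC.
- exact: L2_integrable S'B.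
- exact: L2_variance_lty S'B.
- by congr law; apply/funext => w; rewrite S'E.
Unshelve. all: by end_near.
Qed.

(** Up to a shift, the standardized sum is the sum with parameters t / s, where s is the standard
    deviation. Injectivity gives t / s = u / s', so the multiplier is s' / s. *)
Lemma calS_standardize_inj (R : realType) (d : measure_display)
    (T : measurableType d) (P : probability T R) (St : {RV P >-> R})
    (d' : measure_display) (T' : measurableType d') (Q : probability T' R)
    (Su : {RV Q >-> R}) (t u : nat -> R) :
  l2_tilde t -> l2_tilde u -> t <> (fun=> 0) -> u <> (fun=> 0) ->
  is_calS t St -> is_calS u Su ->
  law P (standardize P St) = law Q (standardize Q Su) ->
  exists lambda : R, u = (fun k => lambda * t k).
Proof.
move=> lt lu tn0 un0 cSt cSu.
have [vt vu] := (calS_variance_gt0 lt cSt tn0, calS_variance_gt0 lu cSu un0).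
rewrite /standardize; set m := fine 'E_P[St]%E; set m' := fine 'E_Q[Su]%E.
set s := Num.sqrt _; set s' := Num.sqrt _.
have s0 : 0 < s by rewrite sqrtr_gt0.
have s'0 : 0 < s' by rewrite sqrtr_gt0.
have mt : measurable_fun setT (fun w => s^-1 * St w) by exact: measurable_funM.
have mu : measurable_fun setT (fun w => s'^-1 * Su w) by exact: measurable_funM.
pose S1 : {RV P >-> R} := mfun_Sub (mem_set mt).
pose S2 : {RV Q >-> R} := mfun_Sub (mem_set mu).
have S1E w : S1 w = s^-1 * St w by [].
have S2E w : S2 w = s'^-1 * Su w by [].
clearbody S1 S2.
have sV : 0 <= s^-1 by rewrite invr_ge0 ltW.
have s'V : 0 <= s'^-1 by rewrite invr_ge0 ltW.
have c1 := calS_scale sV S1E cSt; have c2 := calS_scale s'V S2E cSu.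
rewrite (_ : (fun w => (St w - m) / s) = fun w => - m / s + S1 w); last first.
  by apply/funext => w; rewrite S1E; ring.
rewrite (_ : (fun w => (Su w - m') / s') = fun w => - m' / s' + S2 w); last first.
  by apply/funext => w; rewrite S2E; ring.
move=> /(calS_law_inj (l2_tilde_scale sV lt) (l2_tilde_scale s'V lu) c1 c2)[_ tu].
exists (s' * s^-1); apply/funext => k.
have := congr1 (fun f => f k) tu => /= h.
by rewrite -mulrA h mulrA divff ?mul1r// gt_eqF.
Qed.

Lemma calS_standardize_scale (R : realType) (d : measure_display)
    (T : measurableType d) (P : probability T R) (St : {RV P >-> R})
    (d' : measure_display) (T' : measurableType d') (Q : probability T' R)
    (Su : {RV Q >-> R}) (t : nat -> R) (c : R) :
  l2_tilde t -> 0 < c -> is_calS t St -> is_calS (fun k => c * t k) Su ->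
  law P (standardize P St) = law Q (standardize Q Su).
Proof.
move=> lt c0 cSt cSu; have [iS Voo] := calS_moments lt cSt.
have mt : measurable_fun setT (fun w => c * St w) by exact: measurable_funM.
pose S1 : {RV P >-> R} := mfun_Sub (mem_set mt).
have S1E w : S1 w = c * St w by [].
clearbody S1.
rewrite -(standardize_scale c0 iS Voo S1E); apply: standardize_law.
exact: uniform_sum_law_unique (calS_scale (ltW c0) S1E cSt) cSu.
Qed.

Theorem theorem3p13 (R : realType) :
  [/\ set_bij ([set: R] `*` @l2_tilde R) (@generalized_uniform_sum_laws R)
        (fun ct : R * (nat -> R) => shifted_calS_law ct.1 ct.2),
      forall t u : nat -> R, l2_tilde t -> l2_tilde u -> t <> u ->
        forall (d : measure_display) (T : measurableType d)
          (P : probability T R) (St : {RV P >-> R})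
          (d' : measure_display) (T' : measurableType d')
          (Q : probability T' R) (Su : {RV Q >-> R}),
          is_calS t St -> is_calS u Su -> law P St <> law Q Su &
      forall t u : nat -> R, l2_tilde t -> l2_tilde u ->
        t <> (fun=> 0) -> u <> (fun=> 0) ->
        forall (d : measure_display) (T : measurableType d)
          (P : probability T R) (St : {RV P >-> R})
          (d' : measure_display) (T' : measurableType d')
          (Q : probability T' R) (Su : {RV Q >-> R}),
          is_calS t St -> is_calS u Su ->
          (law P (standardize P St) = law Q (standardize Q Su) <->
           exists lambda : R, u = (fun k => lambda * t k))].
Proof.
split.
- split.
  + move=> [c t] [_ /= lt]; have [d [T [P [S cS]]]] := calS_exists lt.
    by rewrite (shifted_calS_lawE c cS); exact: (shifted_calS_generalized c lt cS).
  + move=> [c t] [c' u] /set_mem[_ /= lt] /set_mem[_ /= lu].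
    have [d [T [P [S cS]]]] := calS_exists lt.
    have [d' [T' [P' [S' cS']]]] := calS_exists lu.
    rewrite (shifted_calS_lawE c cS) (shifted_calS_lawE c' cS').
    by move=> /(calS_law_inj lt lu cS cS')[-> ->].
  + move=> _ [d [T [P [a [b [S [uS _ Voo ->]]]]]]].
    have [c [t [S' [lt cS' ->]]]] := uniform_sum_canonical_form uS Voo.
    by exists (c, t) => //=; exact: shifted_calS_lawE.
- move=> t u lt lu tu d T P St d' T' Q Su cSt cSu eqlaw; apply: tu.
  have [] // := calS_law_inj (c := 0) (c' := 0) lt lu cSt cSu.
  by apply: (law_comp (g := fun x => 0 + x)) => //; exact: measurable_funD.
- move=> t u lt lu tn0 un0 d T P St d' T' Q Su cSt cSu; split.
    exact: calS_standardize_inj cSt cSu.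
  move=> [c uE]; subst u; apply: (calS_standardize_scale lt _ cSt cSu).
  have [_ t0 _] := lt; have [_ u0 _] := lu.
  (* The multiplier is arbitrary in the statement, but a nonpositive one would make the nonnegative
     sequence u vanish. *)
  rewrite ltNge; apply/negP => c0; apply: un0; apply/funext => k.
  by apply/eqP; rewrite eq_le u0 andbT mulr_le0_ge0.
Qed.
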